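(* Let $\rho\in(0,1)$, $d\ge2$, $c\in\{0,1,\dots,d-1\}$, and consider the FA-1f model in dimension $d$ at density $\rho$ with boundary condition of dimension $c$. There exist $\alpha_0<0$ and a sequence $\gamma_N$ with $\lim_{N\to\infty}\gamma_N=0$ such that for every $\alpha>\alpha_0$ $$\varphi_d(\alpha)=\mathbb A\,\alpha,$$ $$\lim_{N\to\infty}\lim_{T\to\infty}\mu^{N,d}_{\alpha,T}\Big(\int_0^Tdt\,\Big|\sum_{i\in\Lambda_N^d}\eta_i(t)-N^d\rho\Big|\le\gamma_NN^dT\Big)=1,$$ $$\lim_{N\to\infty}\lim_{T\to\infty}\mu^{N,d}_{\alpha,T}\Big(\int_0^Tdt\,\Big|\sum_{i\in\Lambda_N^d}c_i(\eta(t))-N^d\mathbb A\Big|\le\gamma_NN^dT\Big)=1.$$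
   Context: Model. Let $\Lambda_N^d=\{1,\dots,N\}^d$, $\Omega_N^d=\{0,1\}^{\Lambda_N^d}$, and let $\vec e_1,\dots,\vec e_d$ be the canonical basis vectors. The FA-1f process $(\eta(t))_{t\ge0}$ on $\Omega^d_N$ has generator $\mathcal L_N^df(\eta)=\sum_{i\in\Lambda_N^d}c_i(\eta)(f(\eta^i)-f(\eta))$, where $\eta^i$ is $\eta$ flipped at $i$, $c_i(\eta)=r_i(\eta)[\eta_i(1-\rho)+(1-\eta_i)\rho]$ and $r_i(\eta)=1-\prod_{j=1}^d\eta_{i+\vec e_j}\eta_{i-\vec e_j}$, where sites outside $\Lambda_N^d$ are given fixed boundary values. Boundary condition of dimension $c$: the set of boundary sites (sites outside $\Lambda_N^d$ adjacent to $\Lambda_N^d$) with value $0$ is a $c$-dimensional axis-parallel discrete hyperplane of linear size $N$ (so $N^c$ sites) contained in one face of the boundary, all other boundary sites having value $1$; $c=0$ is a single empty boundary site. The process is reversible with respect to the Bernoulli product measure $\nu$ with $\nu(\eta_i=1)=\rho$. $\mathcal A(t)$ is the total number of configuration changes (flips) in $\Lambda_N^d$ during $[0,t]$; $\langle\cdot\rangle$ is the expectation over the process with initial law $\nu$. $\varphi^{(N)}(\lambda)=\lim_{t\to\infty}\frac1t\log\langle\exp(\lambda\mathcal A(t))\rangle$, $\ \varphi_d(\alpha)=\limsup_{N\to\infty}\frac1{N^c}\varphi^{(N)}\big(\frac{\alpha}{N^{d-c}}\big)$, and $\mu^{N,d}_{\alpha,T}(\cdot)=\dfrac{\langle\,\cdot\,\exp(\frac{\alpha}{N^{d-c}}\mathcal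 A(T))\rangle}{\langle\exp(\frac{\alpha}{N^{d-c}}\mathcal A(T))\rangle}$. $\mathbb A=\nu(c_j)$ for any $j\in\Lambda_N^d$ all of whose coordinates lie in $\{2,\dots,N-1\}$. *)

(* Defs.v *)
From HB Require Import structures.
From mathcomp Require Import all_boot all_order all_algebra ring.
From mathcomp Require Import finmap.
From mathcomp Require Import all_classical all_reals all_analysis.
Set Implicit Arguments.
Unset Strict Implicit.
Unset Printing Implicit Defensive.
Import Order.TTheory GRing.Theory Num.Theory.
Import numFieldNormedType.Exports.
Local Open Scope classical_set_scope.
Local Open Scope ring_scope.

Section Lattice.
Variables d N : nat.

(* Points of Z^d. *)
Definition site := {ffun 'I_d -> int}.

(* The box {1, ..., N}^d; the ordinal k : 'I_N stands for the coordinate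
   k + 1, see [pos]. *)
Definition box := {ffun 'I_d -> 'I_N}.

Definition pos (i : box) : site := [ffun k => (i k).+1%:Z].

Definition unit_vec (j : 'I_d) : site := [ffun k => (k == j)%:Z].

Definition config := {ffun box -> bool}.

Definition flip (eta : config) (i : box) : config :=
  [ffun k => (k == i) (+) eta k].

(* The configuration on the whole lattice that equals eta inside the box and
   the fixed values b outside. *)
Definition extend (b : site -> bool) (eta : config) (x : site) : bool :=
  if [pick i : box | pos i == x] is Some i then eta i else b x.

Definition boundary_site (x : site) : Prop :=
  (forall i : box, pos i <> x) /\
  exists (i : box) (j : 'I_d), x = pos i + unit_vec j \/ x = pos i - unit_vec j.

(* The empty boundary sites are those of the face {x_k = 0} or {x_k = N + 1}
   whose coordinates outside k and the set S of c free directions are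
   prescribed by a point a of the box. *)
Definition boundary_of_dim (c : nat) (b : site -> bool) : Prop :=
  exists (k : 'I_d) (upper : bool) (S : {set 'I_d}) (a : box),
    [/\ k \notin S, #|S| = c &
      forall x, boundary_site x ->
        (b x = false <->
         x k = (if upper then N.+1 else 0%N)%:Z /\
         (forall l, l != k -> l \notin S -> x l = pos a l))].

(* Coordinates in {2, ..., N - 1}. *)
Definition bulk (j : box) : Prop := forall k, (0 < j k)%N /\ ((j k).+1 < N)%N.

End Lattice.

Section Generator.
Variables (R : realType) (d N : nat) (rho : R) (b : site d -> bool).
Implicit Types (eta : config d N) (i : box d N) (f : config d N -> R).

Definition constraint eta i : R :=
  1 - \prod_(j < d) ((extend b eta (pos i + unit_vec j))%:R *
                     (extend b eta (pos i - unit_vec j))%:R).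

Definition rate i eta : R :=
  constraint eta i * ((eta i)%:R * (1 - rho) + (1 - (eta i)%:R) * rho).

Definition generator f : config d N -> R :=
  fun eta => \sum_i rate i eta * (f (flip eta i) - f eta).

(* The semigroup e^{tL} = sum_k (t^k / k!) L^k; the state space is finite. *)
Definition semigroup (t : R) f : config d N -> R :=
  fun eta => limn (series (fun k => t ^+ k / k`!%:R * iter k generator f eta)).

Definition transition (t : R) eta eta' : R :=
  semigroup t (fun xi => (xi == eta')%:R) eta.

Definition nu eta : R := \prod_i (if eta i then rho else 1 - rho).

Definition nu_mean f : R := \sum_eta nu eta * f eta.

End Generator.

Section Process.
Variables (R : realType) (d N : nat).

(* FA-1f process with generator [generator rho b] and initial law nu; only the
   times t >= 0 matter. *)
Record FA1f_process (rho : R) (b : site d -> bool)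
    (disp : measure_display) (W : measurableType disp) (P : probability W R)
    (eta : R -> W -> config d N) : Prop := {
  FA1f_measurable : forall t xi, 0 <= t ->
    measurable [set w | eta t w = xi];
  FA1f_right_continuous : forall w t, 0 <= t ->
    \forall s \near t^'+, eta s w = eta t w;
  FA1f_left_limits : forall w t, 0 < t ->
    exists xi, \forall s \near t^'-, eta s w = xi;
  FA1f_markov : forall (n : nat) (t : nat -> R) (xi : nat -> config d N),
    t 0%N = 0 -> (forall k, t k <= t k.+1) ->
    P [set w | forall k, (k <= n)%N -> eta (t k) w = xi k] =
    (nu rho (xi 0%N) *
     \prod_(k < n) transition rho b (t k.+1 - t k) (xi k) (xi k.+1))%:E
}.

Section Observables.
Variables (disp : measure_display) (W : measurableType disp).
Variables (P : probability W R) (eta : R -> W -> config d N).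

Definition jump_times (T : R) (w : W) : set R :=
  [set s | 0 < s <= T /\ ~ \forall u \near s^'-, eta u w = eta s w].

(* [jump_times T w] is finite when the path of w is right-continuous with left
   limits. *)
Definition activity (T : R) (w : W) : R := #|` fset_set (jump_times T w)|%:R.

Definition mean (X : W -> R) : R := fine ('E_P[X]).

Definition tilted (lambda T : R) (E : set W) : R :=
  mean (fun w => \1_E w * expR (lambda * activity T w)) /
  mean (fun w => expR (lambda * activity T w)).

Definition free_energy (lambda : R) : R :=
  lim (t^-1 * ln (mean (fun w => expR (lambda * activity t w))) @[t --> +oo]).

Definition time_integral (T : R) (f : config d N -> R) (w : W) : R :=
  \int[lebesgue_measure]_(t in `[0, T]) f (eta t w).

(* The event that f deviates from m, in time average, by at most delta. *)
Definition close_on_average (T : R) (f : config d N -> R) (m delta : R)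
  : set W :=
  [set w | time_integral T (fun xi => `|f xi - m|) w <= delta * T].

End Observables.

Definition particles (xi : config d N) : R := \sum_i (xi i)%:R.

Definition total_rate (rho : R) (b : site d -> bool) (xi : config d N) : R :=
  \sum_i rate rho b i xi.

End Process.

(* lim_{N -> oo} lim_{T -> oo} F N T = l; the inner limits are required to
   exist for all large N. *)
Definition iterated_limit (R : realType) (F : nat -> R -> R) (l : R) : Prop :=
  exists u : nat -> R,
    (\forall N \near \oo, F N T @[T --> +oo] --> u N) /\ u @ \oo --> l.

Section Family.
Variables (R : realType) (d c : nat).
Variables (disp : nat -> measure_display).
Variables (W : forall N, measurableType (disp N)).
Variables (P : forall N, probability (W N) R).
Variables (eta : forall N, R -> W N -> config d N).

Definition scaled_tilt (alpha : R) (N : nat) : R := alpha / N%:R ^+ (d - c).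

Definition phi (alpha : R) : \bar R :=
  limn_esup (fun N =>
    (free_energy (P N) (@eta N) (scaled_tilt alpha N) / N%:R ^+ c)%:E).

Definition mu (alpha : R) (N : nat) (T : R) (E : set (W N)) : R :=
  tilted (P N) (@eta N) (scaled_tilt alpha N) T E.

End Family.

(* nu(c_j) for j = (2, ..., 2) in the box with N = 3; by [mean_rate_bulk] it is
   nu(c_j) for every bulk site j of every box. *)
Definition mean_rate (R : realType) (rho : R) (d : nat) : R :=
  nu_mean rho (rate rho (fun _ => true) ([ffun=> inord 1] : box d 3)).

Section MeanRate.
Variables (R : realType) (d N : nat) (rho : R) (b : site d -> bool).
Variable (j : box d N).
Hypothesis bulk_j : bulk j.

Lemma pos_inj : injective (@pos d N).
Proof.
move=> x y /ffunP exy; apply/ffunP => k; apply: val_inj.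
by have := exy k; rewrite !ffunE => -[].
Qed.

Lemma extend_pos (eta : config d N) (i : box d N) : extend b eta (pos i) = eta i.
Proof.
rewrite /extend; case: pickP => [i' /eqP /pos_inj -> //|/(_ i)].
by rewrite eqxx.
Qed.

Definition nb_up (k : 'I_d) : box d N :=
  [ffun l => if l == k then insubd (j l) (j l).+1 else j l].
Definition nb_down (k : 'I_d) : box d N :=
  [ffun l => if l == k then insubd (j l) (j l).-1 else j l].

Lemma val_up k l : nb_up k l = (j l + (l == k))%N :> nat.
Proof.
rewrite ffunE; case: eqVneq => [->|]; last by rewrite addn0.
by rewrite val_insubd (bulk_j k).2 addn1.
Qed.

Lemma val_down k l : nb_down k l = (j l - (l == k))%N :> nat.
Proof.
rewrite ffunE; case: eqVneq => [->|]; last by rewrite subn0.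
by rewrite val_insubd subn1 (leq_ltn_trans (leq_pred _) (ltn_ord _)).
Qed.

Lemma pos_up k : pos j + unit_vec k = pos (nb_up k).
Proof.
by apply/ffunP => l; rewrite [RHS]ffunE val_up !ffunE -PoszD addSn.
Qed.

Lemma pos_down k : pos j - unit_vec k = pos (nb_down k).
Proof.
apply/ffunP => l; rewrite [RHS]ffunE val_down !ffunE.
case: eqVneq => [->|_]; last by rewrite subn0 subr0.
by have [j_gt0 _] := bulk_j k; rewrite subzn // !subn1 prednK.
Qed.

Lemma up_inj : injective nb_up.
Proof.
move=> k k' /ffunP /(_ k) /(congr1 val) /=.
by rewrite !val_up eqxx => /eqP; rewrite eqn_add2l; case: (k =P k').
Qed.

Lemma down_inj : injective nb_down.
Proof.
move=> k k' /ffunP /(_ k) /(congr1 val) /=.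
have [j_gt0 _] := bulk_j k.
rewrite !val_down eqxx; case: (k =P k') => // _.
by rewrite subn0 subn1 => /eqP; rewrite -{2}(prednK j_gt0) ltn_eqF.
Qed.

Definition neighbours : {set box d N} :=
  [set nb_up k | k in [set: 'I_d]]%SET :|: [set nb_down k | k in [set: 'I_d]]%SET.

Lemma up_neq_down k k' : nb_up k != nb_down k'.
Proof.
apply/eqP => /ffunP /(_ k) /(congr1 val) /=.
rewrite val_up val_down eqxx addn1 => /eqP.
by rewrite gtn_eqF // ltnS leq_subr.
Qed.

Lemma disjoint_neighbours :
  fintype.disjoint (mem [set nb_up k | k in [set: 'I_d]]%SET)
                   (mem [set nb_down k | k in [set: 'I_d]]%SET).
Proof.
apply/pred0P => x /=; apply/negP => /andP[/imsetP[k _ ->] /imsetP[k' _]].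
by apply/eqP; exact: up_neq_down.
Qed.

Lemma center_notin_neighbours : j \notin neighbours.
Proof.
rewrite finset.in_setU negb_or; apply/andP; split; apply/imsetP => -[k _].
  move=> /ffunP /(_ k) /(congr1 val) /=; rewrite val_up eqxx addn1 => /eqP.
  by rewrite ltn_eqF.
move=> /ffunP /(_ k) /(congr1 val) /=; have [j_gt0 _] := bulk_j k.
by rewrite val_down eqxx subn1 => /eqP; rewrite -{1}(prednK j_gt0) gtn_eqF.
Qed.

Lemma card_neighbours : #|neighbours| = (2 * d)%N.
Proof.
rewrite finset.cardsU finset.disjoint_setI0 ?disjoint_neighbours // cards0 subn0.
by rewrite !card_imset ?cardsT ?card_ord ?mul2n ?addnn //;
  [exact: down_inj|exact: up_inj].
Qed.

Lemma constraint_bulk (eta : config d N) :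
  constraint R b eta j = 1 - \prod_(i in neighbours) (eta i)%:R.
Proof.
rewrite /constraint; congr (_ - _).
transitivity (\prod_(k < d) ((eta (nb_up k))%:R * (eta (nb_down k))%:R) : R).
  by apply: eq_bigr => k _; rewrite pos_up pos_down !extend_pos.
rewrite big_split /=.
transitivity (\prod_(i in [predU (mem [set nb_up k | k in [set: 'I_d]]%SET)
    & (mem [set nb_down k | k in [set: 'I_d]]%SET)]) (eta i)%:R : R); last first.
  by apply: eq_bigl => i; rewrite finset.in_setU.
rewrite bigU ?disjoint_neighbours //=.
congr (_ * _).
  by rewrite big_imset /=; [apply: eq_bigl => i; rewrite inE|exact: in2W up_inj].
by rewrite big_imset /=; [apply: eq_bigl => i; rewrite inE|exact: in2W down_inj].
Qed.

Lemma nu_mean_prod (F : box d N -> bool -> R) :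
  nu_mean rho (fun eta : config d N => \prod_i F i (eta i)) =
  \prod_i (rho * F i true + (1 - rho) * F i false).
Proof.
transitivity (\prod_i \sum_(x : bool) (if x then rho else 1 - rho) * F i x).
  by rewrite bigA_distr_bigA; apply: eq_bigr => eta _; rewrite -big_split.
by apply: eq_bigr => i _; rewrite big_bool.
Qed.

Lemma nu_mean_rate :
  nu_mean rho (rate rho b j) = 2 * rho * (1 - rho) * (1 - rho ^+ (2 * d)).
Proof.
pose g (x : bool) : R := x%:R * (1 - rho) + (1 - x%:R) * rho.
pose F (A : {set box d N}) (i : box d N) (x : bool) : R :=
  (if i == j then g x else 1) * (if i \in A then x%:R else 1).
have FE A (eta : config d N) :
    \prod_i F A i (eta i) = g (eta j) * \prod_(i in A) (eta i)%:R.
  rewrite big_split /=; congr (_ * _); last by rewrite [RHS]big_mkcond.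
  by rewrite -big_mkcond big_pred1_eq.
have MF (A : {set box d N}) : j \notin A ->
    nu_mean rho (fun eta : config d N => \prod_i F A i (eta i)) =
    2 * rho * (1 - rho) * rho ^+ #|A|.
  move=> jA; rewrite nu_mean_prod -prodr_const (bigD1 j) //= big_mkcond /=.
  congr (_ * _); first by rewrite /F /g eqxx (negbTE jA) !mulr1n !mulr0n; ring.
  rewrite [RHS]big_mkcond; apply: eq_bigr => i _; rewrite /F.
  case: eqVneq => [->|_] /=; first by rewrite (negbTE jA).
  by case: (i \in A); ring.
have -> : nu_mean rho (rate rho b j) =
    nu_mean rho (fun eta : config d N => \prod_i F finset.set0 i (eta i)) -
    nu_mean rho (fun eta : config d N => \prod_i F neighbours i (eta i)).
  rewrite /nu_mean -sumrB; apply: eq_bigr => eta _.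
  by rewrite /rate constraint_bulk !FE finset.big_set0 /g; ring.
rewrite !MF ?finset.in_set0 ?center_notin_neighbours // cards0 card_neighbours; ring.
Qed.

End MeanRate.

Lemma mean_rate_bulk (R : realType) (rho : R) (d N : nat) (b : site d -> bool)
  (j : box d N) : bulk j -> nu_mean rho (rate rho b j) = mean_rate rho d.
Proof.
move=> bulk_j; rewrite nu_mean_rate // /mean_rate nu_mean_rate // => k.
by rewrite ffunE inordK.
Qed.

(* Main.v *)
Require Import Defs.
From HB Require Import structures.
From mathcomp Require Import all_boot all_order all_algebra ring lra zify.
From mathcomp Require Import finmap.
From mathcomp Require Import all_classical all_reals all_analysis measurable_realfun.
Set Implicit Arguments.
Unset Strict Implicit.
Unset Printing Implicit Defensive.
Import Order.TTheory GRing.Theory Num.Theory.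
Import numFieldNormedType.Exports.
Local Open Scope classical_set_scope.
Local Open Scope ring_scope.

(** Let [H] be the total rate, [A] its mean per site, [D f] the sum over the sites of the
Dirichlet forms, and [F] either [|particles - N^d rho|] or [|H - N^d A|].

The core is a functional inequality, for all eps and all large N:
[nu (F f^2) <= eps N^d nu (f^2) + (C0 N^(d-c) + C_eps) D f].  Call a cube full if it contains no
zero.  On a cube that is not full, the zeros can be spread one legal flip at a time, so [f^2] is
close to its average over the cube, up to local Dirichlet forms.  Averaging a local function
over a line of sites at mutual distance 3 then gives the law of large numbers with the measure
[f^2 nu] in place of [nu].  To bound the weight of full cubes, follow a path that starts at an
empty boundary site and look at the last zero on it: moving this zero by one step costs two
Dirichlet terms, and its position has geometric tails.  A point of the empty boundary hyperplane
serves N^(d-c) cubes, hence the factor C0 N^(d-c).  On a full cube the rates vanish, so the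
upper bound on [H] does not need this factor.

The quadratic form of the generator tilted by [exp (lambda activity + s int F)] equals
[(e^lambda - 1) nu (H f^2) + s nu (F f^2) - e^lambda / 2 * D f].  For [lambda] and [s] of order
N^-(d-c), [lambda] above a small negative threshold, the Dirichlet terms are absorbed and the form
is at most [(e^lambda - 1) N^d A nu (f^2)] up to a term o(N^c).  This bounds the exponential
growth rate from above, and the test function 1 with log-convexity in time bounds it from below
by [(e^lambda - 1) nu H].  Comparing the growth rates with [s > 0] and [s = 0], the exponential
Chebyshev inequality gives the concentration.

The passage from the discrete skeleton of the process to the process itself uses that on a mesh
fine enough each interval contains at most one jump. *)

(** The obstacle is that fully occupied regions are frozen: a zero may have to be brought in from
    the boundary, at a cost that grows with [N]. The scaling still leaves room. Since [c <= d - 1],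
    N^(d-c) is at least [N], so [lambda] and [s] tend to zero and C_eps, however large, is absorbed
    for large [N]. Only C0 has to be compared with a fixed quantity, and C0 does not depend on eps,
    so the threshold for alpha is fixed before eps. For positive tilts the upper bound on [H]
    suffices, hence the one-sided condition on alpha.

    A potential [s F] with [s] of order N^-(d-c) gains a multiple of gamma N^c on the event that [F]
    is on average above gamma N^d, against losses of order eps N^c; eps is therefore chosen after
    gamma. The sequence gamma_N must serve all alpha: it is extracted diagonally from estimates that
    are uniform on windows [|alpha| <= 1 / gamma], which exhaust the line as gamma tends to 0.

    No spectral theorem enters: a bound on the quadratic form becomes a bound on the growth of the
    norm under short discrete steps, with errors quadratic in the mesh. *)

(** * The Bernoulli product measure and its conditional averages *)

Section BernoulliMeasure.
Variables (R : realType) (d N : nat) (rho : R).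
Hypothesis hrho : 0 < rho < 1.
Implicit Types (f g h : config d N -> R) (eta : config d N) (A : {pred box d N}).

Local Notation nuE := (nu_mean rho).

Let rho_gt0 : 0 < rho. Proof. by case/andP: hrho. Qed.
Let rho_lt1 : 0 < 1 - rho. Proof. by rewrite subr_gt0; case/andP: hrho. Qed.

Lemma nu_gt0 eta : 0 < nu rho eta.
Proof. by apply: prodr_gt0 => i _; case: ifP. Qed.

Lemma nu_mean_cst (c : R) : nuE (fun _ : config d N => c) = c.
Proof.
rewrite /nu_mean -mulr_suml; suff -> : \sum_(eta : config d N) nu rho eta = 1.
  by rewrite mul1r.
have := nu_mean_prod rho (fun (_ : box d N) (_ : bool) => 1 : R).
rewrite [X in _ = X -> _]big1 => [<-|i _]; last by rewrite !mulr1 addrC subrK.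
by rewrite /nu_mean; apply: eq_bigr => eta _; rewrite big1 // mulr1.
Qed.

Lemma eq_nu_mean f g : f =1 g -> nuE f = nuE g.
Proof. by move=> e; apply: eq_bigr => eta _; rewrite e. Qed.

Lemma nu_meanD f g : nuE (fun eta => f eta + g eta) = nuE f + nuE g.
Proof. by rewrite -big_split; apply: eq_bigr => eta _; rewrite mulrDr. Qed.

Lemma nu_meanZ (c : R) f : nuE (fun eta => c * f eta) = c * nuE f.
Proof. by rewrite mulr_sumr; apply: eq_bigr => eta _; rewrite mulrCA. Qed.

Lemma nu_meanN f : nuE (fun eta => - f eta) = - nuE f.
Proof. by rewrite -sumrN; apply: eq_bigr => eta _; rewrite mulrN. Qed.

Lemma nu_meanB f g : nuE (fun eta => f eta - g eta) = nuE f - nuE g.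
Proof. by rewrite nu_meanD nu_meanN. Qed.

Lemma nu_mean_sum (I : Type) (r : seq I) (Q : pred I) (F : I -> config d N -> R) :
  nuE (fun eta => \sum_(i <- r | Q i) F i eta) = \sum_(i <- r | Q i) nuE (F i).
Proof.
by rewrite exchange_big; apply: eq_bigr => eta _; rewrite mulr_sumr.
Qed.

Lemma ler_nu_mean f g : (forall eta, f eta <= g eta) -> nuE f <= nuE g.
Proof. by move=> le_fg; apply: ler_sum => eta _; rewrite ler_pM2l ?nu_gt0. Qed.

Lemma nu_mean_ge0 f : (forall eta, 0 <= f eta) -> 0 <= nuE f.
Proof. by move=> f0; rewrite -(nu_mean_cst 0); exact: ler_nu_mean. Qed.

Definition mix A eta eta' : config d N :=
  [ffun i => if i \in A then eta i else eta' i].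

Definition depends_on A g :=
  forall eta eta', {in A, eta =1 eta'} -> g eta = g eta'.

(** For a product measure, conditioning on the sites outside [A] amounts to resampling the sites of
    [A] independently. *)
Definition cond_mean A f : config d N -> R := fun eta =>
  nuE (fun eta' => f (mix A eta' eta)).

Lemma mix_mix A eta eta' : mix A (mix A eta eta') (mix A eta' eta) = eta.
Proof. by apply/ffunP => i; rewrite !ffunE; case: (i \in A). Qed.

Lemma nu_mix A eta eta' :
  nu rho (mix A eta eta') * nu rho (mix A eta' eta) = nu rho eta * nu rho eta'.
Proof.
rewrite /nu -!big_split; apply: eq_bigr => i _ /=; rewrite !ffunE.
by case: (i \in A) => //; rewrite mulrC.
Qed.

(* Exchanging the restrictions to A of two independent copies preserves their
   joint law. *)
Lemma nu_mean_cond_mean A f : nuE (cond_mean A f) = nuE f.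
Proof.
pose sw (p : config d N * config d N) := (mix A p.1 p.2, mix A p.2 p.1).
have swK : involutive sw by move=> [x y]; rewrite /sw /= !mix_mix.
transitivity (\sum_(p : config d N * config d N)
    nu rho p.1 * nu rho p.2 * f (sw p).2).
  rewrite -(pair_bigA _ (fun x y => nu rho x * nu rho y * f (sw (x, y)).2)) /=.
  apply: eq_bigr => x _; rewrite /cond_mean /nu_mean mulr_sumr.
  by apply: eq_bigr => y _; rewrite mulrA.
rewrite (reindex_inj (inv_inj swK)) /=.
transitivity (\sum_(p : config d N * config d N) nu rho p.1 * nu rho p.2 * f p.2).
  by apply: eq_bigr => -[x y] _; rewrite /= nu_mix mix_mix.
rewrite -(pair_bigA _ (fun x y => nu rho x * nu rho y * f y)) /=.
transitivity (nuE (fun _ : config d N => nuE f)); last exact: nu_mean_cst.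
apply: eq_bigr => x _; rewrite /nu_mean mulr_sumr.
by apply: eq_bigr => y _; rewrite mulrA.
Qed.

Lemma nu_mean_indep A g h : depends_on A g -> depends_on [predC A] h ->
  nuE (fun eta => g eta * h eta) = nuE g * nuE h.
Proof.
move=> dg dh; rewrite -(nu_mean_cond_mean A) -nu_meanZ; apply: eq_nu_mean => eta.
rewrite mulrC -nu_meanZ; apply: eq_nu_mean => eta'.
rewrite mulrC (dg _ eta') => [|i iA]; last by rewrite ffunE iA.
by rewrite (dh _ eta) // => i; rewrite inE => /negbTE iA; rewrite ffunE iA.
Qed.

End BernoulliMeasure.

(** * Single-site flips, reversibility and Dirichlet forms *)

Section Flip.
Variables (R : realType) (d N : nat) (rho : R) (b : site d -> bool).
Hypothesis hrho : 0 < rho < 1.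
Implicit Types (f g h : config d N -> R) (eta : config d N) (i j : box d N).

Local Notation nuE := (nu_mean rho).
Local Notation rt := (rate rho b).

Let rho_gt0 : 0 < rho. Proof. by case/andP: hrho. Qed.
Let rho_lt1 : 0 < 1 - rho. Proof. by rewrite subr_gt0; case/andP: hrho. Qed.

Lemma flipK i : involutive (fun eta => @flip d N eta i).
Proof. by move=> eta; apply/ffunP => k; rewrite !ffunE; case: eqP => //=; rewrite negbK. Qed.

Lemma flip_same eta i : flip eta i i = ~~ eta i.
Proof. by rewrite ffunE eqxx. Qed.

Lemma flip_other eta i j : j != i -> flip eta i j = eta j.
Proof. by rewrite ffunE => /negbTE ->. Qed.

Lemma flip_neq eta i : flip eta i != eta.
Proof. by apply/eqP => /ffunP /(_ i); rewrite flip_same; case: (eta i). Qed.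

Lemma nu_flip eta i : ~~ eta i ->
  nu rho (flip eta i) = rho / (1 - rho) * nu rho eta.
Proof.
move=> /negbTE ei; rewrite /nu (bigD1 i) //= flip_same ei /=.
rewrite [in RHS](bigD1 i) //= ei mulrA divfK ?gt_eqF //; congr (_ * _).
by apply: eq_bigr => j /flip_other ->.
Qed.

Lemma constraintE eta i : constraint R b eta i =
  [exists j : 'I_d, ~~ extend b eta (pos i + unit_vec j) ||
                    ~~ extend b eta (pos i - unit_vec j)]%:R.
Proof.
pose X (j : 'I_d) := extend b eta (pos i + unit_vec j) && extend b eta (pos i - unit_vec j).
have -> : [exists j : 'I_d, ~~ extend b eta (pos i + unit_vec j) ||
            ~~ extend b eta (pos i - unit_vec j)] = ~~ \big[andb/true]_j X j.
  by rewrite big_andE negb_forall; apply: eq_existsb => j; rewrite negb_and.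
rewrite /constraint; transitivity (1 - (\big[andb/true]_j X j)%:R : R).
  congr (_ - _).
  rewrite (big_morph (fun x : bool => x%:R : R) (op1 := *%R) (id1 := 1)) //.
    by apply: eq_bigr => j _; rewrite -mulnb natrM.
  by move=> x y; rewrite -mulnb natrM.
by case: (\big[andb/true]_j _); rewrite ?subrr ?subr0.
Qed.

Lemma constraint_dep eta eta' i :
  (forall k, extend b eta (pos i + unit_vec k) = extend b eta' (pos i + unit_vec k)) ->
  (forall k, extend b eta (pos i - unit_vec k) = extend b eta' (pos i - unit_vec k)) ->
  constraint R b eta i = constraint R b eta' i.
Proof.
by move=> e1 e2; rewrite /constraint; congr (_ - _); apply: eq_bigr => k _; rewrite e1 e2.
Qed.

Lemma extend_eq eta eta' x :
  (forall i, pos i = x -> eta i = eta' i) -> extend b eta x = extend b eta' x.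
Proof. by move=> e; rewrite /extend; case: pickP => // i /eqP /e. Qed.

Lemma constraint_flip eta i : constraint R b (flip eta i) i = constraint R b eta i.
Proof.
apply: constraint_dep => k; apply: extend_eq => j /ffunP /(_ k);
  rewrite !ffunE eqxx => e; case: eqP => // ji; move: e; rewrite ji; lia.
Qed.

Lemma rateE eta i : rt i eta = constraint R b eta i * (if eta i then 1 - rho else rho).
Proof. by rewrite /rate; case: (eta i); congr (_ * _); rewrite /=; ring. Qed.

Lemma rate_ge0 eta i : 0 <= rt i eta.
Proof. by rewrite rateE constraintE mulr_ge0 //; case: ifP => _; exact: ltW. Qed.

Lemma rate_le1 eta i : rt i eta <= 1.
Proof.
rewrite rateE constraintE; have := rho_gt0; have := rho_lt1.
by case: existsP => _; case: ifP => _; rewrite ?mul1r ?mul0r; lra.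
Qed.

(** Detailed balance: the constraint at [i] does not look at [i] itself, so what remains is the
    balance of one site between the rates [rho] and [1 - rho]. *)
Lemma nu_rate_flip eta i :
  nu rho (flip eta i) * rt i (flip eta i) = nu rho eta * rt i eta.
Proof.
wlog ei : eta / ~~ eta i => [hw|].
  case: (boolP (eta i)) => [ei|]; last exact: hw.
  by rewrite -(hw (flip eta i)) ?flipK // flip_same ei.
rewrite nu_flip // !rateE constraint_flip flip_same ei (negbTE ei).
have : 1 - rho != 0 by rewrite gt_eqF.
move=> h; by field.
Qed.

Lemma nu_mean_rate_flip i f :
  nuE (fun eta => rt i eta * f (flip eta i)) = nuE (fun eta => rt i eta * f eta).
Proof.
rewrite /nu_mean (reindex_inj (inv_inj (flipK i))) /=.
apply: eq_bigr => eta _; have -> : flip (flip eta i) i = eta by exact: flipK.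
by rewrite mulrA nu_rate_flip mulrA.
Qed.

(** Twice the contribution of site [i] to the form [- nu (f L f)]; this is why [tilted_form] carries
    the coefficient [u / 2]. *)
Definition dirichlet i f : R := nuE (fun eta => rt i eta * (f (flip eta i) - f eta) ^+ 2).

Lemma dirichlet_ge0 i f : 0 <= dirichlet i f.
Proof.
by apply: nu_mean_ge0 => // eta; rewrite mulr_ge0 ?rate_ge0 ?sqr_ge0.
Qed.

(** Polarization: twice the product of [f eta] and [f (flip eta i)] is the sum of their squares
    minus the squared difference, and by reversibility both squares have the same mean against the
    rate. *)
Lemma tilted_form (u : R) f (F : config d N -> R) :
  nuE (fun eta => f eta * (\sum_i rt i eta * (u * f (flip eta i) - f eta)
                           + F eta * f eta)) =
  (u - 1) * nuE (fun eta => total_rate rho b eta * f eta ^+ 2) +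
  nuE (fun eta => F eta * f eta ^+ 2) - u / 2 * \sum_i dirichlet i f.
Proof.
rewrite /dirichlet.
have E i : nuE (fun eta => rt i eta * (f (flip eta i) - f eta) ^+ 2) =
    2 * nuE (fun eta => rt i eta * f eta ^+ 2)
    - 2 * nuE (fun eta => rt i eta * (f eta * f (flip eta i))).
  transitivity (nuE (fun eta => rt i eta * f (flip eta i) ^+ 2) +
     nuE (fun eta => rt i eta * f eta ^+ 2)
    - 2 * nuE (fun eta => rt i eta * (f eta * f (flip eta i)))); last first.
    by rewrite (nu_mean_rate_flip i (fun eta => f eta ^+ 2)); ring.
  by rewrite -nu_meanZ -nu_meanD -nu_meanB; apply: eq_nu_mean => eta; ring.
under eq_bigr do rewrite E.
rewrite sumrB -!mulr_sumr -!nu_mean_sum -!nu_meanZ -!nu_meanB -!nu_meanZ -nu_meanD -nu_meanB.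
apply: eq_nu_mean => eta; rewrite /total_rate.
rewrite mulrDr mulr_sumr.
transitivity (u * (\sum_i rt i eta * (f eta * f (flip eta i)))
  - \sum_i rt i eta * f eta ^+ 2 + F eta * f eta ^+ 2).
  rewrite mulr_sumr -sumrB; congr (_ + _); last by ring.
  by apply: eq_bigr => i _; ring.
by rewrite -mulr_suml; field.
Qed.

End Flip.

(** * Moving the last zero along a path *)

Lemma sum_nat_shift (V : nmodType) (F : nat -> V) (j n : nat) :
  \sum_(n <= i < j + n) F i = \sum_(0 <= k < j) F (k + n)%N.
Proof. by rewrite -{1}[n]add0n big_addn addnK. Qed.

(** Iterating on a whole window of length [j] turns the errors into a geometric series in [E], so
    neither the number [m] of shifts nor the length of the window enters the final error. *)
Lemma geometric_decay (R : realType) (q E : R) (a : nat -> R) (j m : nat) :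
  0 <= q < 1 -> 0 <= E ->
  (forall n, (n < m)%N ->
     \sum_(0 <= k < j) a (k + n)%N <= q * (\sum_(0 <= k < j) a (k + n.+1)%N) + E) ->
  \sum_(0 <= k < j) a k <= q ^+ m * (\sum_(0 <= k < j) a (k + m)%N) + E / (1 - q).
Proof.
move=> /andP[q0 q1] E0 step; have q1' : 0 < 1 - q by rewrite subr_gt0.
have sum n : (n <= m)%N -> \sum_(0 <= k < j) a k <=
    q ^+ n * (\sum_(0 <= k < j) a (k + n)%N) + (1 - q ^+ n) / (1 - q) * E.
  elim: n => [|n IH] nm.
    by rewrite expr0 mul1r subrr !mul0r addr0; under [in leRHS]eq_bigr do rewrite addn0.
  apply: le_trans (IH (ltnW nm)) _.
  have h := ler_wpM2l (exprn_ge0 n q0) (step n nm).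
  apply: le_trans (lerD h (lexx _)) _.
  rewrite exprSr mulrDr mulrA -addrA lerD2l -mulrDl ler_wpM2r //.
  have geom (x : R) : x + (1 - x) / (1 - q) = (1 - x * q) / (1 - q).
    by field; rewrite gt_eqF.
  by rewrite geom.
apply: le_trans (sum m (leqnn _)) _; rewrite lerD2l mulrAC ler_pM2r ?invr_gt0 //.
by rewrite ler_piMl // gerBl exprn_ge0.
Qed.

Section TwoSites.
Variables (R : realType) (rho : R).
Hypothesis hrho : 0 < rho < 1.

Let rho_gt0 : 0 < rho. Proof. by case/andP: hrho. Qed.
Let rho_lt1 : 0 < 1 - rho. Proof. by rewrite subr_gt0; case/andP: hrho. Qed.

(** The factors are the relative weight [rho / (1 - rho)] of an occupied site, the price [1 + 1/e]
    of a weighted AM-GM with [e = (1 - rho) / (2 * rho)], a 2 from squaring a sum of two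
    differences, and [1 / rho] because an empty site flips at rate [rho]. *)
Definition two_site_cst : R :=
  2 * (rho / (1 - rho)) * (1 + ((1 - rho) / (2 * rho))^-1) / rho.

Lemma two_site_cst_ge0 : 0 <= two_site_cst.
Proof.
by rewrite ltW // divr_gt0 // mulr_gt0 // ?mulr_gt0 ?divr_gt0 ?addr_gt0 ?invr_gt0
  ?divr_gt0 // mulr_gt0.
Qed.

(* In the application a, x and c are the values of f at the states (0, 1), (0, 0)
   and (1, 0) of two adjacent sites. *)
Lemma two_site_pointwise (a x c : R) :
  rho / (1 - rho) * a ^+ 2 <=
  (1 + rho) / 2 * (x ^+ 2 + rho / (1 - rho) * c ^+ 2) +
  two_site_cst * (rho * (a - x) ^+ 2 + rho * (c - x) ^+ 2).
Proof.
pose q := (1 + rho) / 2; pose t := rho / (1 - rho).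
have t0 : 0 < t by rewrite divr_gt0.
have tE : t * (1 - rho) = rho by rewrite divfK // gt_eqF.
(* with s the mean (1 - rho) x + rho c, a = s + (a - s) and weighted AM-GM *)
pose e := (1 - rho) / (2 * rho).
have e0 : 0 < e by rewrite divr_gt0 // mulr_gt0.
have eE : e * rho = (1 - rho) / 2 by rewrite /e; field; rewrite gt_eqF.
rewrite /two_site_cst -/t -/e.
pose s := (1 - rho) * x + rho * c.
have h1 : a ^+ 2 <= (1 + e) * s ^+ 2 + (1 + e^-1) * (a - s) ^+ 2.
  rewrite -subr_ge0; set X := (X in 0 <= X).
  have -> : X = (e * s - (a - s)) ^+ 2 / e by rewrite /X; field; rewrite gt_eqF.
  by rewrite divr_ge0 ?sqr_ge0 ?ltW.
have h2 : s ^+ 2 <= (1 - rho) * x ^+ 2 + rho * c ^+ 2.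
  rewrite -subr_ge0; set X := (X in 0 <= X).
  have -> : X = rho * (1 - rho) * (x - c) ^+ 2 by rewrite /X /s; ring.
  by rewrite mulr_ge0 ?sqr_ge0 // mulr_ge0 // ltW.
have h3 : (a - s) ^+ 2 <= 2 * ((a - x) ^+ 2 + (c - x) ^+ 2).
  have -> : a - s = (a - x) - rho * (c - x) by rewrite /s; ring.
  have r1 : rho ^+ 2 <= 1 by rewrite expr_le1 // ltW // -subr_gt0.
  have : rho ^+ 2 * (c - x) ^+ 2 <= 1 * (c - x) ^+ 2 by rewrite ler_wpM2r ?sqr_ge0.
  have := sqr_ge0 ((a - x) + rho * (c - x)).
  nra.
have ei0 : 0 < e^-1 by rewrite invr_gt0.
have -> : 2 * t * (1 + e^-1) / rho * (rho * (a - x) ^+ 2 + rho * (c - x) ^+ 2) =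
   t * (1 + e^-1) * (2 * ((a - x) ^+ 2 + (c - x) ^+ 2)).
  by field; rewrite !gt_eqF.
have qE : q * (x ^+ 2 + t * c ^+ 2) = t * (1 + e) * ((1 - rho) * x ^+ 2 + rho * c ^+ 2).
  rewrite /q; have -> : (1 + rho) / 2 = (1 + e) * rho by rewrite [RHS]mulrDl eE; field.
  by rewrite -[in LHS]tE; rewrite /t; field; rewrite gt_eqF.
rewrite -/t -/q qE.
apply: le_trans (_ : t * ((1 + e) * s ^+ 2 + (1 + e^-1) * (a - s) ^+ 2) <= _).
  by rewrite ler_wpM2l // ltW.
rewrite mulrDr [t * (_ * s ^+ 2)]mulrA [t * (_ * (a - s) ^+ 2)]mulrA; apply: lerD; apply: ler_wpM2l => //.
  by rewrite ltW // mulr_gt0 // addr_gt0.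
by rewrite ltW // mulr_gt0 // addr_gt0.
Qed.

End TwoSites.

Section Adjacency.
Variables (R : realType) (d N : nat) (b : site d -> bool).
Implicit Types (eta : config d N) (i j : box d N).

Definition adjacent i j : bool :=
  [exists k : 'I_d, (pos j == pos i + unit_vec k) || (pos j == pos i - unit_vec k)].

Lemma adjacent_sym i j : adjacent i j = adjacent j i.
Proof.
by apply: eq_existsb => k; rewrite orbC; congr orb; apply/eqP/eqP => ->;
  rewrite ?addrK ?subrK.
Qed.

Lemma adjacent_neq i j : adjacent i j -> i != j.
Proof.
move=> /existsP[k e]; apply/eqP => ij; move: e; rewrite ij => /orP[] /eqP /ffunP /(_ k);
  rewrite !ffunE eqxx; lia.
Qed.

Lemma constraint_adjacent eta i j : adjacent i j -> ~~ eta j ->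
  constraint R b eta i = 1.
Proof.
move=> /existsP[k ij] ej; rewrite constraintE; suff -> : [exists k : 'I_d,
  ~~ extend b eta (pos i + unit_vec k) || ~~ extend b eta (pos i - unit_vec k)] by [].
apply/existsP; exists k; case/orP: ij => /eqP <-; rewrite extend_pos ej //.
by rewrite orbT.
Qed.

End Adjacency.

Section LocalEstimates.
Variables (R : realType) (d N : nat) (rho : R) (b : site d -> bool).
Hypothesis hrho : 0 < rho < 1.
Implicit Types (f g h V : config d N -> R) (eta : config d N) (i j : box d N).

Local Notation nuE := (nu_mean rho).
Local Notation rt := (rate rho b).
Local Notation dir := (dirichlet rho b).
Local Notation kappa := (Num.min rho (1 - rho)).

Let rho_gt0 : 0 < rho. Proof. by case/andP: hrho. Qed.
Let rho_lt1 : 0 < 1 - rho. Proof. by rewrite subr_gt0; case/andP: hrho. Qed.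
Let kappa_gt0 : 0 < kappa. Proof. by rewrite lt_min rho_gt0. Qed.

(** Each configuration with a zero at [j] is paired with its flip at [j], whose weight is
    [rho / (1 - rho)] times larger. Inequalities between means can then be checked pointwise. *)
Lemma nu_mean_split j f :
  nuE f = nuE (fun eta => (~~ eta j)%:R * (f eta + rho / (1 - rho) * f (flip eta j))).
Proof.
have -> : nuE f = nuE (fun eta => (~~ eta j)%:R * f eta) + nuE (fun eta => (eta j)%:R * f eta).
  rewrite -nu_meanD; apply: eq_nu_mean => eta.
  by case: (eta j); rewrite /= ?mul1r ?mul0r ?add0r ?addr0.
have -> : nuE (fun eta => (eta j)%:R * f eta) =
    nuE (fun eta => (~~ eta j)%:R * (rho / (1 - rho) * f (flip eta j))).
  rewrite /nu_mean (reindex_inj (inv_inj (@flipK d N j))) /=.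
  apply: eq_bigr => eta _; rewrite flip_same.
  case: (boolP (eta j)) => ej /=; first by rewrite !mul0r !mulr0.
  by rewrite nu_flip // !mul1r; ring.
by rewrite -nu_meanD; apply: eq_nu_mean => eta; rewrite mulrDr.
Qed.

(** The zero moves from [i] to [j] through the state where both sites are empty; each flip is legal
    because the other site is empty. For constant [f] the factor [rho] would be enough; it is
    relaxed to [(1 + rho) / 2], still below 1, to leave room for the gradients. *)
Lemma two_sites i j (G : config d N -> bool) f : adjacent i j ->
  (forall eta, G (flip eta i) = G eta) -> (forall eta, G (flip eta j) = G eta) ->
  nuE (fun eta => ([&& ~~ eta i, eta j & G eta])%:R * f eta ^+ 2) <=
  (1 + rho) / 2 * nuE (fun eta => (~~ eta j && G eta)%:R * f eta ^+ 2) +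
  two_site_cst rho * (dir i f + dir j f).
Proof.
move=> ij Gi Gj; have nij := adjacent_neq ij; have ji := ij.
rewrite adjacent_sym in ji.
rewrite (nu_mean_split j) (nu_mean_split i (fun eta => (~~ eta j && _)%:R * _)).
rewrite /dirichlet -nu_meanD -!nu_meanZ -nu_meanD; apply: ler_nu_mean => // eta.
have C0 := two_site_cst_ge0 hrho.
have rest0 : 0 <= two_site_cst rho * (rt i eta * (f (flip eta i) - f eta) ^+ 2 +
   rt j eta * (f (flip eta j) - f eta) ^+ 2).
  by rewrite mulr_ge0 // addr_ge0 // mulr_ge0 ?sqr_ge0 ?rate_ge0.
have q0 : 0 <= (1 + rho) / 2 by rewrite divr_ge0 // addr_ge0 // ltW.
have t0 : 0 <= rho / (1 - rho) by rewrite divr_ge0 // ltW.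
rewrite Gi Gj !(flip_same, flip_other) //; last by rewrite eq_sym.
case: (boolP (eta i)) => ei; case: (boolP (eta j)) => ej; case: (boolP (G eta)) => Ge;
  rewrite /= ?(mul0r, mulr0, mul1r, addr0, add0r) //.
have c1 : constraint R b eta i = 1 by exact: constraint_adjacent ej.
have c2 : constraint R b eta j = 1 by exact: constraint_adjacent ei.
rewrite !rateE c1 c2 (negbTE ei) (negbTE ej) !mul1r [X in _ + _ * X]addrC.
exact: two_site_pointwise.
Qed.

(** Used at the start of a path without zeros: emptying its first site, which is always legal there,
    costs one Dirichlet term and puts the last zero at position 0. *)
Lemma first_site i (G : config d N -> bool) f :
  (forall eta, constraint R b eta i = 1) -> (forall eta, G (flip eta i) = G eta) ->
  nuE (fun eta => (eta i && G eta)%:R * f eta ^+ 2) <=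
  2 * (rho / (1 - rho)) * nuE (fun eta => (~~ eta i && G eta)%:R * f eta ^+ 2) +
  2 / (1 - rho) * dir i f.
Proof.
move=> ci Gi.
rewrite (nu_mean_split i) -!nu_meanZ -nu_meanD; apply: ler_nu_mean => // eta.
have t0 : 0 <= rho / (1 - rho) by rewrite divr_ge0 // ltW.
have rest0 : 0 <= 2 / (1 - rho) * (rt i eta * (f (flip eta i) - f eta) ^+ 2).
  by rewrite mulr_ge0 ?[0 <= 2 / _]divr_ge0 ?[0 <= 1 - _]ltW // mulr_ge0 ?sqr_ge0 ?rate_ge0.
rewrite Gi flip_same.
case: (boolP (eta i)) => ei; case: (boolP (G eta)) => Ge;
  rewrite /= ?(mul0r, mulr0, mul1r, addr0, add0r) //.
rewrite rateE ci (negbTE ei) mul1r.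
have -> : 2 / (1 - rho) * (rho * (f (flip eta i) - f eta) ^+ 2) =
  rho / (1 - rho) * (2 * (f (flip eta i) - f eta) ^+ 2) by ring.
rewrite [2 * _]mulrC -[_ * 2 * f eta ^+ 2]mulrA -mulrDr ler_wpM2l //.
have := sqr_ge0 (f (flip eta i) - 2 * f eta); nra.
Qed.

Section Path.
Local Opaque nu_mean dirichlet.
Variables (v : nat -> box d N) (L m : nat).
Hypothesis v_inj : forall k l, (k < L)%N -> (l < L)%N -> v k = v l -> k = l.
Hypothesis v_adj : forall k, (k.+1 < L)%N -> adjacent (v k) (v k.+1).
Hypothesis v_first : forall eta, constraint R b eta (v 0%N) = 1.
Hypothesis m_lt : (m < L)%N.
Variable f : config d N -> R.

Definition ones_from (k : nat) eta := [forall l : 'I_L, (k <= l)%N ==> eta (v l)].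

Local Notation q := ((1 + rho) / 2).
(** [a k] is the mass, for the measure with density [f ^+ 2], of the event that the last zero of the
    path is at position [k]. *)
Local Notation a k := (nuE (fun eta => (~~ eta (v k) && ones_from k.+1 eta)%:R * f eta ^+ 2)).
Local Notation Dpath := (\sum_(k < L) dir (v k) f).

Lemma ones_from_flip k l eta : (l < k)%N -> (l < L)%N ->
  ones_from k (flip eta (v l)) = ones_from k eta.
Proof.
move=> lk lL; apply: eq_forallb => x; case: (leqP k x) => //= kx.
rewrite flip_other //; apply/eqP => /v_inj e; move: kx; rewrite e //; lia.
Qed.

Lemma ones_fromS k eta : (k < L)%N -> ones_from k eta = eta (v k) && ones_from k.+1 eta.
Proof.
move=> kL; apply/forallP/andP => [h|[h1 /forallP h2] l].
  split; first by have := h (Ordinal kL); rewrite leqnn.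
  by apply/forallP => l; apply/implyP => kl; exact: (implyP (h l) (ltnW kl)).
apply/implyP; rewrite leq_eqVlt => /orP[/eqP <- //|]; exact/implyP.
Qed.

Lemma path_recursion k : (k.+1 < L)%N ->
  a k <= q * a k.+1 + two_site_cst rho * (dir (v k) f + dir (v k.+1) f).
Proof.
move=> kL; rewrite (eq_nu_mean _ (g := fun eta =>
  ([&& ~~ eta (v k), eta (v k.+1) & ones_from k.+2 eta])%:R * f eta ^+ 2)).
  by apply: two_sites => [|eta|eta]; rewrite ?v_adj ?ones_from_flip //; apply: ltnW.
by move=> eta; rewrite ones_fromS.
Qed.

(** Decomposition by the position of the last zero: a path that is full from [k] on either has no
    zero or has its last one at some [l < k]. *)
Lemma mass_ones_from k : (k <= L)%N ->
  nuE (fun eta => (ones_from k eta)%:R * f eta ^+ 2) =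
  nuE (fun eta => (ones_from 0 eta)%:R * f eta ^+ 2) + \sum_(0 <= l < k) a l.
Proof.
elim: k => [|k IH] kL; first by rewrite big_geq ?addr0.
rewrite big_nat_recr //= addrA -IH ?(ltnW kL) // -nu_meanD; apply: eq_nu_mean => eta.
rewrite (ones_fromS _ kL); case: (eta (v k)); case: (ones_from k.+1 eta);
  by rewrite /= ?mul1r ?mul0r ?add0r ?addr0.
Qed.

Lemma path_shift_mass (j n : nat) : (j + n < L)%N ->
  \sum_(0 <= k < j) a (k + n)%N <=
  q * \sum_(0 <= k < j) a (k + n.+1)%N + two_site_cst rho * (2 * Dpath).
Proof.
move=> jn; have C0 := two_site_cst_ge0 hrho.
(* Each of the two shifted windows meets a site of the path at most once, so the total error is
   twice [Dpath] whatever the length of the window. *)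
have le_path (n' : nat) : (j + n' <= L)%N -> \sum_(0 <= k < j) dir (v (k + n')%N) f <= Dpath.
  move=> h; rewrite -(big_mkord xpredT (fun k => dir (v k) f)).
  rewrite (big_cat_nat (n := n') (p := L)) /=; [|lia|lia].
  rewrite (big_cat_nat (n := (j + n')%N) (m := n') (p := L)) /=; [|lia|lia].
  rewrite sum_nat_shift addrCA lerDl addr_ge0 // sumr_ge0 // => k _;
    exact: dirichlet_ge0.
apply: le_trans (_ : \sum_(0 <= k < j) (q * a (k + n.+1)%N + two_site_cst rho *
   (dir (v (k + n)%N) f + dir (v (k + n.+1)%N) f)) <= _).
  rewrite !big_nat; apply: ler_sum => k /andP[_ kj].
  by rewrite addnS; apply: path_recursion; lia.
rewrite big_split /= -!mulr_sumr lerD2l ler_wpM2l // big_split /= mulr2n mulrDl !mul1r.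
by rewrite lerD // le_path; lia.
Qed.

(** The factor [1 + 2 * (rho / (1 - rho))] accounts for the path without zeros: by [first_site] its
    mass is at most [2 * (rho / (1 - rho))] times [a 0], itself a term of the window, plus
    [2 / (1 - rho)] times a Dirichlet term. *)
Definition path_cst : R :=
  (1 + 2 * (rho / (1 - rho))) * (two_site_cst rho * 2 / (1 - q)) + 2 / (1 - rho).

(** If the last [m] sites are full, the last zero lies in the window [[0, L - m)] or does not exist.
    After [m] shifts the window becomes [[m, L)], whose mass is at most the whole mass of
    [f ^+ 2]. *)
Lemma path_bound :
  nuE (fun eta => (ones_from (L - m) eta)%:R * f eta ^+ 2) <=
  (1 + 2 * (rho / (1 - rho))) * q ^+ m * nuE (fun eta => f eta ^+ 2) +
  path_cst * Dpath.
Proof.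
have C0 := two_site_cst_ge0 hrho.
have q01 : 0 <= q < 1.
  rewrite divr_ge0 ?addr_ge0 // ?ltW //=.
  by rewrite ltr_pdivrMr //; have := rho_lt1; lra.
have D0 : 0 <= Dpath by rewrite sumr_ge0 // => k _; exact: dirichlet_ge0.
have a0 k : 0 <= a k by apply: nu_mean_ge0 => // eta; rewrite mulr_ge0 ?sqr_ge0.
have E0 : 0 <= two_site_cst rho * (2 * Dpath) by rewrite mulr_ge0 // mulr_ge0.
have decay := @geometric_decay R q _ (fun k => a k) (L - m) m q01 E0
  (fun n nm => path_shift_mass (ltac:(lia) : (L - m + n < L)%N)).
have mass : \sum_(0 <= k < L - m) a (k + m)%N <= nuE (fun eta => f eta ^+ 2).
  apply: le_trans (_ : nuE (fun eta => (ones_from L eta)%:R * f eta ^+ 2) <= _).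
    rewrite (mass_ones_from (leqnn L)) (big_cat_nat (n := m) (p := L)) /=; [|lia|lia].
    have {2}-> : L = (L - m + m)%N by rewrite subnK // ltnW.
    rewrite sum_nat_shift addrA lerDr addr_ge0 //; last by rewrite sumr_ge0.
    by apply: nu_mean_ge0 => // eta; rewrite mulr_ge0 ?sqr_ge0.
  by apply: ler_nu_mean => // eta; rewrite ler_piMl ?sqr_ge0 // lern1 leq_b1.
have h0 : nuE (fun eta => (ones_from 0 eta)%:R * f eta ^+ 2) <=
    2 * (rho / (1 - rho)) * a 0%N + 2 / (1 - rho) * dir (v 0%N) f.
  rewrite (eq_nu_mean _ (g := fun eta =>
    (eta (v 0%N) && ones_from 1 eta)%:R * f eta ^+ 2)).
    apply: first_site => // eta; rewrite ones_from_flip //.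
    exact: leq_ltn_trans m_lt.
  by move=> eta; rewrite ones_fromS //; exact: leq_ltn_trans m_lt.
have a0S : a 0%N <= \sum_(0 <= k < L - m) a k.
  by rewrite big_ltn ?subn_gt0 // lerDl sumr_ge0.
have d0 : dir (v 0%N) f <= Dpath.
  rewrite -(big_mkord xpredT (fun k => dir (v k) f)) big_ltn; last exact: leq_ltn_trans m_lt.
  by rewrite lerDl sumr_ge0 // => k _; exact: dirichlet_ge0.
rewrite mass_ones_from ?leq_subr //.
have t0 : 0 <= rho / (1 - rho) by rewrite divr_ge0 // ltW.
have r0 : 0 <= 2 / (1 - rho) by rewrite divr_ge0 // ltW.
rewrite /path_cst; move: decay a0S h0 mass d0.
set S := \sum_(0 <= k < L - m) _; set S' := \sum_(0 <= k < L - m) _.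
move: S S' (a 0%N) (nuE (fun eta => (ones_from 0 eta)%:R * _))
  (nuE (fun eta => f eta ^+ 2)) (dir _ f) Dpath => S S' A0 B F D0' D.
set t := rho / (1 - rho) in t0 *; set r := 2 / (1 - rho) in r0 *.
have := two_site_cst_ge0 hrho; move: (two_site_cst rho) => C.
have qm : 0 <= q ^+ m by rewrite exprn_ge0 //; case/andP: q01.
move: ((1 - q)^-1) (q ^+ m) qm => I Q Q0 _ decay a0S h0 mass d0.
apply: le_trans (_ : (1 + 2 * t) * (Q * F + C * (2 * D) * I) + r * D <= _); last first.
  by rewrite le_eqVlt; apply/orP; left; apply/eqP; ring.
have : Q * S' <= Q * F by rewrite ler_wpM2l.
have : r * D0' <= r * D by rewrite ler_wpM2l.
have : 2 * t * A0 <= 2 * t * S by rewrite ler_wpM2l // mulr_ge0.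
move=> h1 h2 h3.
have : (1 + 2 * t) * S <= (1 + 2 * t) * (Q * F + C * (2 * D) * I).
  apply: ler_wpM2l; first by rewrite addr_ge0 // mulr_ge0.
  by apply: le_trans decay _; rewrite lerD2r.
move: h0 h1 h2; rewrite mulrDl mul1r; lra.
Qed.

End Path.

End LocalEstimates.

(** * Spreading zeros over a set that is not full *)

Section Zeroing.
Variables (R : realType) (d N : nat) (rho : R) (b : site d -> bool).
Hypothesis hrho : 0 < rho < 1.
Implicit Types (f g h V : config d N -> R) (eta zeta : config d N) (i j : box d N).
Implicit Types A : {set box d N}.

Local Notation nuE := (nu_mean rho).
Local Notation rt := (rate rho b).
Local Notation dir := (dirichlet rho b).
Local Notation kappa := (Num.min rho (1 - rho)).

Let rho_gt0 : 0 < rho. Proof. by case/andP: hrho. Qed.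
Let rho_lt1 : 0 < 1 - rho. Proof. by rewrite subr_gt0; case/andP: hrho. Qed.
Let kappa_gt0 : 0 < kappa. Proof. by rewrite lt_min rho_gt0. Qed.
Let kappa_le1 : kappa <= 1.
Proof. by rewrite ge_min; apply/orP; left; rewrite -subr_ge0 ltW. Qed.

Definition zero_on A eta : config d N := [ffun k => (k \notin A) && eta k].

Definition full_on A eta : bool := [forall k in A, eta k].

(** Connectedness stated as a crossing edge: with [Z] the empty sites, it directly yields an
    occupied site with an empty neighbour, the next one to be emptied. *)
Definition connected_set A := forall Z : pred (box d N),
  (exists2 j, j \in A & Z j) -> (exists2 i, i \in A & ~~ Z i) ->
  exists i j, [/\ i \in A, j \in A, ~~ Z i, Z j & adjacent i j].

(* The zeros of a non-full configuration can be spread over A one site at a time,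
   each new zero being adjacent to an existing one. *)
Lemma zero_on_path A f (s : R) eta : connected_set A -> 0 <= s -> ~~ full_on A eta ->
  (forall zeta i, {in [predC A], zeta =1 eta} -> i \in A ->
     constraint R b zeta i = 1 -> `|f (flip zeta i) - f zeta| <= s) ->
  `|f eta - f (zero_on A eta)| <= #|A|%:R * s.
Proof.
move=> cA s0 nf step.
pose ones zeta := [set k in A | zeta k]%SET.
suff h n zeta : (#|ones zeta| <= n)%N -> ~~ full_on A zeta -> {in [predC A], zeta =1 eta} ->
    `|f zeta - f (zero_on A eta)| <= n%:R * s.
  apply: (h _ eta _ nf (fun _ _ => erefl)); apply: subset_leq_card.
  by apply/fintype.subsetP => k; rewrite inE => /andP[].
elim: n zeta => [|n IH] zeta hn nfz ez.
  suff -> : zeta = zero_on A eta by rewrite subrr normr0 mul0r.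
  apply/ffunP => k; rewrite ffunE; case: (boolP (k \in A)) => kA /=; last exact: ez.
  move: hn; rewrite leqn0 cards_eq0 => /eqP /setP /(_ k); rewrite !inE kA /=.
  by move=> ->.
case: (boolP [exists i in A, zeta i]) => [/exists_inP[i0 i0A i01]|]; last first.
  rewrite negb_exists_in => /forall_inP hz.
  suff -> : zeta = zero_on A eta by rewrite subrr normr0 mulr_ge0.
  apply/ffunP => k; rewrite ffunE; case: (boolP (k \in A)) => kA /=; last exact: ez.
  by apply/negbTE/hz.
move: (nfz); rewrite negb_forall_in => /exists_inP[j0 j0A j00].
have [||i [j [iA jA /negPn i1 j1 ij]]] := cA (fun k => ~~ zeta k).
- by exists j0.
- by exists i0; rewrite ?negbK.
have nij := adjacent_neq ij.
apply: le_trans (ler_distD (f (flip zeta i)) _ _) _; rewrite -natr1 mulrDl mul1r addrC.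
apply: lerD.
  apply: IH.
  - rewrite -ltnS; apply: leq_trans hn; apply: proper_card; apply/properP; split.
      apply/fintype.subsetP => k; rewrite !inE => /andP[-> /=].
      by rewrite ffunE; case: eqP => [->|//]; rewrite i1.
    by exists i; rewrite !inE iA ?i1 // flip_same i1.
  - rewrite negb_forall_in; apply/exists_inP; exists j => //.
    by rewrite flip_other // eq_sym.
  - move=> k kA; rewrite flip_other ?ez //; apply: contraNneq kA => ->; exact: iA.
by rewrite distrC step // (constraint_adjacent R b ij).
Qed.

(** A prescribed configuration on [A] has probability at least [kappa ^+ #|A|], and its contribution
    to the average is already enough. *)
Lemma cond_mean_ge A f eta zeta : (forall eta', 0 <= f eta') ->
  {in [predC A], zeta =1 eta} ->
  kappa ^+ #|A| * f zeta <= cond_mean rho (mem A) f eta.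
Proof.
move=> f0 ez.
pose F i (x : bool) : R := if i \in A then (x == zeta i)%:R else 1.
have -> : kappa ^+ #|A| = \prod_(i : box d N) (if i \in A then kappa else 1).
  by rewrite -big_mkcond prodr_const.
apply: le_trans (_ : nuE (fun eta' : config d N => \prod_i F i (eta' i)) * f zeta <= _).
  rewrite ler_wpM2r // nu_mean_prod; apply: ler_prod => i _; rewrite /F.
  case: ifP => _; last by rewrite !mulr1 addrC subrK ler01 lexx.
  rewrite ltW //=; case: (zeta i); rewrite /= ?mulr1 ?mulr0 ?addr0 ?add0r ge_min lexx //.
  by rewrite orbT.
rewrite mulrC -nu_meanZ; apply: ler_nu_mean => // eta'.
case: (boolP [forall i in A, eta' i == zeta i]) => [/forall_inP e|].
  rewrite big1 ?mulr1 => [|i _]; last by rewrite /F; case: ifP => // /e ->.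
  suff -> : mix (mem A) eta' eta = zeta by [].
  apply/ffunP => i; rewrite ffunE; case: (boolP (i \in A)) => iA.
    exact/eqP/e.
  by rewrite ez.
rewrite negb_forall_in => /exists_inP[i iA /negbTE ei].
by rewrite (bigD1 i) //= /F iA ei mul0r mulr0.
Qed.

Local Notation grad A f zeta :=
  (\sum_(i in A) rt i zeta * (f (flip zeta i) - f zeta) ^+ 2).

(** [zero_on_path] asks for a uniform bound on legal flips. Each squared gradient is at most the
    conditional mean of [grad], divided by [kappa ^+ #|A|] for the probability of the configuration
    and by one more [kappa] for the rate of the flip. *)
Lemma zero_on_diff A f eta : connected_set A -> ~~ full_on A eta ->
  (f eta - f (zero_on A eta)) ^+ 2 <=
  #|A|%:R ^+ 2 / kappa ^+ #|A|.+1 * cond_mean rho (mem A) (fun zeta => grad A f zeta) eta.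
Proof.
move=> cA nf.
have g0 zeta : 0 <= grad A f zeta.
  by apply: sumr_ge0 => i _; rewrite mulr_ge0 ?sqr_ge0 ?rate_ge0.
set M := cond_mean _ _ _ _; pose s2 := M / kappa ^+ #|A|.+1.
have M0 : 0 <= M by apply: nu_mean_ge0.
have s20 : 0 <= s2 by rewrite divr_ge0 // exprn_ge0 // ltW.
have := @zero_on_path A f (Num.sqrt s2) eta cA (sqrtr_ge0 _) nf.
have h zeta i : {in [predC A], zeta =1 eta} -> i \in A -> constraint R b zeta i = 1 ->
    `|f (flip zeta i) - f zeta| <= Num.sqrt s2.
  move=> ez iA ci; rewrite -sqrtr_sqr ler_sqrt //.
  rewrite ler_pdivlMr ?exprn_gt0 // mulrC [kappa ^+ _]exprSr -mulrA.
  apply: le_trans (cond_mean_ge g0 ez); rewrite ler_wpM2l ?exprn_ge0 ?(ltW kappa_gt0) //.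
  rewrite (bigD1 i) //= ler_wpDr ?sumr_ge0 // => [k _|].
    by rewrite mulr_ge0 ?sqr_ge0 ?rate_ge0.
  rewrite ler_wpM2r ?sqr_ge0 // rateE ci mul1r ge_min.
  by case: ifP => _; rewrite lexx ?orbT.
move=> /(_ h) le1.
rewrite -real_normK ?num_real //.
have -> : #|A|%:R ^+ 2 / kappa ^+ #|A|.+1 * M = (#|A|%:R * Num.sqrt s2) ^+ 2.
  by rewrite exprMn sqr_sqrtr // /s2 mulrAC mulrA.
by rewrite lerXn2r // nnegrE // mulr_ge0 ?sqrtr_ge0.
Qed.

Definition local_cst (n : nat) : R :=
  (4 / (1 - rho) + 2) * (n%:R ^+ 2 / kappa ^+ n.+1).

Lemma local_cst_ge0 n : 0 <= local_cst n.
Proof.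
rewrite mulr_ge0 ?addr_ge0 ?divr_ge0 ?sqr_ge0 ?exprn_ge0 //; exact: ltW.
Qed.

Lemma nu_mean_not_full A i : i \in A ->
  1 - rho <= nuE (fun eta => (~~ full_on A eta)%:R).
Proof.
move=> iA; apply: le_trans (_ : nuE (fun eta : config d N => (~~ eta i)%:R) <= _).
  have := nu_mean_split (d := d) (N := N) hrho i (fun _ => 1).
  rewrite nu_mean_cst // (eq_nu_mean _ (g := fun eta =>
    (1 + rho / (1 - rho)) * (~~ eta i)%:R)) => [|eta]; last by rewrite mulr1 mulrC.
  have -> : 1 + rho / (1 - rho) = (1 - rho)^-1 by field; rewrite gt_eqF.
  by rewrite nu_meanZ => /(congr1 ( *%R (1 - rho))); rewrite mulr1 mulVKf ?gt_eqF // => <-.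
apply: ler_nu_mean => // eta; rewrite ler_nat; case: (boolP (eta i)) => //= ei.
by rewrite negb_forall_in lt0b; apply/exists_inP; exists i.
Qed.

(** With [g] the value of [f] after emptying [A], [f ^+ 2] is at most
    [2 * g ^+ 2 + 2 * (f - g) ^+ 2]. Since [g] does not see the sites of [A], it is independent of
    [V], and the mean of [V] factors out. *)
Lemma local_bound A V f (n : nat) : connected_set A -> (0 < #|A| <= n)%N ->
  (forall eta, 0 <= V eta <= 1) -> depends_on (mem A) V ->
  nuE (fun eta => V eta * (~~ full_on A eta)%:R * f eta ^+ 2) <=
  4 / (1 - rho) * nuE V * nuE (fun eta => f eta ^+ 2) +
  local_cst n * \sum_(i in A) dir i f.
Proof.
move=> cA /andP[/card_gt0P[i iA] An] V01 dV.
pose g eta := f (zero_on A eta).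
pose E := nuE (fun eta => (~~ full_on A eta)%:R * (f eta - g eta) ^+ 2).
have E0 : 0 <= E by apply: nu_mean_ge0 => // eta; rewrite mulr_ge0 ?sqr_ge0.
have D0 : 0 <= \sum_(i in A) dir i f by rewrite sumr_ge0 // => k _; exact: dirichlet_ge0.
have EleD : E <= n%:R ^+ 2 / kappa ^+ n.+1 * \sum_(i in A) dir i f.
  apply: le_trans (_ : #|A|%:R ^+ 2 / kappa ^+ #|A|.+1 * \sum_(i in A) dir i f <= _).
    rewrite /dirichlet -nu_mean_sum -(nu_mean_cond_mean rho (mem A)) -nu_meanZ.
    apply: ler_nu_mean => // eta.
    case: (boolP (full_on A eta)) => /= nf; last by rewrite mul1r zero_on_diff.
    rewrite mul0r mulr_ge0 ?divr_ge0 ?sqr_ge0 ?exprn_ge0 ?(ltW kappa_gt0) //.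
    apply: nu_mean_ge0 => // eta'; apply: sumr_ge0 => k _.
    by rewrite mulr_ge0 ?sqr_ge0 ?rate_ge0.
  rewrite ler_wpM2r // ler_pM ?sqr_ge0 ?invr_ge0 ?exprn_ge0 ?(ltW kappa_gt0) //.
    by rewrite lerXn2r ?nnegrE ?ler_nat.
  rewrite lef_pV2 ?posrE ?exprn_gt0 // ler_wiXn2l ?(ltW kappa_gt0) //.
have dg : depends_on [predC A] g.
  move=> eta eta' e; rewrite /g; congr f; apply/ffunP => k; rewrite !ffunE.
  by case: (boolP (k \in A)) => //= kA; rewrite e.
have dg2 : depends_on [predC A] (fun eta => g eta ^+ 2).
  by move=> eta eta' /dg ->.
have dnf : depends_on (mem A) (fun eta => (~~ full_on A eta)%:R : R).
  move=> eta eta' e; congr ((~~ _)%:R); apply: eq_forallb => k.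
  by case: (boolP (k \in A)) => //= kA; rewrite e.
(* Independence is used in the other direction: the event that [A] is not full has probability at
   least [1 - rho], and on it [g ^+ 2] is controlled by [f ^+ 2] and the squared difference. *)
have G : nuE (fun eta => g eta ^+ 2) * (1 - rho) <= 2 * nuE (fun eta => f eta ^+ 2) + 2 * E.
  apply: le_trans (_ : nuE (fun eta => g eta ^+ 2) * nuE (fun eta => (~~ full_on A eta)%:R) <= _).
    rewrite ler_wpM2l ?(nu_mean_not_full iA) //; apply: nu_mean_ge0 => // eta.
    exact: sqr_ge0.
  rewrite mulrC -(nu_mean_indep rho dnf dg2) -!nu_meanZ -nu_meanD.
  apply: ler_nu_mean => // eta; case: (~~ _) => /=; last first.
    by rewrite !mul0r mulr0 addr0 mulr_ge0 ?sqr_ge0.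
  by rewrite !mul1r; have := sqr_ge0 (2 * f eta - g eta); nra.
have V0 : 0 <= nuE V by apply: nu_mean_ge0 => // eta; case/andP: (V01 eta).
have V1 : nuE V <= 1.
  rewrite -[leRHS](nu_mean_cst d N rho); apply: ler_nu_mean => // eta.
  by case/andP: (V01 eta).
apply: le_trans (_ : 2 * (nuE V * nuE (fun eta => g eta ^+ 2)) + 2 * E <= _).
  rewrite -(nu_mean_indep rho dV dg2) -!nu_meanZ -nu_meanD.
  apply: ler_nu_mean => // eta; have /andP[v0 v1] := V01 eta.
  case: (~~ _) => /=; last first.
    by rewrite !mul0r !mulr0 mul0r addr0 mulr_ge0 // mulr_ge0 // sqr_ge0.
  rewrite mulr1 mul1r.
  apply: le_trans (_ : V eta * (2 * g eta ^+ 2 + 2 * (f eta - g eta) ^+ 2) <= _).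
    by rewrite ler_wpM2l //; have := sqr_ge0 (f eta - 2 * g eta); nra.
  by rewrite mulrDr mulrCA lerD2l -[leRHS]mul1r ler_wpM2r // mulr_ge0 // sqr_ge0.
move: G EleD; rewrite /local_cst.
set D := \sum_(i in A) _ in D0 *; set c := _ / kappa ^+ _.
move: (nuE V) V0 V1 (nuE _) (nuE _) E E0 => v v0 v1 F G E E0 h1 h2.
have {}h1 : G <= (2 * F + 2 * E) / (1 - rho) by rewrite ler_pdivlMr.
set r := (1 - rho)^-1 in h1 *.
have r0 : 0 <= r by rewrite invr_ge0 ltW.
apply: le_trans (_ : 2 * (v * ((2 * F + 2 * E) * r)) + 2 * E <= _).
  by rewrite lerD2r ler_wpM2l // ler_wpM2l.
have -> : 2 * (v * ((2 * F + 2 * E) * r)) + 2 * E =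
  4 * r * v * F + (4 * r * v + 2) * E by ring.
rewrite lerD2l -[leRHS]mulrA; apply: ler_pM => //.
  by rewrite addr_ge0 // mulr_ge0 // mulr_ge0.
by rewrite lerD2r -[leRHS]mulr1 ler_wpM2l // mulr_ge0.
Qed.

End Zeroing.

(** * Rectangles, fibres and paths in the box *)

Section Geometry.
Variables (d N : nat).
Implicit Types (S : {set 'I_d}) (x y z : box d N) (l : 'I_d) (lo hi : 'I_d -> nat) (A : {set box d N}).

(** Both the cubes on which zeros are spread and the fibres that carry paths to the boundary are
    rectangles, so connectedness is proved once. *)
Definition rect lo hi : {set box d N} :=
  [set z : box d N | [forall l, (lo l <= z l <= hi l)%N]]%SET.

Lemma rectP lo hi z : reflect (forall l, (lo l <= z l <= hi l)%N) (z \in rect lo hi).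
Proof. by rewrite inE; exact: forallP. Qed.

(** Through the default of [insubd], the coordinate is left unchanged when [a] is not below [N]. *)
Definition set_coord x l (a : nat) : box d N :=
  [ffun k => if k == l then insubd (x l) a else x k].

Lemma set_coord_same x l a : (a < N)%N -> set_coord x l a l = a :> nat.
Proof. by move=> aN; rewrite ffunE eqxx val_insubd aN. Qed.

Lemma set_coord_other x l a k : k != l -> set_coord x l a k = x k.
Proof. by rewrite ffunE => /negbTE ->. Qed.

Lemma adjacent_set_coord x l a : (a < N)%N ->
  (a = (x l).+1) \/ (a.+1 = x l) -> adjacent x (set_coord x l a).
Proof.
move=> aN e; apply/existsP; exists l; apply/orP; case: e => e; [left|right];
  apply/eqP/ffunP => k; rewrite [LHS]ffunE; (have [->|kl] := eqVneq k l;
  [rewrite set_coord_same // !ffunE eqxx|rewrite set_coord_other // !ffunE (negbTE kl)]);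
  lia.
Qed.

Lemma adjacent_coord x y l : adjacent x y -> (y l <= (x l).+1)%N /\ (x l <= (y l).+1)%N.
Proof.
by move=> /existsP[k] /orP[] /eqP /ffunP /(_ l); rewrite !ffunE; case: (l == k); lia.
Qed.

Definition rect_rel A : rel (box d N) := fun x y => adjacent x y && (y \in A).

(** Induction on the l1 distance: a coordinate that differs from that of [y] is moved one step
    towards it, which does not leave the rectangle. *)
Lemma rect_connect lo hi x y : x \in rect lo hi -> y \in rect lo hi ->
  connect (rect_rel (rect lo hi)) x y.
Proof.
have [n hn] : exists n, (\sum_l ((x l - y l) + (y l - x l)) <= n)%N.
  by exists (\sum_l ((x l - y l) + (y l - x l)))%N.
elim: n x hn => [|n IH] x hn xA yA.
  suff -> : x = y by exact: connect0.
  apply/ffunP => l; apply: val_inj => /=.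
  have : ((x l - y l) + (y l - x l) <= 0)%N.
    by apply: leq_trans hn; rewrite (bigD1 l) //= leq_addr.
  lia.
have [->|/eqP xy] := eqVneq x y; first exact: connect0.
have [l xl] : exists l, x l != y l.
  apply/existsP; rewrite -negb_forall; apply/negP => /forallP e; apply: xy.
  by apply/ffunP => l; apply/eqP.
pose a := (if (x l < y l)%N then (x l).+1 else (x l).-1).
have xlN : (x l : nat) <> y l by move/val_inj/eqP; apply/negP.
have := ltn_ord (x l); have := ltn_ord (y l) => yN xN.
have aN : (a < N)%N by rewrite /a; case: ifP => h; lia.
have xx' : adjacent x (set_coord x l a).
  apply: adjacent_set_coord => //; rewrite /a; case: ifP => h; [left|right] => //.
  by rewrite prednK //; lia.
have x'A : set_coord x l a \in rect lo hi.
  apply/rectP => k; have [->|kl] := eqVneq k l; last first.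
    by rewrite set_coord_other //; move/rectP: xA.
  rewrite set_coord_same //; move/rectP/(_ l): xA; move/rectP/(_ l): yA.
  rewrite /a; case: ifP; lia.
apply: connect_trans (connect1 _) (IH _ _ x'A yA); first by rewrite /rect_rel xx'.
rewrite -ltnS; apply: leq_trans hn; rewrite (bigD1 l) //= [in leqRHS](bigD1 l) //=.
have -> : (\sum_(k | k != l) ((set_coord x l a k - y k) + (y k - set_coord x l a k)) =
           \sum_(k | k != l) ((x k - y k) + (y k - x k)))%N.
  by apply: eq_bigr => k kl; rewrite set_coord_other.
rewrite ltn_add2r set_coord_same // /a; case: ifP => h; lia.
Qed.

Lemma rect_connected lo hi : connected_set (rect lo hi).
Proof.
move=> Z [j jA Zj] [i iA Zi]; have /connectP[p] := rect_connect iA jA.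
elim: p i iA Zi => [|x p IH] i iA Zi /=; first by move=> _ ji; move: Zi; rewrite -ji Zj.
move=> /andP[/andP[ix xA] pp] jl; have [Zx|Zx] := boolP (Z x); last exact: IH xA Zx pp jl.
by exists i, x.
Qed.

(** Repetitions are removed so that a flip at one position leaves the others alone and each
    Dirichlet form along the path is counted once. *)
Lemma rect_path lo hi x y : x \in rect lo hi -> y \in rect lo hi ->
  exists s : seq (box d N), [/\ uniq s, {subset s <= rect lo hi}, (0 < size s)%N,
    nth x s 0 = x /\ nth x s (size s).-1 = y &
    forall k, (k.+1 < size s)%N -> adjacent (nth x s k) (nth x s k.+1)].
Proof.
move=> xA yA; have /connectP[p0 hp0 ->] := rect_connect xA yA.
case: (shortenP hp0) => p hp up _; exists (x :: p); split => //.
- move=> z; rewrite inE => /predU1P[-> //|].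
  elim: p x {xA hp0 up} hp => //= u p IH x /andP[/andP[_ uA] hp].
  by rewrite inE => /predU1P[-> //|]; exact: IH hp.
- by rewrite /= -last_nth.
- move=> k; rewrite /= ltnS => kp; move: hp => /(pathP x) /(_ k kp) /andP[] //.
Qed.

Lemma path_coord (v : nat -> box d N) (L : nat) l :
  (forall k, (k.+1 < L)%N -> adjacent (v k) (v k.+1)) ->
  forall k n, (k + n < L)%N -> (v k l <= v (k + n)%N l + n)%N /\ (v (k + n)%N l <= v k l + n)%N.
Proof.
move=> adj k; elim => [|n IH] kn; first by rewrite !addn0.
have := IH ltac:(lia); have := adjacent_coord l (adj (k + n)%N ltac:(lia)).
by rewrite [(k + _.+1)%N]addnS; lia.
Qed.

Definition cube (r : nat) y := rect (fun l => (y l - r)%N) (fun l => (y l + r)%N).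

(** The affine subspace through [y] along the directions outside [S]; its rectangular form makes
    [rect_path] available inside it. *)
Definition fiber (S : {set 'I_d}) y :=
  rect (fun l => if l \in S then val (y l) else 0%N) (fun l => if l \in S then val (y l) else N).

Definition inner (r : nat) : {set box d N} :=
  [set y : box d N | [forall l, (r <= y l)%N && (y l + r < N)%N]]%SET.

Lemma innerP r y : reflect (forall l, (r <= y l)%N /\ (y l + r < N)%N) (y \in inner r).
Proof.
by rewrite inE; apply: (iffP forallP) => h l; [apply/andP|have /andP := h l].
Qed.

Lemma cubeP r y z : reflect (forall l, (y l <= z l + r)%N /\ (z l <= y l + r)%N) (z \in cube r y).
Proof. by apply: (iffP (rectP _ _ _)) => h l; have := h l; lia. Qed.

Lemma cube_refl r y : y \in cube r y.
Proof. by apply/cubeP => l; rewrite leq_addr. Qed.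

Lemma cube_sym r y z : (z \in cube r y) = (y \in cube r z).
Proof. by apply/cubeP/cubeP => h l; have := h l; tauto. Qed.

Lemma fiberP S y z : reflect (forall l, l \in S -> z l = y l) (z \in fiber S y).
Proof.
apply: (iffP (rectP _ _ _)) => h l; have := h l.
  by move=> /[swap] ->; rewrite -eqn_leq => /eqP /val_inj.
by case: (l \in S) => [/(_ isT) ->|_]; rewrite ?leqnn //= ltnW.
Qed.

Lemma fiber_refl S y : y \in fiber S y.
Proof. exact/fiberP. Qed.

Lemma fiber_sym S y z : (z \in fiber S y) = (y \in fiber S z).
Proof. by apply/fiberP/fiberP => h l /h. Qed.

Lemma card_coordwise (P : 'I_d -> pred 'I_N) :
  #|[set y : box d N | [forall l, P l (y l)]]%SET| = (\prod_l #|P l|)%N.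
Proof.
transitivity (\prod_l \sum_(a : 'I_N) (P l a))%N; last first.
  apply: eq_bigr => l _; rewrite -sum1_card [RHS]big_mkcond.
  by apply: eq_bigr => a _; rewrite unfold_in; case: (P l a).
rewrite bigA_distr_bigA -sum1_card big_mkcond; apply: eq_bigr => y _ /=.
rewrite inE; case: forallP => [h|/forallP]; first by rewrite big1 // => l _; rewrite h.
by rewrite negb_forall => /existsP[l /negbTE hl]; rewrite (bigD1 l) //= hl.
Qed.

Lemma card_interval (a c : nat) : (#|[pred t : 'I_N | a <= t < c]| <= c - a)%N.
Proof.
rewrite -(size_iota a (c - a)) cardE -(size_map val).
apply: uniq_leq_size; first by rewrite map_inj_uniq ?enum_uniq //; exact: val_inj.
by move=> k /mapP[t]; rewrite mem_enum inE => h -> /=; rewrite mem_iota; move: h => /=; lia.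
Qed.

Lemma card_cube r y : (#|cube r y| <= (2 * r).+1 ^ d)%N.
Proof.
rewrite /cube /rect (card_coordwise (fun l t => (y l - r <= t <= y l + r)%N)).
rewrite -[d in (_ ^ d)%N]card_ord -prod_nat_const; apply: leq_prod => l _.
apply: leq_trans (card_interval (y l - r) (y l + r).+1) _; lia.
Qed.

Lemma card_fiber S y : (#|fiber S y| <= N ^ (d - #|S|))%N.
Proof.
rewrite /fiber /rect (card_coordwise (fun l t => ((if l \in S then val (y l) else 0%N) <= t
   <= (if l \in S then val (y l) else N))%N)).
rewrite (bigID (mem S)) /= -[leqRHS]mul1n; apply: leq_mul.
  rewrite big1 // => l ->; apply/eqP; rewrite eqn_leq; apply/andP; split.
    by apply: leq_trans (card_interval (y l) (y l).+1) _; rewrite subSnn.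
  by apply/card_gt0P; exists (y l); rewrite unfold_in /= !leqnn.
have -> : (d - #|S| = #|[predC S]|)%N by rewrite -[d in (d - _)%N]card_ord -(cardC (mem S)) addKn.
rewrite -prod_nat_const; apply: leq_prod => l _.
by rewrite -[leqRHS]card_ord max_card.
Qed.

Lemma card_not_inner r : (#|~: inner r| <= d * (2 * r) * N ^ d.-1)%N.
Proof.
pose bad l : {set box d N} :=
  [set y : box d N | [forall k, (k == l) ==> ~~ ((r <= y k) && (y k + r < N))%N]]%SET.
have sub : (~: inner r \subset \bigcup_l bad l)%SET.
  apply/fintype.subsetP => y; rewrite !inE negb_forall => /existsP[l hl].
  apply/bigcupP; exists l => //; rewrite inE; apply/forallP => k.
  by apply/implyP => /eqP ->.
apply: leq_trans (subset_leq_card sub) _.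
apply: leq_trans (_ : \sum_l #|bad l| <= _)%N.
  elim/big_ind2: _ => [|n A m B hA hB|//]; first by rewrite cards0.
  exact: leq_trans (leq_card_setU _ _) (leq_add hA hB).
rewrite -mulnA -[X in (X * _)%N]card_ord -sum_nat_const; apply: leq_sum => l _.
rewrite /bad (card_coordwise (fun k t => (k == l) ==> ~~ ((r <= t) && (t + r < N))%N)).
rewrite (bigD1 l) //=; apply: leq_mul.
  pose P := [pred t : 'I_N | 0 <= t < r]%N; pose Q := [pred t : 'I_N | N - r <= t < N]%N.
  have hP : (#|P| <= r)%N by apply: leq_trans (card_interval 0 r) _; rewrite subn0.
  have hQ : (#|Q| <= r)%N by apply: leq_trans (card_interval (N - r) N) _; lia.
  apply: leq_trans (_ : #|[predU P & Q]| <= _)%N.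
    apply: subset_leq_card; apply/fintype.subsetP => t; rewrite !inE unfold_in eqxx /= => h.
    by have := ltn_ord t; lia.
  by rewrite mul2n -addnn; apply: leq_trans (leq_add hP hQ); rewrite -cardUI leq_addr.
have -> : d.-1 = #|[pred k : 'I_d | k != l]| by rewrite cardC1 card_ord.
rewrite -prod_nat_const; apply: leq_prod => k _.
by rewrite -[leqRHS]card_ord max_card.
Qed.

Lemma card_inner r : (#|inner r| + #|~: inner r| = N ^ d)%N.
Proof. by rewrite cardsC card_ffun !card_ord. Qed.

End Geometry.

(** * The mass of full cubes, controlled from the empty boundary *)

Lemma path_cst_ge0 (R : realType) (rho : R) : 0 < rho < 1 -> 0 <= path_cst rho.
Proof.
move=> hrho; have t0 := two_site_cst_ge0 hrho; case/andP: hrho => r0 r1.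
have q1 : 0 <= 1 - (1 + rho) / 2 by lra.
have r1' : 0 <= 1 - rho by lra.
have r0' : 0 <= rho / (1 - rho) by rewrite divr_ge0 // ltW.
have e2 : 0 <= 2 / (1 - rho) by rewrite divr_ge0.
have e3 : 0 <= two_site_cst rho * 2 / (1 - (1 + rho) / 2) by rewrite divr_ge0 // mulr_ge0.
by rewrite addr_ge0 // mulr_ge0 // addr_ge0 // mulr_ge0.
Qed.

Section EmptyBoundary.
Variables (R : realType) (d N c : nat) (b : site d -> bool).
Hypothesis hb : boundary_of_dim N c b.
Implicit Types (eta : config d N) (y z : box d N).

(** [S] consists of the free directions of the empty hyperplane. Keeping the coordinates of [y] in
    [S] and taking the others from the hyperplane gives a site of the fibre that touches an empty
    boundary site. Fibres have at most [N ^ (d - c)] sites, which is the origin of this factor. *)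
Lemma empty_boundary_neighbour : exists (S : {set 'I_d}) (k : 'I_d), #|S| = c /\
  forall y, exists2 z, z \in fiber S y &
    (forall eta, constraint R b eta z = 1) /\ (z k = 0%N :> nat \/ (z k).+1 = N).
Proof.
have [k [upper [S [a [kS cS hbx]]]]] := hb; exists S, k; split=> // y.
have N0 : (0 < N)%N by apply: leq_ltn_trans (ltn_ord (y k)).
pose z : box d N := [ffun l => if l == k then insubd (y k) (if upper then N.-1 else 0%N)
                       else if l \in S then y l else a l].
have zk : z k = (if upper then N.-1 else 0%N) :> nat.
  by rewrite ffunE eqxx val_insubd; case: (upper); rewrite /= ?ltn_predL N0.
exists z.
  by apply/fiberP => l lS; rewrite ffunE lS; case: eqP => // lk; rewrite lk (negbTE kS) in lS.
split; last by rewrite zk; case: (upper); [right; rewrite prednK|left].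
move=> eta; pose x := if upper then pos z + unit_vec k else pos z - unit_vec k.
have xk : x k = (if upper then N.+1 else 0%N)%:Z.
  by rewrite /x; move: zk; case: (upper) => zk; rewrite !ffunE eqxx; move: zk; rewrite ?ffunE eqxx => ->; lia.
have xl l : l != k -> x l = pos z l.
  move=> /negbTE lk; have ul : unit_vec k l = 0 by rewrite ffunE lk.
  by rewrite /x; case: (upper); rewrite [LHS]ffunE ?[(- unit_vec k) l]ffunE ul ?oppr0 addr0.
have xout (i : box d N) : pos i != x.
  apply/eqP => /ffunP /(_ k); rewrite xk ffunE; have := ltn_ord (i k).
  by case: (upper); lia.
have bx : b x = false.
  apply/hbx; last first.
    split=> // l lk lS; rewrite xl // ffunE [RHS]ffunE; congr (Posz (nat_of_ord _).+1).
    by rewrite ffunE (negbTE lk) (negbTE lS).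
  split; first by move=> i; apply/eqP.
  by exists z, k; rewrite /x; case: (upper); [left|right].
have ex : extend b eta x = false.
  by rewrite /extend; case: pickP => // i; rewrite (negbTE (xout i)).
rewrite constraintE; suff -> : [exists j : 'I_d, ~~ extend b eta (pos z + unit_vec j) ||
  ~~ extend b eta (pos z - unit_vec j)] by [].
apply/existsP; exists k; move: ex; rewrite /x; case: (upper) => ->; rewrite ?orbT //.
Qed.

End EmptyBoundary.

Section FullCube.
Variables (R : realType) (d N : nat) (rho : R) (b : site d -> bool).
Hypothesis hrho : 0 < rho < 1.
Implicit Types (f : config d N -> R) (eta : config d N) (y z : box d N).

Local Notation nuE := (nu_mean rho).
Local Notation dir := (dirichlet rho b).

(** The path from [z] to [y] runs inside the fibre, so only the Dirichlet forms of the fibre appear.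
    Its last [r] sites lie within distance [r] of [y] and are therefore occupied when the cube is
    full. *)
Lemma full_cube_bound (S : {set 'I_d}) (k : 'I_d) (r : nat) y f :
  (exists2 z, z \in fiber S y &
    (forall eta, constraint R b eta z = 1) /\ (z k = 0%N :> nat \/ (z k).+1 = N)) ->
  y \in inner d N r ->
  nuE (fun eta => (full_on (cube r y) eta)%:R * f eta ^+ 2) <=
  (1 + 2 * (rho / (1 - rho))) * ((1 + rho) / 2) ^+ r * nuE (fun eta => f eta ^+ 2) +
  path_cst rho * \sum_(i in fiber S y) dir i f.
Proof.
move=> [z zS [cz zk]] /innerP yr.
have [s [us sS s0 [sz sy] adj]] := rect_path zS (fiber_refl S y).
pose v := nth z s; have [L eL] : exists L, L = size s by exists (size s).
rewrite -eL in s0 sy adj.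
have vadj n : (n.+1 < L)%N -> adjacent (v n) (v n.+1) by exact: adj.
have vinj n m : (n < L)%N -> (m < L)%N -> v n = v m -> n = m.
  by move=> nL mL /eqP; rewrite nth_uniq -?eL // => /eqP.
(* In direction [k] the site [z] is on a face and [y] is at least [r] away from it, while a step
   changes a coordinate by at most one. *)
have rL : (r < L)%N.
  have := @path_coord d N v L k vadj 0 L.-1; rewrite add0n prednK // => /(_ (leqnn _)).
  by rewrite /v sz sy; move: (yr k) zk s0; move: (nat_of_ord (z k)) (nat_of_ord (y k)); clear; lia.
have v0 eta : constraint R b eta (v 0%N) = 1 by rewrite /v sz.
have path_cst0 := path_cst_ge0 hrho.
apply: le_trans (le_trans (path_bound hrho vinj vadj v0 rL f) _).
  apply: ler_nu_mean => // eta; rewrite ler_wpM2r ?sqr_ge0 // ler_nat.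
  case: (boolP (full_on _ _)) => // /forall_inP h; rewrite lt0b; apply/forallP => l.
  apply/implyP => lL; apply: h; apply/cubeP => k'.
  have := @path_coord d N v L k' vadj l (L.-1 - l)%N; rewrite subnKC ?prednK //; last first.
    by rewrite -ltnS prednK.
  by move=> /(_ (leqnn _)); rewrite [v L.-1]sy; have := ltn_ord l; lia.
rewrite lerD2l ler_wpM2l //.
rewrite -(big_mkord xpredT (fun n => dir (v n) f)) eL -(big_nth z xpredT (fun i => dir i f)).
rewrite big_uniq //= [leRHS](bigID (mem s)) /= -[leLHS]addr0 lerD //.
  rewrite [leLHS]big_mkcond [leRHS]big_mkcond; apply: ler_sum => i _.
  by case: (boolP (i \in s)) => [/sS ->|]; rewrite ?andbF.
by rewrite sumr_ge0 // => i _; exact: dirichlet_ge0.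
Qed.

End FullCube.

(** * Averages of local functions along a line of distant sites *)

Section LineOfSites.
Variables (d N : nat) (l0 : 'I_d) (k : nat).
Implicit Types (y z : box d N).

Local Notation n := (k ^ 2)%N.

(** Large enough for the cube around [y] to contain the unit cubes around all [k ^ 2] sites of the
    line. Their number is a square so that the mean of the absolute value of the average is bounded
    by the plain [1 / k]. *)
Definition radius : nat := (3 * k ^ 2).+1.

Local Notation r := radius.

(* The sites y + 3 t e_l0 are far enough apart for the V's to be independent. *)
Definition shift_site (t : nat) y : box d N := set_coord y l0 (y l0 + 3 * t).

Lemma val_shift_site t y l : y \in inner d N r -> (t < n)%N ->
  shift_site t y l = (y l + (l == l0) * (3 * t))%N :> nat.
Proof.
move=> /innerP /(_ l0) [_ h] tn; rewrite /shift_site; have [->|ll0] := eqVneq l l0.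
  by rewrite set_coord_same ?mul1n //; move: h tn; rewrite /radius; lia.
by rewrite set_coord_other // mul0n addn0.
Qed.

Lemma cube_shift_site t y z : y \in inner d N r -> (t < n)%N ->
  z \in cube 1 (shift_site t y) -> z \in cube r y.
Proof.
move=> yr tn /cubeP h; apply/cubeP => l; move: (h l); rewrite val_shift_site // /radius.
by case: (l == l0); move: tn; lia.
Qed.

Lemma inner_shift_site t y : y \in inner d N r -> (t < n)%N ->
  shift_site t y \in inner d N 1.
Proof.
move=> yr tn; apply/innerP => l; rewrite val_shift_site //.
move: yr => /innerP /(_ l); rewrite /radius; case: (l == l0); move: tn; lia.
Qed.

Lemma shift_site_inj t : (t < n)%N -> {in inner d N r &, injective (shift_site t)}.
Proof.
move=> tn y z yr zr e; apply/ffunP => l; apply: val_inj => /=.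
have := congr1 (fun x : box d N => nat_of_ord (x l)) e; rewrite !val_shift_site //.
lia.
Qed.

End LineOfSites.

Section LocalAverages.
Variables (R : realType) (d N : nat) (rho : R).
Hypothesis hrho : 0 < rho < 1.
Implicit Types (eta : config d N) (y z : box d N).

Local Notation nuE := (nu_mean rho).

Lemma depends_on_sub (A B : {pred box d N}) (g : config d N -> R) :
  {subset A <= B} -> depends_on A g -> depends_on B g.
Proof. by move=> sAB dg eta eta' e; apply: dg => i /sAB; exact: e. Qed.

Variables (l0 : 'I_d) (k : nat) (V : box d N -> config d N -> R).
Hypothesis k_gt0 : (0 < k)%N.
Hypothesis V_le1 : forall i eta, `|V i eta| <= 1.
Hypothesis V_local : forall i, depends_on (mem (cube 1 i)) (V i).
Hypothesis V_centred : forall i, i \in inner d N 1 -> nuE (V i) = 0.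

Local Notation n := (k ^ 2)%N.

Local Notation r := (radius k).

Definition line_average y eta : R := n%:R^-1 * \sum_(t < n) V (shift_site l0 t y) eta.

Let n_gt0 : 0 < (n%:R : R).
Proof. by rewrite ltr0n expn_gt0 k_gt0. Qed.

Let n_neq0 : n%:R != 0 :> R.
Proof. by rewrite gt_eqF. Qed.

Lemma line_average_local y : y \in inner d N r ->
  depends_on (mem (cube r y)) (line_average y).
Proof.
move=> yr eta eta' e; congr (_ * _); apply: eq_bigr => t _.
by apply: V_local => i /(cube_shift_site yr (ltn_ord t)); exact: e.
Qed.

Lemma line_average_le1 y eta : `|line_average y eta| <= 1.
Proof.
rewrite normrM ger0_norm ?invr_ge0 ?ler0n // -[leRHS](mulVf n_neq0).
rewrite ler_wpM2l ?invr_ge0 ?ler0n //; apply: le_trans (ler_norm_sum _ _ _) _.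
apply: le_trans (ler_sum _ (fun i _ => V_le1 _ _)) _.
by rewrite sumr_const card_ord.
Qed.

(** Unit cubes around sites at distance at least 3 are disjoint, so different terms are independent
    and centred, and only the diagonal of the double sum remains. *)
Lemma line_average_sqr y : y \in inner d N r ->
  nuE (fun eta => line_average y eta ^+ 2) <= n%:R^-1.
Proof.
move=> yr.
rewrite (eq_nu_mean _ (g := fun eta => n%:R^-1 ^+ 2 *
   \sum_(t < n) \sum_(u < n) V (shift_site l0 t y) eta * V (shift_site l0 u y) eta)); last first.
  by move=> eta; rewrite exprMn; congr (_ * _); rewrite expr2 big_distrlr.
rewrite nu_meanZ expr2 -mulrA -[leRHS]mulr1 ler_wpM2l ?invr_ge0 ?ler0n //.
rewrite mulrC ler_pdivrMr // mul1r nu_mean_sum.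
have -> : n%:R = \sum_(t < n) 1 :> R by rewrite sumr_const card_ord.
apply: ler_sum => t _; rewrite nu_mean_sum (bigD1 t) //= big1 ?addr0.
  rewrite -[leRHS](nu_mean_cst d N rho); apply: ler_nu_mean => // eta.
  by rewrite -expr2 -real_normK ?num_real // expr_le1.
move=> u ut; rewrite (@nu_mean_indep _ _ _ _ (mem (cube 1 (shift_site l0 t y)))).
- by rewrite V_centred ?mul0r //; exact: inner_shift_site yr (ltn_ord t).
- exact: V_local.
- apply: depends_on_sub (@V_local _) => i iu; suff : i \notin cube 1 (shift_site l0 t y) by []; apply/negP => it.
  move: it iu => /cubeP /(_ l0) + /cubeP /(_ l0).
  rewrite !(@val_shift_site d N l0 k _ y _ yr) // eqxx; move/eqP: ut => ut.
  have : (t : nat) <> u by move=> /val_inj tu; apply: ut.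
  lia.
Qed.

Lemma line_average_mean y : y \in inner d N r ->
  nuE (fun eta => `|line_average y eta|) <= k%:R^-1.
Proof.
move=> yr; have k0 : 0 < (k%:R : R) by rewrite ltr0n.
(* AM-GM, with weights balanced for a second moment of order [1 / k ^ 2]. *)
apply: le_trans (_ : nuE (fun eta => k%:R^-1 / 2 + k%:R / 2 * line_average y eta ^+ 2) <= _).
  apply: ler_nu_mean => // eta; rewrite -[X in _ + _ * X]real_normK ?num_real //.
  move: `|_| => x; rewrite -subr_ge0.
  have -> : k%:R^-1 / 2 + k%:R / 2 * x ^+ 2 - x = (k%:R * x - 1) ^+ 2 / (2 * k%:R).
    by field; rewrite gt_eqF.
  by rewrite divr_ge0 ?sqr_ge0 // mulr_ge0 // ltW.
rewrite nu_meanD nu_mean_cst nu_meanZ.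
apply: le_trans (_ : k%:R^-1 / 2 + k%:R / 2 * n%:R^-1 <= _).
  by rewrite lerD2l ler_wpM2l ?line_average_sqr // divr_ge0 // ltW.
rewrite natrX le_eqVlt; apply/orP; left; apply/eqP; field; by rewrite gt_eqF.
Qed.

(** For each fixed [t], shifting the inner sites is injective, so the shifted sum misses exactly as
    many sites of the box as there are sites that are not inner; averaging over [t] keeps the
    bound. *)
Lemma sum_line_average eta :
  `|\sum_i V i eta - \sum_(y in inner d N r) line_average y eta| <=
  #|~: inner d N r|%:R.
Proof.
have one t : (t < n)%N ->
    `|\sum_i V i eta - \sum_(y in inner d N r) V (shift_site l0 t y) eta| <= #|~: inner d N r|%:R.
  move=> tn; pose I : {set box d N} := [set shift_site l0 t y | y in inner d N r]%SET.
  have -> : \sum_(y in inner d N r) V (shift_site l0 t y) eta = \sum_(i in I) V i eta.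
    by rewrite big_imset //=; exact: shift_site_inj.
  rewrite (bigID (mem I)) /= addrAC subrr add0r.
  have -> : #|~: inner d N r| = #|~: I|.
    have cI : #|I| = #|inner d N r| by rewrite card_in_imset //; exact: shift_site_inj.
    by apply/(@addnI #|I|); rewrite {1}cI !cardsC.
  apply: le_trans (ler_norm_sum _ _ _) _.
  apply: le_trans (ler_sum _ (fun i _ => V_le1 _ _)) _.
  by rewrite sumr_const; rewrite le_eqVlt; apply/orP; left; apply/eqP; congr (_%:R);
    apply: eq_card => i; rewrite !inE.
have -> : \sum_i V i eta - \sum_(y in inner d N r) line_average y eta =
   n%:R^-1 * \sum_(t < n) (\sum_i V i eta - \sum_(y in inner d N r) V (shift_site l0 t y) eta).
  rewrite sumrB sumr_const card_ord mulrBr -[(\sum_i V i eta) *+ _]mulr_natl mulKf //; congr (_ - _).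
  by rewrite exchange_big mulr_sumr.
rewrite normrM ger0_norm ?invr_ge0 ?ler0n // mulrC ler_pdivrMr //.
apply: le_trans (ler_norm_sum _ _ _) _.
apply: le_trans (ler_sum _ (fun (t : 'I_n) _ => one t (ltn_ord t))) _.
by rewrite sumr_const card_ord mulr_natr.
Qed.

End LocalAverages.

(** * The functional inequality and its asymptotic form *)

(** Double counting: by symmetry each [i] belongs to at most [m] of the sets [B y]. It is applied to
    cubes, with [m] independent of [N], and to fibres, with [m = N ^ (d - c)]. *)
Lemma exchange_sum_le (R : realType) (T : finType) (B : T -> {set T}) (m : nat)
    (A : {set T}) (g : T -> R) :
  (forall y z, (z \in B y) = (y \in B z)) -> (forall y, (#|B y| <= m)%N) ->
  (forall i, 0 <= g i) ->
  \sum_(y in A) \sum_(i in B y) g i <= m%:R * \sum_i g i.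
Proof.
move=> Bsym Bm g0.
apply: le_trans (_ : \sum_y \sum_(i in B y) g i <= _).
  rewrite [leRHS](bigID (mem A)) /= lerDl sumr_ge0 // => y _.
  by rewrite sumr_ge0.
rewrite (exchange_big_dep xpredT) //= mulr_sumr; apply: ler_sum => i _.
rewrite (eq_bigl (mem (B i))) => [|y]; last by rewrite /= Bsym.
by rewrite sumr_const -[g i *+ _]mulr_natl ler_wpM2r // ler_nat.
Qed.

Section FunctionalInequality.
Variables (R : realType) (d N c : nat) (rho : R) (b : site d -> bool).
Hypothesis hrho : 0 < rho < 1.
Hypothesis hb : boundary_of_dim N c b.
Variables (l0 : 'I_d) (k : nat) (V : box d N -> config d N -> R).
Hypothesis k_gt0 : (0 < k)%N.
Hypothesis V_le1 : forall i eta, `|V i eta| <= 1.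
Hypothesis V_local : forall i, depends_on (mem (cube 1 i)) (V i).
Hypothesis V_centred : forall i, i \in inner d N 1 -> nu_mean rho (V i) = 0.
Variable f : config d N -> R.

Local Notation nuE := (nu_mean rho).
Local Notation r := (radius k).
Local Notation m := ((2 * r).+1 ^ d)%N.
Local Notation Dsum := (\sum_i dirichlet rho b i f).
Local Notation norm2 := (nuE (fun eta => f eta ^+ 2)).
Local Notation W := (line_average l0 k V).
Local Notation nf y eta := ((~~ full_on (cube r y) eta)%:R : R).
Local Notation fu y eta := ((full_on (cube r y) eta)%:R : R).

Let norm2_ge0 : 0 <= norm2.
Proof. by apply: nu_mean_ge0 => // eta; exact: sqr_ge0. Qed.

Let D_ge0 i : 0 <= dirichlet rho b i f.
Proof. exact: dirichlet_ge0. Qed.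

(** [local_bound] is applied with [V] equal to the absolute value of the line average, whose mean
    under [nu] is at most [1 / k]. *)
Lemma sum_line_average_not_full :
  \sum_(y in inner d N r) nuE (fun eta => `|W y eta| * nf y eta * f eta ^+ 2) <=
  #|inner d N r|%:R * (4 / (1 - rho) * k%:R^-1) * norm2 + local_cst rho m * m%:R * Dsum.
Proof.
have r1 : 0 < 1 - rho by rewrite subr_gt0; case/andP: hrho.
apply: le_trans (_ : \sum_(y in inner d N r) (4 / (1 - rho) * k%:R^-1 * norm2 +
   local_cst rho m * \sum_(i in cube r y) dirichlet rho b i f) <= _); last first.
  rewrite big_split /= -[X in _ + X]mulr_sumr; apply: lerD; last rewrite -mulrA.
    by rewrite -mulr_sumr sumr_const -[norm2 *+ _]mulr_natl mulrCA -[leRHS]mulrA.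
  rewrite ler_wpM2l ?local_cst_ge0 //; apply: exchange_sum_le => // y.
    by move=> z; exact: cube_sym.
  exact: card_cube.
apply: ler_sum => y yr.
apply: le_trans (@local_bound R d N rho b hrho (cube r y)
  (fun eta => `|W y eta|) f m (@rect_connected d N _ _) _ _ _) _.
- by rewrite card_cube andbT; apply/card_gt0P; exists y; exact: cube_refl.
- by move=> eta; rewrite normr_ge0 line_average_le1.
- by move=> eta eta' e; rewrite (line_average_local l0 V_local yr e).
rewrite lerD2r ler_wpM2r // ler_wpM2l ?divr_ge0 ?(ltW r1) //.
exact: line_average_mean.
Qed.

Lemma sum_full :
  \sum_(y in inner d N r) nuE (fun eta => fu y eta * f eta ^+ 2) <=
  #|inner d N r|%:R * ((1 + 2 * (rho / (1 - rho))) * ((1 + rho) / 2) ^+ r) * norm2 +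
  path_cst rho * (N ^ (d - c))%:R * Dsum.
Proof.
have [S [l [cS hS]]] := empty_boundary_neighbour R hb.
apply: le_trans (_ : \sum_(y in inner d N r)
   ((1 + 2 * (rho / (1 - rho))) * ((1 + rho) / 2) ^+ r * norm2 +
   path_cst rho * \sum_(i in fiber S y) dirichlet rho b i f) <= _); last first.
  rewrite big_split /= -[X in _ + X]mulr_sumr; apply: lerD; last rewrite -mulrA.
    by rewrite -mulr_sumr sumr_const -[norm2 *+ _]mulr_natl mulrCA -[leRHS]mulrA.
  rewrite ler_wpM2l ?path_cst_ge0 //; apply: exchange_sum_le => // y.
    by move=> z; exact: fiber_sym.
  by rewrite -cS; exact: card_fiber.
by apply: ler_sum => y yr; exact: (full_cube_bound hrho f (hS y) yr).
Qed.

Lemma functional_bound :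
  nuE (fun eta => `|\sum_i V i eta| * f eta ^+ 2) <=
  (#|~: inner d N r|%:R + #|inner d N r|%:R * (4 / (1 - rho) * k%:R^-1) +
   #|inner d N r|%:R * ((1 + 2 * (rho / (1 - rho))) * ((1 + rho) / 2) ^+ r)) * norm2 +
  (path_cst rho * (N ^ (d - c))%:R + local_cst rho m * m%:R) * Dsum.
Proof.
apply: le_trans (_ : #|~: inner d N r|%:R * norm2 +
  (\sum_(y in inner d N r) nuE (fun eta => `|W y eta| * nf y eta * f eta ^+ 2) +
   \sum_(y in inner d N r) nuE (fun eta => fu y eta * f eta ^+ 2)) <= _); last first.
  have h1 := sum_line_average_not_full; have h2 := sum_full.
  apply: le_trans (lerD (lexx _) (lerD h1 h2)) _.
  by rewrite le_eqVlt; apply/orP; left; apply/eqP; ring.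
rewrite -!nu_mean_sum -nu_meanZ -!nu_meanD; apply: ler_nu_mean => // eta.
rewrite -!mulr_suml -!mulrDl ler_wpM2r ?sqr_ge0 //.
have := sum_line_average l0 k_gt0 V_le1 eta.
set X := \sum_i _; set Y := \sum_(y in _) _ => h.
apply: le_trans (_ : `|X - Y| + `|Y| <= _).
  by have := ler_normD (X - Y) Y; rewrite subrK.
rewrite lerD // -big_split /=; apply: le_trans (ler_norm_sum _ _ _) _.
apply: ler_sum => y _; case: (full_on _ _) => /=; rewrite ?mulr0 ?mulr1 ?add0r ?addr0 //.
exact: line_average_le1.
Qed.

Lemma functional_bound_above :
  (forall i eta, i \in inner d N 1 -> full_on (cube 1 i) eta -> V i eta <= 0) ->
  nuE (fun eta => (\sum_i V i eta) * f eta ^+ 2) <=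
  (#|~: inner d N r|%:R + #|inner d N r|%:R * (4 / (1 - rho) * k%:R^-1)) * norm2 +
  local_cst rho m * m%:R * Dsum.
Proof.
move=> V_full.
apply: le_trans (_ : #|~: inner d N r|%:R * norm2 +
  \sum_(y in inner d N r) nuE (fun eta => `|W y eta| * nf y eta * f eta ^+ 2) <= _); last first.
  have h1 := sum_line_average_not_full.
  apply: le_trans (lerD (lexx _) h1) _.
  by rewrite le_eqVlt; apply/orP; left; apply/eqP; ring.
rewrite -!nu_mean_sum -nu_meanZ -!nu_meanD; apply: ler_nu_mean => // eta.
rewrite -!mulr_suml -!mulrDl ler_wpM2r ?sqr_ge0 //.
have := sum_line_average l0 k_gt0 V_le1 eta.
set X := \sum_i _; set Y := \sum_(y in _) _ => h.
rewrite -[X in X <= _](subrK Y); apply: lerD; first exact: le_trans (ler_norm _) h.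
apply: ler_sum => y yr; case: (boolP (full_on _ _)) => [hf|_]; last first.
  by rewrite mulr1 ler_norm.
rewrite mulr0 mulr_ge0_le0 ?invr_ge0 ?ler0n // sumr_le0 // => t _.
apply: V_full; first exact: inner_shift_site yr (ltn_ord t).
by apply/forall_inP => i it; move/forall_inP: hf; apply; exact: cube_shift_site yr (ltn_ord t) it.
Qed.

End FunctionalInequality.

Section RateSupport.
Variables (R : realType) (d : nat) (rho : R).

Lemma rate_local N (b : site d -> bool) i :
  depends_on (mem (cube 1 i)) (rate rho b i : config d N -> R).
Proof.
move=> eta eta' e; rewrite !rateE e ?cube_refl //; congr (_ * _).
apply: constraint_dep => k; apply: extend_eq => j hj; apply: e; apply/cubeP => l;
  have := congr1 (fun x : site d => x l) hj; rewrite !ffunE; case: (l == k); lia.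
Qed.

Lemma rate_full N (b : site d -> bool) i (eta : config d N) :
  i \in inner d N 1 -> full_on (cube 1 i) eta -> rate rho b i eta = 0.
Proof.
move=> /innerP hi /forall_inP hf; have bi : bulk i by move=> l; have := hi l; lia.
rewrite rateE constraintE; case: existsP => [[k]|]; last by rewrite mul0r.
have up : nb_up i k \in cube 1 i.
  by apply/cubeP => l; rewrite val_up //; case: (l == k); lia.
have down : nb_down i k \in cube 1 i.
  by apply/cubeP => l; rewrite val_down //; case: (l == k); lia.
by rewrite (pos_up bi) (pos_down bi) !extend_pos (hf _ up) (hf _ down).
Qed.

End RateSupport.

Section Asymptotics.
Variables (R : realType) (d : nat) (rho : R).
Hypothesis hrho : 0 < rho < 1.
Variable l0 : 'I_d.

Let rho_gt0 : 0 < rho. Proof. by case/andP: hrho. Qed.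
Let rho_lt1 : 0 < 1 - rho. Proof. by rewrite subr_gt0; case/andP: hrho. Qed.

(** Two scales: [k] is chosen first and makes the fluctuation and the full-cube terms small relative
    to the volume; then [N] is taken large compared with the radius, so that the boundary layer
    becomes negligible. *)
Lemma coarse_error (eps : R) : 0 < eps -> exists k N0 : nat, (0 < k)%N /\
  forall N, (N0 <= N)%N ->
  #|~: inner d N (radius k)|%:R + #|inner d N (radius k)|%:R * (4 / (1 - rho) * k%:R^-1) +
  #|inner d N (radius k)|%:R * ((1 + 2 * (rho / (1 - rho))) * ((1 + rho) / 2) ^+ radius k)
  <= eps * N%:R ^+ d :> R.
Proof.
move=> eps0; have e3 : 0 < eps / 3 by rewrite divr_gt0.
set K := 1 + 2 * (rho / (1 - rho)).
have K0 : 0 < K by rewrite addr_gt0 // mulr_gt0 // divr_gt0.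
have q01 : `|(1 + rho) / 2| < 1.
  by rewrite ger0_norm; have := rho_gt0; have := rho_lt1; lra.
have q0 : 0 <= (1 + rho) / 2 by have := rho_gt0; lra.
have [n0 _ hn0] : \forall n \near \oo, `|0 - ((1 + rho) / 2) ^+ n| < eps / 3 / K.
  by have /cvgrPdist_lt /(_ (eps / 3 / K)) := cvg_expr q01; apply; rewrite divr_gt0.
pose k0 := Num.bound (4 / (1 - rho) / (eps / 3)).
pose k := maxn k0.+1 n0.
have k1 : (0 < k)%N by rewrite /k leq_max.
have kA : 4 / (1 - rho) * k%:R^-1 <= eps / 3.
  rewrite ler_pdivrMr ?ltr0n // [_ / 3 * _]mulrC -ler_pdivrMr //.
  have x0 : 0 <= 4 / (1 - rho) / (eps / 3) by rewrite ltW // divr_gt0 // divr_gt0.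
  by apply: le_trans (ltW (archi_boundP x0)) _; rewrite ler_nat /k leq_max leqnSn.
have kB : K * ((1 + rho) / 2) ^+ radius k <= eps / 3.
  have /= := hn0 (radius k); rewrite sub0r normrN ger0_norm ?exprn_ge0 // => h.
  rewrite mulrC -ler_pdivlMr // ltW // h //.
  have : (n0 <= k)%N by rewrite /k leq_max leqnn orbT.
  move=> n0k; apply: leq_trans n0k _; rewrite /radius.
  have : (k <= k ^ 2)%N by rewrite leq_pmulr.
  lia.
pose r := radius k.
pose N0 := (Num.bound ((d * (2 * r))%:R / (eps / 3) : R)).+1.
exists k, N0; split => // N hN.
have N_gt0 : (0 < N)%N by apply: leq_trans hN.
have cin : #|inner d N r|%:R <= N%:R ^+ d :> R.
  by rewrite -natrX ler_nat -(card_inner d N r) leq_addr.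
have cnot : #|~: inner d N r|%:R <= eps / 3 * N%:R ^+ d :> R.
  apply: le_trans (_ : (d * (2 * r) * N ^ d.-1)%:R <= _); first by rewrite ler_nat card_not_inner.
  have d0 : (0 < d)%N by apply: leq_ltn_trans (ltn_ord l0).
  rewrite -[in leRHS](prednK d0) exprS natrM natrX mulrA ler_wpM2r ?exprn_ge0 //.
  rewrite mulrC -ler_pdivrMr //; have x0 : 0 <= (d * (2 * r))%:R / (eps / 3) :> R by rewrite divr_ge0 // ltW.
  by apply: le_trans (ltW (archi_boundP x0)) _; rewrite ler_nat ltnW.
have Nd : 0 <= N%:R ^+ d :> R by rewrite exprn_ge0.
have -> : eps * N%:R ^+ d = eps / 3 * N%:R ^+ d + N%:R ^+ d * (eps / 3) + N%:R ^+ d * (eps / 3).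
  by field.
rewrite lerD // ?lerD // ler_pM //.
  by rewrite mulr_ge0 ?invr_ge0 ?divr_ge0 // ltW.
by rewrite mulr_ge0 ?exprn_ge0 // ltW.
Qed.

(** The order of the quantifiers is essential: [C] depends on [eps] but not on [N], [c], [b] or [V],
    and it multiplies no power of [N], so a vanishing tilt absorbs it. The other constant,
    [path_cst rho], is independent of [eps]. *)
Lemma asymptotic_bound (eps : R) : 0 < eps -> exists (C : R) (N0 : nat), 0 <= C /\
  forall N c (b : site d -> bool) (V : box d N -> config d N -> R),
  (N0 <= N)%N -> boundary_of_dim N c b ->
  (forall i eta, `|V i eta| <= 1) -> (forall i, depends_on (mem (cube 1 i)) (V i)) ->
  (forall i, i \in inner d N 1 -> nu_mean rho (V i) = 0) ->
  forall f : config d N -> R,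
  nu_mean rho (fun eta => `|\sum_i V i eta| * f eta ^+ 2) <=
    eps * N%:R ^+ d * nu_mean rho (fun eta => f eta ^+ 2) +
    (path_cst rho * N%:R ^+ (d - c) + C) * \sum_i dirichlet rho b i f /\
  ((forall i eta, i \in inner d N 1 -> full_on (cube 1 i) eta -> V i eta <= 0) ->
   nu_mean rho (fun eta => (\sum_i V i eta) * f eta ^+ 2) <=
    eps * N%:R ^+ d * nu_mean rho (fun eta => f eta ^+ 2) +
    C * \sum_i dirichlet rho b i f).
Proof.
move=> /coarse_error[k [N0 [k0 hN0]]].
exists (local_cst rho ((2 * radius k).+1 ^ d) * ((2 * radius k).+1 ^ d)%:R), N0.
split=> [|N c b V NN0 hb V1 Vl Vc f]; first by rewrite mulr_ge0 ?local_cst_ge0.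
have f0 : 0 <= nu_mean rho (fun eta => f eta ^+ 2).
  by apply: nu_mean_ge0 => // eta; exact: sqr_ge0.
have err := hN0 N NN0; split.
  apply: le_trans (functional_bound hrho hb l0 k0 V1 Vl Vc f) _.
  by rewrite natrX lerD2r ler_wpM2r.
move=> Vf; apply: le_trans (functional_bound_above b hrho l0 k0 V1 Vl Vc f Vf) _.
rewrite lerD2r ler_wpM2r //; apply: le_trans err; rewrite lerDl.
have K0 : 0 <= 1 + 2 * (rho / (1 - rho)).
  by rewrite addr_ge0 // mulr_ge0 // divr_ge0 // ltW.
have q0 : 0 <= (1 + rho) / 2 by rewrite divr_ge0 // addr_ge0 // ltW.
by rewrite mulr_ge0 // mulr_ge0 // exprn_ge0.
Qed.

Lemma mean_rate_itv : 0 <= mean_rate rho d <= 1.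
Proof.
rewrite /mean_rate; apply/andP; split.
  by apply: nu_mean_ge0 => // eta; exact: rate_ge0.
by rewrite -[leRHS](nu_mean_cst d 3 rho); apply: ler_nu_mean => // eta; exact: rate_le1.
Qed.

Lemma asymptotic_particles (eps : R) : 0 < eps -> exists (C : R) (N0 : nat), 0 <= C /\
  forall N c (b : site d -> bool), (N0 <= N)%N -> boundary_of_dim N c b ->
  forall f : config d N -> R,
  nu_mean rho (fun eta => `|particles R eta - N%:R ^+ d * rho| * f eta ^+ 2) <=
    eps * N%:R ^+ d * nu_mean rho (fun eta => f eta ^+ 2) +
    (path_cst rho * N%:R ^+ (d - c) + C) * \sum_i dirichlet rho b i f.
Proof.
move=> /asymptotic_bound[C [N0 [C0 h]]]; exists C, N0; split=> // N c b NN0 hb f.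
have [] := h N c b (fun i eta => (eta i)%:R - rho) NN0 hb _ _ _ f.
- by move=> i eta; rewrite ler_norml; have := rho_gt0; have := rho_lt1; case: (eta i) => /=; lra.
- by move=> i eta eta' e; rewrite e //; exact: cube_refl.
- move=> i _; rewrite nu_meanB nu_mean_cst; apply/eqP; rewrite subr_eq0; apply/eqP.
  have := nu_mean_prod rho (fun (j : box d N) x => if j == i then (x%:R : R) else 1).
  rewrite (bigD1 i) //= eqxx mulr1 mulr0 addr0 big1 ?mulr1 => [e|j /negbTE ->].
    by rewrite -[RHS]e; apply: eq_nu_mean => eta; rewrite -big_mkcond big_pred1_eq.
  by rewrite !mulr1 addrC subrK.
move=> h1 _; apply: le_trans h1; apply: ler_nu_mean => // eta.
rewrite ler_wpM2r ?sqr_ge0 // sumrB sumr_const -[rho *+ _]mulr_natl.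
by rewrite card_ffun !card_ord natrX.
Qed.

Lemma asymptotic_total_rate (eps : R) : 0 < eps -> exists (C : R) (N0 : nat), 0 <= C /\
  forall N c (b : site d -> bool), (N0 <= N)%N -> boundary_of_dim N c b ->
  forall f : config d N -> R,
  nu_mean rho (fun eta => `|total_rate rho b eta - N%:R ^+ d * mean_rate rho d| * f eta ^+ 2) <=
    eps * N%:R ^+ d * nu_mean rho (fun eta => f eta ^+ 2) +
    (path_cst rho * N%:R ^+ (d - c) + C) * \sum_i dirichlet rho b i f /\
  nu_mean rho (fun eta => (total_rate rho b eta - N%:R ^+ d * mean_rate rho d) * f eta ^+ 2) <=
    eps * N%:R ^+ d * nu_mean rho (fun eta => f eta ^+ 2) +
    C * \sum_i dirichlet rho b i f.
Proof.
move=> /asymptotic_bound[C [N0 [C0 h]]]; exists C, N0; split=> // N c b NN0 hb f.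
have /andP[A0 A1] := mean_rate_itv.
have E (eta : config d N) : \sum_i (rate rho b i eta - mean_rate rho d) =
    total_rate rho b eta - N%:R ^+ d * mean_rate rho d :> R.
  by rewrite sumrB sumr_const -[mean_rate _ _ *+ _]mulr_natl card_ffun !card_ord natrX.
have [] := h N c b (fun i eta => rate rho b i eta - mean_rate rho d) NN0 hb _ _ _ f.
- move=> i eta; rewrite ler_norml.
  have := rate_ge0 b hrho eta i; have := rate_le1 b hrho eta i; lra.
- by move=> i eta eta' e; rewrite (rate_local rho b e).
- move=> i /innerP hi; rewrite nu_meanB nu_mean_cst.
  by rewrite mean_rate_bulk ?subrr // => l; have := hi l; lia.
move=> h1 h2; split.
  by apply: le_trans h1; apply: ler_nu_mean => // eta; rewrite E.
apply: le_trans (h2 _); first by apply: ler_nu_mean => // eta; rewrite E.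
by move=> i eta ii hf; rewrite (rate_full rho b ii hf) sub0r oppr_le0.
Qed.

End Asymptotics.

(** * The semigroup and the tilted step for a small mesh *)

(** Follows from [(1 - x) * expR x <= 1], as [(1 - x) * (1 + x + 2 * x ^+ 2)] equals
    [1 + x ^+ 2 * (1 - 2 * x)]. *)
Lemma expR_le_quadratic (R : realType) (x : R) : x <= 1 / 2 ->
  expR x <= 1 + x + 2 * x ^+ 2.
Proof.
move=> x1; have h : 0 < 1 - x by lra.
have := expR_ge1Dx (- x); rewrite expRN => e1.
have := expR_gt0 x => e0.
have : (1 - x) * expR x <= 1.
  by have := ler_wpM2r (ltW e0) e1; rewrite mulVf // gt_eqF.
move=> e2; rewrite -(ler_pM2l h); apply: le_trans e2 _.
have : 0 <= x ^+ 2 * (1 - 2 * x) by rewrite mulr_ge0 ?sqr_ge0 //; lra.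
nra.
Qed.

Lemma expR_quadratic (R : realType) (x : R) : `|x| <= 1 / 2 ->
  `|expR x - (1 + x)| <= 2 * x ^+ 2.
Proof.
move=> hx; have x1 : x <= 1 / 2 by apply: le_trans hx; exact: ler_norm.
rewrite ger0_norm ?subr_ge0 ?expR_ge1Dx //.
by have := expR_le_quadratic x1; lra.
Qed.

Lemma expR_le1Dx (R : realType) (x : R) : - 1 / 2 <= x ->
  expR (x - 2 * x ^+ 2) <= 1 + x.
Proof.
move=> x1; have h : 0 < 1 + x by lra.
have := expR_ge1Dx (- (x - 2 * x ^+ 2)); rewrite expRN => e1.
have e0 := expR_gt0 (x - 2 * x ^+ 2).
have := ler_wpM2r (ltW e0) e1; rewrite mulVf ?gt_eqF // => e2.
have p : 1 <= (1 + x) * (1 + - (x - 2 * x ^+ 2)).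
  have : 0 <= x ^+ 2 * (1 + 2 * x) by rewrite mulr_ge0 ?sqr_ge0 //; lra.
  nra.
have q : 0 < 1 + - (x - 2 * x ^+ 2) by have := sqr_ge0 x; nra.
rewrite -(ler_pM2l q); apply: le_trans e2 _; rewrite mulrC; exact: p.
Qed.

Lemma cvg_sumr (R : realType) (I : Type) (r : seq I) (Q : pred I) (F : I -> nat -> R)
    (l : I -> R) : (forall i, Q i -> F i n @[n --> \oo] --> l i) ->
  \sum_(i <- r | Q i) F i n @[n --> \oo] --> \sum_(i <- r | Q i) l i.
Proof. by move=> Fl; apply: cvg_big => //; exact: add_continuous. Qed.

Section Semigroup.
Variables (R : realType) (d N : nat) (rho : R) (b : site d -> bool).
Hypothesis hrho : 0 < rho < 1.
Implicit Types (f g : config d N -> R) (eta : config d N).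

Local Notation nuE := (nu_mean rho).
Local Notation rt := (rate rho b).
Local Notation gen := (generator rho b).
Local Notation M := (2 * #|{: box d N}|%:R : R).

Lemma generator_le f (B : R) : (forall eta, `|f eta| <= B) ->
  forall eta, `|gen f eta| <= M * B.
Proof.
move=> fB eta; apply: le_trans (ler_norm_sum _ _ _) _.
apply: le_trans (_ : \sum_(i : box d N) 2 * B <= _); last first.
  by rewrite sumr_const -[_ *+ #|_|]mulr_natl mulrA [_ * 2]mulrC.
apply: ler_sum => i _; rewrite normrM -[leRHS]mul1r ler_pM //.
  by rewrite ger0_norm ?rate_ge0 // rate_le1.
by rewrite mulrDl mul1r; apply: le_trans (ler_normB _ _) _; rewrite lerD.
Qed.

Lemma iter_generator_le f (B : R) : (forall eta, `|f eta| <= B) ->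
  forall k eta, `|iter k gen f eta| <= M ^+ k * B.
Proof.
move=> fB; elim=> [|k IH] eta; first by rewrite expr0 mul1r.
by rewrite exprS -mulrA; exact: generator_le.
Qed.

Lemma semigroup_term_le (t : R) f (B : R) eta k : 0 <= t ->
  (forall eta, `|f eta| <= B) ->
  `|t ^+ k / k`!%:R * iter k gen f eta| <= exp_coeff (t * M) k * B.
Proof.
move=> t0 fB; rewrite normrM ger0_norm ?divr_ge0 ?exprn_ge0 //.
rewrite /exp_coeff /= exprMn [_ * M ^+ k / _]mulrAC -[leRHS]mulrA.
by rewrite ler_wpM2l ?divr_ge0 ?exprn_ge0 // iter_generator_le.
Qed.

Lemma semigroup_cvg (t : R) f eta : 0 <= t ->
  cvgn (series (fun k => t ^+ k / k`!%:R * iter k gen f eta)).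
Proof.
move=> t0; pose B := \sum_xi `|f xi|.
have fB xi : `|f xi| <= B by rewrite /B (bigD1 xi) //= lerDl sumr_ge0.
apply: normed_cvg; apply: (@series_le_cvg _ _ (fun k => exp_coeff (t * M) k * B)) => [k|k|k|].
- exact: normr_ge0.
- apply: le_trans (semigroup_term_le eta k t0 fB); exact: normr_ge0.
- exact: semigroup_term_le.
have -> : series (fun k => exp_coeff (t * M) k * B) =
    (fun n => series (exp_coeff (t * M)) n * B).
  by apply/funext => n; rewrite /series /= mulr_suml.
by apply: is_cvgMl; exact: is_cvg_series_exp_coeff.
Qed.

(** The terms of order at least 2 are dominated by those of the exponential series at [t * M], since
    [M] bounds the generator in the sup norm. *)
Lemma semigroup_error (t : R) f (B : R) eta : 0 <= t -> t * M <= 1 / 2 ->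
  (forall eta, `|f eta| <= B) ->
  `|semigroup rho b t f eta - (f eta + t * gen f eta)| <= 2 * (t * M) ^+ 2 * B.
Proof.
move=> t0 tM fB; have M0 : 0 <= M by rewrite mulr_ge0.
have B0 : 0 <= B by apply: le_trans (fB eta); exact: normr_ge0.
have tM0 : 0 <= t * M by rewrite mulr_ge0.
pose u k := t ^+ k / k`!%:R * iter k gen f eta.
pose s := f eta + t * gen f eta.
have cu : cvgn (series u) by exact: semigroup_cvg.
rewrite -/s /semigroup -/u.
have cv : series u n - s @[n --> \oo] --> limn (series u) - s.
  by apply: cvgB => //; exact: cvg_cst.
have /cvg_norm cn := cv; rewrite -(cvg_lim _ cn) //.
apply: limr_le; first by apply/cvg_ex; eexists; exact: cn.
exists 2%N => // n /= n2.
have sE : series u n - s = \sum_(2 <= k < n) u k.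
  rewrite /series /= (big_cat_nat (n := 2)) //= big_nat_recl // big_nat1.
  by rewrite /u /s /= expr0 expr1 factS fact0 muln1 !divr1 mul1r [LHS]addrAC subrr add0r.
rewrite sE; apply: le_trans (ler_norm_sum _ _ _) _.
apply: le_trans (ler_sum _ (fun k _ => semigroup_term_le eta k t0 fB)) _.
rewrite -mulr_suml ler_wpM2r //.
have := expR_le_quadratic tM.
have : \sum_(0 <= k < n) exp_coeff (t * M) k <= expR (t * M).
  apply: (nondecreasing_cvgn_le (u_ := series (exp_coeff (t * M)))).
    apply: nondecreasing_series => k _ _; exact: exp_coeff_ge0.
  exact: is_cvg_series_exp_coeff.
rewrite (big_cat_nat (n := 2)) //= big_nat_recl // big_nat1.
rewrite /exp_coeff /= expr0 expr1 factS fact0 muln1 !divr1; lra.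
Qed.

Lemma generator_sym f g :
  nuE (fun eta => g eta * gen f eta) = nuE (fun eta => gen g eta * f eta).
Proof.
have E f' g' : nuE (fun eta => g' eta * gen f' eta) =
    \sum_i (nuE (fun eta => rt i eta * (g' eta * f' (flip eta i))) -
            nuE (fun eta => rt i eta * (g' eta * f' eta))).
  under [RHS]eq_bigr do rewrite -nu_meanB.
  rewrite -nu_mean_sum; apply: eq_nu_mean => eta; rewrite mulr_sumr.
  by apply: eq_bigr => i _; ring.
rewrite E (eq_nu_mean _ (g := fun eta => f eta * gen g eta)) => [|eta]; last exact: mulrC.
rewrite E; apply: eq_bigr => i _; congr (_ - _); last first.
  by apply: eq_nu_mean => eta; rewrite (mulrC (g eta)).
rewrite -(nu_mean_rate_flip b hrho i (fun eta => f eta * g (flip eta i))).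
apply: eq_nu_mean => eta; have -> : flip (flip eta i) i = eta by exact: flipK.
by rewrite (mulrC (g eta)).
Qed.

Lemma iter_generator_sym k f g :
  nuE (fun eta => g eta * iter k gen f eta) = nuE (fun eta => iter k gen g eta * f eta).
Proof.
elim: k f g => [//|k IH] f g.
by rewrite iterS generator_sym IH -iterSr.
Qed.

Lemma semigroup_sym (t : R) f g : 0 <= t ->
  nuE (fun eta => g eta * semigroup rho b t f eta) =
  nuE (fun eta => semigroup rho b t g eta * f eta).
Proof.
move=> t0.
have lim (h l : config d N -> R) : \sum_eta nu rho eta * (l eta *
    series (fun k => t ^+ k / k`!%:R * iter k gen h eta) n) @[n --> \oo] -->
    nuE (fun eta => l eta * semigroup rho b t h eta).
  apply: cvg_sumr => eta _; do 2 (apply: cvgM; first exact: cvg_cst).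
  exact: semigroup_cvg.
have E := lim f g; rewrite -(cvg_lim _ E) //.
have E' := lim g f; rewrite [RHS](eq_nu_mean _ (g := fun eta => f eta * semigroup rho b t g eta)).
  rewrite -(cvg_lim _ E') //; congr (limn _); apply/funext => n.
  have S (h l : config d N -> R) : \sum_eta nu rho eta * (l eta *
    series (fun k => t ^+ k / k`!%:R * iter k gen h eta) n) =
    \sum_(0 <= k < n) t ^+ k / k`!%:R * nuE (fun eta => l eta * iter k gen h eta).
    under [RHS]eq_bigr do rewrite -nu_meanZ.
    rewrite -nu_mean_sum; apply: eq_bigr => eta _; rewrite /series /= mulr_sumr.
    by congr (_ * _); apply: eq_bigr => k _; ring.
  rewrite !S; apply: eq_bigr => k _; congr (_ * _); rewrite iter_generator_sym.
  by apply: eq_nu_mean => eta; rewrite mulrC.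
by move=> eta; rewrite mulrC.
Qed.

Lemma iter_generator_sum k (I : finType) (a : I -> R) (F : I -> config d N -> R) eta :
  iter k gen (fun xi => \sum_i a i * F i xi) eta = \sum_i a i * iter k gen (F i) eta.
Proof.
elim: k eta => [//|k IH] eta; rewrite iterS /generator.
transitivity (\sum_(j : box d N) \sum_i a i * (rt j eta *
   (iter k gen (F i) (flip eta j) - iter k gen (F i) eta))).
  apply: eq_bigr => j _; rewrite !IH -sumrB mulr_sumr; apply: eq_bigr => i _; ring.
by rewrite exchange_big; apply: eq_bigr => i _; rewrite mulr_sumr.
Qed.

Lemma semigroup_transition (t : R) f eta : 0 <= t ->
  semigroup rho b t f eta = \sum_xi transition rho b t eta xi * f xi.
Proof.
move=> t0.
have lim : \sum_xi series (fun k => t ^+ k / k`!%:R *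
     iter k gen (fun z => (z == xi)%:R) eta) n * f xi @[n --> \oo] -->
    \sum_xi transition rho b t eta xi * f xi.
  apply: cvg_sumr => xi _; apply: cvgM; last exact: cvg_cst.
  exact: semigroup_cvg.
rewrite -(cvg_lim _ lim) //; congr (limn _); apply/funext => n; rewrite /series /=.
under [RHS]eq_bigr do rewrite mulr_suml.
rewrite exchange_big; apply: eq_bigr => k _.
transitivity (t ^+ k / k`!%:R *
    iter k gen (fun z => \sum_xi f xi * (z == xi)%:R) eta).
  congr (_ * iter k gen _ eta); apply/funext => z.
  rewrite (bigD1 z) //= eqxx mulr1 big1 ?addr0 // => xi /negbTE zx.
  by rewrite eq_sym zx mulr0.
rewrite iter_generator_sum mulr_sumr; apply: eq_bigr => xi _; ring.
Qed.

Lemma transition_sym (t : R) eta xi : 0 <= t ->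
  nu rho eta * transition rho b t eta xi = nu rho xi * transition rho b t xi eta.
Proof.
move=> t0; have pick (h : config d N -> R) z :
    nuE (fun eta => (eta == z)%:R * h eta) = nu rho z * h z.
  rewrite /nu_mean (bigD1 z) //= eqxx mul1r big1 ?addr0 // => y /negbTE ->.
  by rewrite mul0r mulr0.
rewrite -(pick (fun eta => transition rho b t eta xi)) semigroup_sym //.
rewrite -(pick (fun eta' => transition rho b t eta' eta)).
by apply: eq_nu_mean => z; rewrite mulrC.
Qed.

End Semigroup.

Section TiltedKernel.
Variables (R : realType) (d N : nat) (rho : R) (b : site d -> bool).
Hypothesis hrho : 0 < rho < 1.
Variables (lam : R) (G : config d N -> R).
Implicit Types (f g : config d N -> R) (eta xi : config d N).

Local Notation nuE := (nu_mean rho).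
Local Notation rt := (rate rho b).
Local Notation M := (2 * #|{: box d N}|%:R : R).

(** A mesh step counts as one jump when its two ends differ. This never overestimates the activity
    and is exact once the mesh is fine enough for the path. *)
Definition step_weight (h : R) eta xi : R := expR (h * G eta + lam * (eta != xi)%:R).

Definition tilted_step (h : R) f : config d N -> R := fun eta =>
  \sum_xi transition rho b h eta xi * (step_weight h eta xi * f xi).

Definition tilted_generator f : config d N -> R := fun eta =>
  \sum_i rt i eta * (expR lam * f (flip eta i) - f eta) + G eta * f eta.

Local Notation E := (expR `|lam|).
Local Notation g0 := (\sum_eta `|G eta|).

Let M0 : 0 <= M. Proof. by rewrite mulr_ge0. Qed.
Let g00 : 0 <= g0. Proof. by rewrite sumr_ge0. Qed.
Let G_le eta : `|G eta| <= g0. Proof. by rewrite (bigD1 eta) //= lerDl sumr_ge0. Qed.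
Let E1 : 1 <= E. Proof. by rewrite -[leLHS](@expR0 R) ler_expR. Qed.

(** Below this mesh, [h * M] and [h * g0] are in the range where the exponential has a quadratic
    remainder. *)
Definition step_max : R := (2 * (1 + M + g0))^-1.

Lemma step_max_gt0 : 0 < step_max.
Proof. by rewrite invr_gt0 mulr_gt0 // !ltr_wpDr // ltr01. Qed.

Lemma step_maxP (h : R) : 0 <= h <= step_max ->
  [/\ h <= 1, h * M <= 1 / 2 & h * g0 <= 1 / 2].
Proof.
have p : 0 < 2 * (1 + M + g0) by rewrite mulr_gt0 // !ltr_wpDr // ltr01.
move=> /andP[h0]; rewrite /step_max -[_^-1]div1r ler_pdivlMr // => hh.
have a1 : 0 <= h * M by rewrite mulr_ge0.
have a2 : 0 <= h * g0 by rewrite mulr_ge0.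
move: hh a1 a2; rewrite mulrCA !mulrDr mulr1; move: (h * M) (h * g0) => u v hh a1 a2.
by split; lra.
Qed.

Lemma tilted_generator_le f (B : R) : (forall eta, `|f eta| <= B) ->
  forall eta, `|tilted_generator f eta| <= (M * E + g0) * B.
Proof.
move=> fB eta; have B0 : 0 <= B := le_trans (normr_ge0 _) (fB eta).
apply: le_trans (ler_normD _ _) _; rewrite mulrDl lerD //; last first.
  by rewrite normrM ler_pM.
apply: le_trans (ler_norm_sum _ _ _) _.
apply: le_trans (_ : \sum_(i : box d N) 2 * (E * B) <= _); last first.
  by rewrite sumr_const -[_ *+ #|_|]mulr_natl !mulrA [_ * 2]mulrC.
apply: ler_sum => i _; rewrite normrM -[leRHS]mul1r ler_pM //.
  by rewrite ger0_norm ?rate_ge0 // rate_le1.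
apply: le_trans (ler_normB _ _) _.
have h1 : `|expR lam * f (flip eta i)| <= E * B.
  rewrite normrM ler_pM // ger0_norm ?expR_ge0 // ler_expR; exact: ler_norm.
have h2 : `|f eta| <= E * B by apply: le_trans (fB _) _; rewrite ler_peMl.
lra.
Qed.

(** Its summands bound, in order, the product of the two first-order terms, the remainder of the
    semigroup and the remainder of the exponential of the potential. It may depend on [N], since the
    mesh tends to zero at fixed [N]. *)
Definition step_cst : R :=
  g0 * (M * E) + 2 * (2 * M ^+ 2 * E) + 2 * g0 ^+ 2 * (1 + M * E + 2 * M ^+ 2 * E).

Lemma step_cst_ge0 : 0 <= step_cst.
Proof.
have E0 : 0 <= E by exact: expR_ge0.
have M20 : 0 <= M ^+ 2 by rewrite sqr_ge0.
have g20 : 0 <= g0 ^+ 2 by rewrite sqr_ge0.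
have a : 0 <= M * E by rewrite mulr_ge0.
have a' : 0 <= M ^+ 2 * E by rewrite mulr_ge0.
by rewrite /step_cst -!mulrA !addr_ge0 ?mulr_ge0 // !addr_ge0 // mulr_ge0.
Qed.

Lemma tilted_step_error (h : R) f (B : R) eta : 0 <= h <= step_max ->
  (forall xi, `|f xi| <= B) ->
  `|tilted_step h f eta - (f eta + h * tilted_generator f eta)| <= step_cst * h ^+ 2 * B.
Proof.
move=> hh fB; have B0 : 0 <= B := le_trans (normr_ge0 _) (fB eta).
have [h1 hM hg] := step_maxP hh; case/andP: hh => h0 _.
have E0 : 0 <= E by exact: expR_ge0.
pose g xi := expR (lam * (eta != xi)%:R) * f xi.
have gB xi : `|g xi| <= E * B.
  rewrite normrM ler_pM // ger0_norm ?expR_ge0 // ler_expR.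
  case: (eta != xi); first by rewrite mulr1 ler_norm.
  by rewrite mulr0.
pose T := \sum_i rt i eta * (expR lam * f (flip eta i) - f eta).
have gT : generator rho b g eta = T.
  apply: eq_bigr => i _; congr (_ * _); rewrite /g eqxx mulr0 expR0 mul1r.
  by rewrite eq_sym flip_neq mulr1.
have TB : `|T| <= M * E * B by rewrite -gT -mulrA; exact: generator_le.
have stepE : tilted_step h f eta = expR (h * G eta) * semigroup rho b h g eta.
  rewrite semigroup_transition // /tilted_step mulr_sumr; apply: eq_bigr => xi _.
  by rewrite /step_weight expRD /g; ring.
have geta : g eta = f eta by rewrite /g eqxx mulr0 expR0 mul1r.
have := semigroup_error b hrho eta h0 hM gB; rewrite gT geta => e1B.
pose x := h * G eta.
have xg : `|x| <= h * g0 by rewrite normrM ger0_norm // ler_wpM2l.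
have e2B := expR_quadratic (le_trans xg hg).
rewrite stepE -/x /tilted_generator -/T.
pose e1 := semigroup rho b h g eta - (f eta + h * T).
pose e2 := expR x - (1 + x).
have -> : expR x * semigroup rho b h g eta - (f eta + h * (T + G eta * f eta)) =
    x * (h * T) + (1 + x) * e1 + e2 * (f eta + h * T + e1).
  by rewrite /e1 /e2 /x; ring.
have h20 : 0 <= h ^+ 2 by rewrite sqr_ge0.
have e1b : `|e1| <= 2 * M ^+ 2 * E * h ^+ 2 * B.
  by apply: le_trans e1B _; rewrite le_eqVlt; apply/orP; left; apply/eqP; ring.
have hT : `|h * T| <= h * (M * E * B) by rewrite normrM ger0_norm // ler_wpM2l.
have ME0 : 0 <= M * E by rewrite mulr_ge0.
have M2E : 0 <= 2 * M ^+ 2 * E by rewrite mulr_ge0 // mulr_ge0 ?sqr_ge0.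
have MEB0 : 0 <= M * E * B by rewrite mulr_ge0.
have hT' : `|h * T| <= M * E * B by apply: le_trans hT _; rewrite ler_piMl.
have h21 : h ^+ 2 <= 1 by rewrite expr_le1.
have e1b' : `|e1| <= 2 * M ^+ 2 * E * B.
  by apply: le_trans e1b _; rewrite ler_wpM2r // ler_piMr.
have e2b : `|e2| <= 2 * g0 ^+ 2 * h ^+ 2.
  apply: le_trans e2B _; rewrite -mulrA ler_wpM2l // -exprMn mulrC -real_normK ?num_real //.
  by rewrite mulrC lerXn2r ?nnegrE // mulrC // mulr_ge0.
have sumb : `|f eta + h * T + e1| <= (1 + M * E + 2 * M ^+ 2 * E) * B.
  have -> : (1 + M * E + 2 * M ^+ 2 * E) * B = B + M * E * B + 2 * M ^+ 2 * E * B by ring.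
  apply: le_trans (ler_normD _ _) _; rewrite lerD //.
  by apply: le_trans (ler_normD _ _) _; rewrite lerD.
have x1 : `|1 + x| <= 2.
  apply: le_trans (ler_normD _ _) _; rewrite normr1; have := le_trans xg hg; lra.
have t1 : `|x * (h * T)| <= h * g0 * (h * (M * E * B)) by rewrite normrM ler_pM.
have t2 : `|(1 + x) * e1| <= 2 * (2 * M ^+ 2 * E * h ^+ 2 * B) by rewrite normrM ler_pM.
have t3 : `|e2 * (f eta + h * T + e1)| <=
    2 * g0 ^+ 2 * h ^+ 2 * ((1 + M * E + 2 * M ^+ 2 * E) * B) by rewrite normrM ler_pM.
apply: le_trans (ler_normD _ _) _.
apply: le_trans (lerD (ler_normD _ _) (lexx _)) _.
apply: le_trans (lerD (lerD t1 t2) t3) _; rewrite /step_cst.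
by rewrite le_eqVlt; apply/orP; left; apply/eqP; ring.
Qed.

End TiltedKernel.

(** * Growth of iterated tilted steps *)

Section Norms.
Variables (R : realType) (d N : nat) (rho : R).
Hypothesis hrho : 0 < rho < 1.
Implicit Types (f g : config d N -> R) (eta xi : config d N).

Local Notation nuE := (nu_mean rho).

Lemma nu_mean_CS f g :
  nuE (fun eta => f eta * g eta) ^+ 2 <=
  nuE (fun eta => f eta ^+ 2) * nuE (fun eta => g eta ^+ 2).
Proof.
set a := nuE (fun eta => f eta * g eta); set F := nuE _; set b := nuE _.
have F0 : 0 <= F by apply: nu_mean_ge0 => // eta; exact: sqr_ge0.
have b0 : 0 <= b by apply: nu_mean_ge0 => // eta; exact: sqr_ge0.
have disc (s t : R) : 0 <= s ^+ 2 * F - 2 * s * t * a + t ^+ 2 * b.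
  rewrite /F /a /b -!nu_meanZ -nu_meanB -nu_meanD; apply: nu_mean_ge0 => // eta.
  have -> : s ^+ 2 * f eta ^+ 2 - 2 * s * t * (f eta * g eta) + t ^+ 2 * g eta ^+ 2 =
    (s * f eta - t * g eta) ^+ 2 by ring.
  exact: sqr_ge0.
have [b_gt0|] := ltrP 0 b.
  have := disc b a; have -> : b ^+ 2 * F - 2 * b * a * a + a ^+ 2 * b = b * (F * b - a ^+ 2).
    by ring.
  by rewrite pmulr_rge0 // subr_ge0.
move=> b_le0; have {b_le0}b00 : b = 0 by apply/eqP; rewrite eq_le b_le0.
have := disc a (F + 1); rewrite b00.
have -> : a ^+ 2 * F - 2 * a * (F + 1) * a + (F + 1) ^+ 2 * 0 = - (a ^+ 2 * (F + 2)) by ring.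
rewrite oppr_ge0 pmulr_lle0 ?mulr0 //; lra.
Qed.

Lemma nu_mean_sqr f : nuE f ^+ 2 <= nuE (fun eta => f eta ^+ 2).
Proof.
have := nu_mean_CS f (fun _ => 1); rewrite (eq_nu_mean _ (g := f)) => [|eta].
  by rewrite (eq_nu_mean _ (g := fun _ : config d N => 1) (f := fun _ => 1 ^+ 2)) ?nu_mean_cst
    ?mulr1 // => eta; rewrite expr1n.
by rewrite mulr1.
Qed.

(** A comparison of norms that is very poor for large [N]; it only enters terms of order [h ^+ 2],
    which disappear as the mesh is refined. *)
Lemma sup_le_norm f eta :
  `|f eta| <= Num.sqrt ((\sum_(xi : config d N) (nu rho xi)^-1) * nuE (fun xi => f xi ^+ 2)).
Proof.
have v0 xi : 0 < nu rho (xi : config d N) by exact: nu_gt0.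
rewrite -sqrtr_sqr ler_wsqrtr //.
apply: le_trans (_ : (nu rho eta)^-1 * nuE (fun xi => f xi ^+ 2) <= _).
  rewrite /nu_mean (bigD1 eta) //= mulrDr mulKf ?gt_eqF // lerDl.
  rewrite mulr_ge0 ?invr_ge0 ?(ltW (v0 _)) // sumr_ge0 // => xi _.
  by rewrite mulr_ge0 ?sqr_ge0 // ltW.
rewrite ler_wpM2r //; first by apply: nu_mean_ge0 => // xi; exact: sqr_ge0.
by rewrite (bigD1 eta) //= lerDl sumr_ge0 // => xi _; rewrite invr_ge0 ltW.
Qed.

End Norms.

Section UpperBound.
Variables (R : realType) (d N : nat) (rho : R) (b : site d -> bool).
Hypothesis hrho : 0 < rho < 1.
Variables (lam : R) (G : config d N -> R) (K : R).
Implicit Types (f g : config d N -> R) (eta xi : config d N).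

Local Notation nuE := (nu_mean rho).
Local Notation step := (tilted_step rho b lam G).
Local Notation A := (2 * #|{: box d N}|%:R * expR `|lam| + \sum_eta `|G eta|).
Local Notation c := (step_cst lam G).

Hypothesis formK : forall f, nuE (fun eta => f eta * tilted_generator rho b lam G f eta) <=
  K * nuE (fun eta => f eta ^+ 2).

Definition norm_cst : R :=
  (A ^+ 2 + 2 * c + 2 * A * c + c ^+ 2) * \sum_(xi : config d N) (nu rho xi)^-1.

(** In the square of [f + h * g + e] the term linear in [h] is twice the quadratic form, controlled
    by [formK]; all others are of order [h ^+ 2]. The argument covers steps that are not
    self-adjoint, such as those with a potential evaluated at the left end. *)
Lemma norm_tilted_step (h : R) f : 0 <= h <= step_max G ->
  nuE (fun eta => step h f eta ^+ 2) <=
  (1 + 2 * h * K + norm_cst * h ^+ 2) * nuE (fun eta => f eta ^+ 2).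
Proof.
move=> hh; set F := nuE (fun eta => f eta ^+ 2); pose B := Num.sqrt ((\sum_(xi : config d N) (nu rho xi)^-1) * F).
have F0 : 0 <= F by apply: nu_mean_ge0 => // eta; exact: sqr_ge0.
have fB eta : `|f eta| <= B by exact: sup_le_norm.
have B0 : 0 <= B by exact: sqrtr_ge0.
have inv0 : 0 <= \sum_(xi : config d N) (nu rho xi)^-1.
  by rewrite sumr_ge0 // => xi _; rewrite invr_ge0 ltW // nu_gt0.
have B2 : B ^+ 2 = (\sum_(xi : config d N) (nu rho xi)^-1) * F.
  by rewrite sqr_sqrtr // mulr_ge0.
have [h1 _ _] := step_maxP hh; have /andP[h0 _] := hh.
have c0 : 0 <= c by exact: step_cst_ge0.
have A0 : 0 <= A by rewrite addr_ge0 ?mulr_ge0 ?expR_ge0 // sumr_ge0.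
pose g := tilted_generator rho b lam G f.
have gB eta : `|g eta| <= A * B by exact: tilted_generator_le.
pose e eta := step h f eta - (f eta + h * g eta).
have eB eta : `|e eta| <= c * h ^+ 2 * B by exact: tilted_step_error.
apply: le_trans (_ : nuE (fun eta => f eta ^+ 2 + 2 * h * (f eta * g eta) +
    h ^+ 2 * ((A ^+ 2 + 2 * c + 2 * A * c + c ^+ 2) * B ^+ 2)) <= _).
  apply: ler_nu_mean => // eta.
  have -> : step h f eta ^+ 2 = f eta ^+ 2 + 2 * h * (f eta * g eta) +
     (h ^+ 2 * (g eta * g eta) + 2 * (f eta * e eta) + 2 * h * (g eta * e eta) + e eta * e eta).
    have -> : step h f eta = f eta + h * g eta + e eta by rewrite /e addrC subrK.
    by ring.
  rewrite lerD2l.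
  have h20 : 0 <= h ^+ 2 by exact: sqr_ge0.
  have h21 : h ^+ 2 <= 1 by rewrite expr_le1.
  have ch0 : 0 <= c * h ^+ 2 * B by rewrite mulr_ge0 // mulr_ge0.
  have AB0 : 0 <= A * B by rewrite mulr_ge0.
  have mulB (x y X Y : R) : `|x| <= X -> `|y| <= Y -> x * y <= X * Y.
    by move=> hx hy; apply: le_trans (ler_norm _) _; rewrite normrM ler_pM.
  have t1 := mulB _ _ _ _ (gB eta) (gB eta).
  have t2 := mulB _ _ _ _ (fB eta) (eB eta).
  have t3 := mulB _ _ _ _ (gB eta) (eB eta).
  have t4 := mulB _ _ _ _ (eB eta) (eB eta).
  have s1 : h ^+ 2 * (g eta * g eta) <= h ^+ 2 * (A * B * (A * B)) by rewrite ler_wpM2l.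
  have s3 : 2 * h * (g eta * e eta) <= 2 * (A * B * (c * h ^+ 2 * B)).
    apply: le_trans (_ : 2 * h * (A * B * (c * h ^+ 2 * B)) <= _).
      by rewrite ler_wpM2l // mulr_ge0.
    rewrite -mulrA ler_wpM2l // ler_piMl // mulr_ge0 //.
  have s4 : c * h ^+ 2 * B * (c * h ^+ 2 * B) <= c * h ^+ 2 * B * (c * B).
    rewrite ler_wpM2l // ler_wpM2r // ler_piMr //.
  have -> : h ^+ 2 * ((A ^+ 2 + 2 * c + 2 * A * c + c ^+ 2) * B ^+ 2) =
     h ^+ 2 * (A * B * (A * B)) + 2 * (B * (c * h ^+ 2 * B)) +
     2 * (A * B * (c * h ^+ 2 * B)) + c * h ^+ 2 * B * (c * B) by ring.
  rewrite !lerD //; first by rewrite ler_wpM2l.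
  exact: le_trans t4 s4.
rewrite !nu_meanD nu_meanZ nu_mean_cst B2 -/F.
have -> : (1 + 2 * h * K + norm_cst * h ^+ 2) * F = F + 2 * h * (K * F) +
  h ^+ 2 * ((A ^+ 2 + 2 * c + 2 * A * c + c ^+ 2) * ((\sum_(xi : config d N) (nu rho xi)^-1) * F)).
  by rewrite /norm_cst; ring.
rewrite lerD2r lerD2l ler_wpM2l //; first by rewrite mulr_ge0.
Qed.

Lemma norm_iter_step (h : R) n : 0 <= h <= step_max G ->
  nuE (fun eta => iter n (step h) (fun _ => 1) eta ^+ 2) <=
  expR (n%:R * (2 * h * K + norm_cst * h ^+ 2)).
Proof.
move=> hh; elim: n => [|n IH].
  rewrite mul0r expR0 (eq_nu_mean _ (g := fun _ : config d N => 1)) ?nu_mean_cst //.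
  by move=> eta; rewrite expr1n.
rewrite iterS; apply: le_trans (norm_tilted_step _ hh) _.
set X := 2 * h * K + _ in IH *; rewrite -(natr1 n) [(n%:R + 1) * _]mulrDl mul1r expRD mulrC.
apply: le_trans (_ : nuE (fun eta => iter n (step h) (fun _ => 1) eta ^+ 2) * expR X <= _).
  rewrite ler_wpM2l -?addrA ?expR_ge1Dx //.
  by apply: nu_mean_ge0 => // eta; exact: sqr_ge0.
by rewrite ler_wpM2r ?expR_ge0.
Qed.

Lemma mean_iter_step_le (h : R) n : 0 <= h <= step_max G ->
  nuE (iter n (step h) (fun _ => 1)) <= expR (n%:R * (h * K + norm_cst / 2 * h ^+ 2)).
Proof.
move=> hh; apply: le_trans (ler_norm _) _.
rewrite -(ger0_norm (expR_ge0 _)) -ler_sqr ?nnegrE ?normr_ge0 //.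
rewrite !real_normK ?num_real //; apply: le_trans (nu_mean_sqr hrho _) _.
apply: le_trans (norm_iter_step n hh) _; rewrite -expRM_natl ler_expR.
by rewrite le_eqVlt; apply/orP; left; apply/eqP; field.
Qed.

End UpperBound.

Section LowerBound.
Variables (R : realType) (d N : nat) (rho : R) (b : site d -> bool).
Hypothesis hrho : 0 < rho < 1.
Variable lam : R.
Implicit Types (f g : config d N -> R) (eta xi : config d N).

Local Notation nuE := (nu_mean rho).
Local Notation step := (tilted_step rho b lam (fun _ : config d N => 0)).
Local Notation one := (fun _ : config d N => 1 : R).
Local Notation c := (step_cst lam (fun _ : config d N => 0)).

(** Without potential the weight only depends on whether the two states differ, so it is symmetric,
    and reversibility of the transition makes the step self-adjoint. *)
Lemma tilted_step_sym (h : R) f g : 0 <= h ->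
  nuE (fun eta => g eta * step h f eta) = nuE (fun eta => step h g eta * f eta).
Proof.
move=> h0; rewrite /nu_mean.
transitivity (\sum_eta \sum_xi nu rho eta * transition rho b h eta xi *
    (step_weight lam (fun _ => 0) h eta xi * g eta * f xi)).
  apply: eq_bigr => eta _; rewrite !mulr_sumr; apply: eq_bigr => xi _; ring.
rewrite exchange_big; apply: eq_bigr => eta _; rewrite mulr_suml mulr_sumr.
apply: eq_bigr => xi _; rewrite transition_sym // /step_weight eq_sym; ring.
Qed.

Lemma iter_step_sym (h : R) n f g : 0 <= h ->
  nuE (fun eta => g eta * iter n (step h) f eta) =
  nuE (fun eta => iter n (step h) g eta * f eta).
Proof.
move=> h0; elim: n f g => [//|n IH] f g.
by rewrite iterS tilted_step_sym // IH -iterSr.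
Qed.

Lemma mean_iter_stepD (h : R) n m : 0 <= h ->
  nuE (iter (n + m) (step h) one) =
  nuE (fun eta => iter n (step h) one eta * iter m (step h) one eta).
Proof.
move=> h0; rewrite iterD.
have := iter_step_sym n (iter m (step h) one) one h0 => <-.
by apply: eq_nu_mean => eta; rewrite mul1r.
Qed.

(** Self-adjointness turns the mean after [n + m] steps into a scalar product; Cauchy-Schwarz then
    gives log-convexity in the number of steps. *)
Lemma mean_iter_step_CS (h : R) n m : 0 <= h ->
  nuE (iter (n + m) (step h) one) ^+ 2 <=
  nuE (iter (n + n) (step h) one) * nuE (iter (m + m) (step h) one).
Proof.
move=> h0; rewrite !mean_iter_stepD //; apply: le_trans (nu_mean_CS hrho _ _) _.
by rewrite le_eqVlt; apply/orP; left; apply/eqP; congr (_ * _);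
  apply: eq_nu_mean => eta; rewrite expr2.
Qed.

Lemma mean_step_ge (h : R) : 0 <= h <= step_max (fun _ : config d N => 0 : R) ->
  1 + h * ((expR lam - 1) * nuE (total_rate rho b : config d N -> R)) - c * h ^+ 2 <=
  nuE (step h one).
Proof.
move=> hh.
have -> : 1 + h * ((expR lam - 1) * nuE (total_rate rho b : config d N -> R)) - c * h ^+ 2 =
   nuE (fun eta => one eta + h * tilted_generator rho b lam (fun _ => 0) one eta - c * h ^+ 2 * 1).
  rewrite nu_meanB nu_meanD !nu_mean_cst mulr1 nu_meanZ -nu_meanZ.
  congr (_ + _ * _ - _); apply: eq_nu_mean => eta.
  rewrite /tilted_generator mul0r addr0 mulr1 /total_rate mulr_sumr.
  by apply: eq_bigr => i _; rewrite mulrC.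
apply: ler_nu_mean => // eta.
have := @tilted_step_error R d N rho b hrho lam (fun _ => 0) h one 1 eta hh.
rewrite normr1 => /(_ (fun _ => lexx _)); rewrite ler_norml => /andP[+ _]; lra.
Qed.

(** Doubling: the mean after [2 ^ k.+1] steps is the squared norm after [2 ^ k] steps, hence at
    least the square of the mean. The base case is the one-step bound, brought into exponential form
    by [expR_le1Dx]. *)
Lemma mean_iter_step_ge : exists C h1 : R, 0 < h1 /\ forall h k, 0 <= h <= h1 ->
  expR ((2 ^ k)%:R * (h * ((expR lam - 1) * nuE (total_rate rho b : config d N -> R)) - C * h ^+ 2)) <=
  nuE (iter (2 ^ k) (step h) one).
Proof.
set a := (expR lam - 1) * _.
have c0 : 0 <= c by exact: step_cst_ge0.
have ac0 : 0 <= `|a| + c by rewrite addr_ge0.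
pose h1 := Num.min (step_max (fun _ : config d N => 0 : R)) (2 * (1 + (`|a| + c)))^-1 : R.
have p : 0 < 2 * (1 + (`|a| + c)) by rewrite mulr_gt0 // ltr_wpDr.
exists (c + 2 * (`|a| + c) ^+ 2), h1; split.
  by rewrite lt_min step_max_gt0 invr_gt0.
move=> h k /andP[h0]; rewrite le_min => /andP[hm].
rewrite -[_^-1]div1r ler_pdivlMr // => hac.
have hh : 0 <= h <= step_max (fun _ : config d N => 0 : R) by rewrite h0.
have [h_le1 _ _] := step_maxP hh.
have := mean_step_ge hh; rewrite -/a; set x := h * a - c * h ^+ 2.
rewrite -addrA -/x => ux.
have xh : `|x| <= h * (`|a| + c).
  apply: le_trans (ler_normB _ _) _; rewrite mulrDr lerD //.
    by rewrite normrM ger0_norm.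
  by rewrite ger0_norm ?mulr_ge0 ?sqr_ge0 // mulrC ler_wpM2r // expr2 ler_piMr.
have hac2 : h * (`|a| + c) <= 1 / 2.
  move: hac; rewrite mulrCA mulrDr mulr1; move: h0; move: (h * _) => y; lra.
have x1 : - 1 / 2 <= x.
  have := le_trans xh hac2; rewrite ler_norml; lra.
have base : expR (h * a - (c + 2 * (`|a| + c) ^+ 2) * h ^+ 2) <= nuE (step h one).
  apply: le_trans ux; apply: le_trans (expR_le1Dx x1); rewrite ler_expR.
  have : x ^+ 2 <= (h * (`|a| + c)) ^+ 2.
    by rewrite -real_normK ?num_real // lerXn2r ?nnegrE // mulr_ge0.
  rewrite exprMn /x; lra.
elim: k => [|k IH]; first by rewrite mul1r.
rewrite expnS mul2n -addnn mean_iter_stepD //.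
apply: le_trans (_ : nuE (iter (2 ^ k) (step h) one) ^+ 2 <= _); last first.
  apply: le_trans (nu_mean_sqr hrho _) _.
  by rewrite le_eqVlt; apply/orP; left; apply/eqP; apply: eq_nu_mean => eta; rewrite expr2.
rewrite natrD mulrDl expRD -expr2 lerXn2r ?nnegrE ?expR_ge0 //.
by apply: le_trans IH; exact: expR_ge0.
Qed.

End LowerBound.

(** * Jumps and time integrals of step paths along grids *)

Section StepPath.
Variables (R : realType) (S : eqType) (x : R -> S).
Hypothesis x_right : forall t, 0 <= t -> \forall s \near t^'+, x s = x t.
Hypothesis x_left : forall t, 0 < t -> exists xi, \forall s \near t^'-, x s = xi.
Implicit Types (s t u v z : R).

Definition jumps s u : set R := [set v | s < v <= u /\ ~ \forall z \near v^'-, x z = x v].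

Definition jump_count s u : nat := #|` fset_set (jumps s u)|.

Lemma jumps_cst s u : (forall z, s <= z <= u -> x z = x s) -> jumps s u = set0.
Proof.
move=> xs; rewrite -subset0 => v [/andP[sv vu]] []; exists (v - s) => /=.
  by rewrite subr_gt0.
move=> z /= hz zv; have sz : s <= z by move: hz; rewrite ltr_distl; lra.
by rewrite xs ?sz ?(ltW (lt_le_trans zv vu)) // xs // (ltW sv).
Qed.

(** The second case includes that the end values differ: this makes a comparison of the two ends a
    correct count of the jumps in the cell. *)
Definition simple_cell s u : Prop :=
  (forall z, s <= z <= u -> x z = x s) \/
  (x s <> x u /\ exists2 v, jumps s u = [set v] &
     [/\ s < v, v <= u, forall z, s <= z < v -> x z = x s & forall z, v <= z <= u -> x z = x u]).

(** Near [t] the path equals its left limit before [t] and [x t] from [t] on. If the two agree the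
    cell has no jump, otherwise [t] is its only jump. *)
Lemma simple_cell_near t : 0 <= t -> exists2 e, 0 < e & forall s u,
  0 <= s -> s < u -> `|s - t| < e -> `|u - t| < e -> simple_cell s u.
Proof.
move=> t0; have [e1 /= e10 h1] := x_right t0.
have [xi [e2 e20 h2]] : exists xi, exists2 e2, 0 < e2 & forall s, 0 <= s -> s < t ->
    `|s - t| < e2 -> x s = xi.
  (* At time 0 no admissible time lies to the left, so any value can serve as left limit. *)
  move: t0; rewrite le_eqVlt => /predU1P[<-|t0].
    by exists (x 0), 1 => // s s0 s0'; move: (le_lt_trans s0 s0'); rewrite ltxx.
  have [xi [e2 /= e20 h2]] := x_left t0; exists xi, e2 => // s _ st d.
  by apply: h2 => //=; rewrite distrC.
exists (Num.min e1 e2); first by rewrite lt_min e10.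
move=> s u s0 su; rewrite !lt_min => /andP[s1 s2] /andP[u1 u2].
have right z : t <= z -> z <= u -> x z = x t.
  rewrite le_eqVlt => /predU1P[<- //|tz] zu; apply: h1 => //=.
  by move: u1; rewrite !ltr_distl; lra.
have left z : s <= z -> z < t -> x z = xi.
  move=> sz zt; apply: h2 => //; first exact: le_trans sz.
  by move: s2; rewrite !ltr_distl; lra.
have [ts|st] := leP t s.
  left=> z /andP[sz zu]; rewrite (right z) ?(right s) //; first exact: ltW.
  exact: le_trans sz.
have [tu|ut] := leP t u; last first.
  by left=> z /andP[sz zu]; rewrite (left z) ?(left s) //; exact: le_lt_trans ut.
have [e|ne] := eqVneq xi (x t).
  left=> z /andP[sz zu]; rewrite (left s) //; have [tz|zt] := leP t z.
    by rewrite e right.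
  exact: left.
right; split.
  by rewrite (left s) // (right u) //; apply/eqP.
exists t; last first.
  split=> // z /andP[h h']; first by rewrite !left.
  by rewrite !right.
apply/seteqP; split=> v /=.
  move=> [/andP[sv vu] nj]; have [vt|tv|//] := ltrgtP v t; exfalso; apply: nj.
    exists (v - s) => /=; first by rewrite subr_gt0.
    move=> z /= hz zv; have sz : s <= z by move: hz; rewrite ltr_distl; lra.
    by rewrite (left z) ?(left v) //; [exact: ltW|exact: lt_trans vt].
  exists (v - t) => /=; first by rewrite subr_gt0.
  move=> z /= hz zv; have tz : t <= z by move: hz; rewrite ltr_distl; lra.
  by rewrite (right z) ?(right v) //; [exact: ltW|exact: ltW (lt_le_trans zv vu)].
move=> ->; split=> [|hn]; first by rewrite st tu.
(* If [t] were not a jump, some time just before it would carry both [x t] and the different value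
   [xi]. *)
have [z [zt [z1 z2]]] : exists z, x z = x t /\ s <= z /\ z < t.
  have hs : \forall z \near t^'-, s <= z /\ z < t.
    exists (t - s) => /=; first by rewrite subr_gt0.
    by move=> z /=; rewrite ltr_distl => hz zt; split => //; lra.
  have hc : \forall z \near t^'-, x z = x t /\ (s <= z /\ z < t) by exact: filterI.
  by have [z [e1' e2']] := @filter_ex _ _ (at_left_proper_filter t) _ hc; exists z.
by move/eqP: ne; apply; rewrite -zt left.
Qed.

(** A Lebesgue-number argument: compactness of [[0, T]] makes the local size of the cells
    uniform. *)
Lemma simple_cell_uniform T : exists2 e, 0 < e & forall s u,
  0 <= s -> s < u -> u <= T -> u - s < e -> simple_cell s u.
Proof.
pose P (e s : R) := forall u, 0 <= s -> s < u -> u - s < e -> simple_cell s u.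
have /compact_near_coveringP cov := @segment_compact R 0 T.
have H : \forall e \near (0 : R)^'+, `[0, T]%classic `<=` P e.
  apply: (cov _ _ P) => t; rewrite /= in_itv /= => /andP[t0 _].
  have [e e0 he] := simple_cell_near t0.
  exists (ball t (e / 2), [set y | y < e / 2]); first split => /=.
  - by apply: nbhsx_ballx; rewrite divr_gt0.
  - by apply: nbhs_right_lt; rewrite divr_gt0.
  move=> [s y] /= [ts ye] u s0 su us; apply: he => //.
    by rewrite distrC; apply: lt_trans ts _; lra.
  by move: ts; rewrite /ball /= !ltr_distl; lra.
have hc : \forall e \near (0 : R)^'+, `[0, T]%classic `<=` P e /\ 0 < e.
  by apply: filterI => //; exact: nbhs_right_gt.
have [e [he e0]] := @filter_ex _ _ (at_right_proper_filter (0 : R)) _ hc.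
exists e => // s u s0 su uT us; apply: (he s _ u) => //.
by rewrite /= in_itv /= s0 (le_trans (ltW su)).
Qed.

Lemma jumps_setU s t u : s <= t -> t <= u -> jumps s u = jumps s t `|` jumps t u.
Proof.
move=> st tu; apply/seteqP; split=> v /=.
  move=> [/andP[sv vu] nj]; have [vt|tv] := leP v t; [left|right]; split=> //.
    by rewrite sv.
  by rewrite tv.
move=> [] [/andP[h1 h2] nj]; split=> //; first by rewrite h1 (le_trans h2).
by rewrite h2 andbT (le_lt_trans st).
Qed.

Lemma jump_countD s t u : s <= t -> t <= u ->
  finite_set (jumps s t) -> finite_set (jumps t u) ->
  finite_set (jumps s u) /\ jump_count s u = (jump_count s t + jump_count t u)%N.
Proof.
move=> st tu f1 f2; rewrite /jump_count (jumps_setU st tu); split.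
  by rewrite finite_setU.
rewrite fset_setU // -cardfsUI -fset_setI //.
suff -> : jumps s t `&` jumps t u = set0 by rewrite fset_set0 cardfs0 addn0.
rewrite -subset0 => v [[/andP[_ vt] _] [/andP[tv _] _]].
by move: (le_lt_trans vt tv); rewrite ltxx.
Qed.

Lemma simple_cell_count s u : s <= u -> simple_cell s u ->
  finite_set (jumps s u) /\ jump_count s u = (x s != x u).
Proof.
move=> su; rewrite /jump_count => -[h|[/eqP ne [v -> _]]].
  by rewrite (jumps_cst h) fset_set0 cardfs0 (h u) ?su ?lexx ?eqxx.
by rewrite ne fset_set1 cardfs1.
Qed.

Lemma jump_count0 t : finite_set (jumps t t) /\ jump_count t t = 0%N.
Proof.
rewrite /jump_count (_ : jumps t t = set0) ?fset_set0 ?cardfs0 //.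
by apply: jumps_cst => z /le_anti ->.
Qed.

Lemma fine_grid_count (t : nat -> R) T (e : R) n :
  (forall s u, 0 <= s -> s < u -> u <= T -> u - s < e -> simple_cell s u) ->
  0 <= t 0%N -> (forall k, (k < n)%N -> t k < t k.+1 /\ t k.+1 - t k < e) -> t n <= T ->
  finite_set (jumps (t 0%N) (t n)) /\
  jump_count (t 0%N) (t n) = (\sum_(k < n) (x (t k) != x (t k.+1)))%N.
Proof.
move=> cell t0; elim: n => [|n IH] tS tT.
  by have [? ->] := jump_count0 (t 0%N); rewrite big_ord0.
have [tn te] := tS n (ltnSn n).
have tnT : t n <= T by apply: le_trans (ltW tn) tT.
have tS' k : (k < n)%N -> t k < t k.+1 /\ t k.+1 - t k < e by move=> /ltnW; exact: tS.
have [f1 c1] := IH tS' tnT.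
have t0n : t 0%N <= t n.
  have : forall m, (m <= n)%N -> t 0%N <= t m.
    elim=> [//|m IHm] mn; apply: le_trans (IHm (ltnW mn)) _.
    by have [/ltW] := tS' m mn.
  exact.
have [f2 c2] := simple_cell_count (ltW tn) (cell _ _ (le_trans t0 t0n) tn tT te).
have [f ->] := jump_countD t0n (ltW tn) f1 f2; split=> //.
by rewrite big_ord_recr /= c1 c2.
Qed.

Definition grid s (h : R) (k : nat) : R := s + k%:R * h.

Lemma gridS s h k : grid s h k.+1 = grid s h k + h.
Proof. by rewrite /grid -natr1 mulrDl mul1r addrA. Qed.

(** Different end values force a change along some step of a fine grid, hence a jump; the interval
    itself may be long. *)
Lemma jump_count_ge s u : 0 <= s -> s < u ->
  finite_set (jumps s u) /\ ((x s != x u) <= jump_count s u)%N.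
Proof.
move=> s0 su; have [e e0 cell] := simple_cell_uniform u.
pose n := (Num.bound ((u - s) / e)).+1; pose h := (u - s) / n%:R.
have n0 : 0 < (n%:R : R) by rewrite ltr0n.
have h0 : 0 < h by rewrite divr_gt0 // subr_gt0.
have he : h < e.
  rewrite ltr_pdivrMr // mulrC -ltr_pdivrMr //; apply: lt_trans (archi_boundP _) _.
    by rewrite divr_ge0 // ltW // subr_gt0.
  by rewrite ltr_nat.
have gn : grid s h n = u by rewrite /grid mulrC divfK ?gt_eqF // addrC subrK.
have g0 : grid s h 0 = s by rewrite /grid mul0r addr0.
have := @fine_grid_count (grid s h) u e n cell.
rewrite gn g0 => /(_ s0 _ (lexx _)) [k _|f ->].
  by rewrite gridS ltrDl addrAC subrr add0r.
split=> //; case: eqVneq => //= ne; rewrite lt0n sum_nat_eq0; apply/negP => /forallP all0.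
have : forall k, (k <= n)%N -> x (grid s h k) = x s.
  elim=> [|k IH] kn; first by rewrite g0.
  have /implyP/(_ isT) := all0 (Ordinal kn); rewrite eqb0 negbK => /eqP <-.
  by rewrite IH // ltnW.
by move=> /(_ n (leqnn n)); rewrite gn => e'; move/eqP: ne; apply.
Qed.

Lemma finite_jumps T : 0 <= T -> finite_set (jumps 0 T).
Proof.
rewrite le_eqVlt => /predU1P[<-|T0]; last by have [] := jump_count_ge (lexx 0) T0.
by have [] := jump_count0 0.
Qed.

Definition grid_count T (n : nat) : nat :=
  (\sum_(k < n) (x (grid 0 (T / n%:R) k) != x (grid 0 (T / n%:R) k.+1)))%N.

(** Valid for every mesh, not only for fine ones, which provides the dominating function in
    [exp_moment_cvg]. *)
Lemma grid_count_le T n : 0 < T -> (0 < n)%N -> (grid_count T n <= jump_count 0 T)%N.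
Proof.
move=> T0 n0; have nR : 0 < (n%:R : R) by rewrite ltr0n.
rewrite /grid_count; set h := T / n%:R; have h0 : 0 < h by rewrite divr_gt0.
have <- : grid 0 h n = T by rewrite /grid /h mulrC divfK ?gt_eqF // add0r.
clearbody h; elim: n {n0 nR} => [|n IH]; first by rewrite big_ord0.
rewrite big_ord_recr /=.
have gn : 0 <= grid 0 h n by rewrite /grid add0r mulr_ge0 // ltW.
have gS : grid 0 h n < grid 0 h n.+1 by rewrite gridS ltrDl.
have [f2 c2] := jump_count_ge gn gS.
have [_ ->] := jump_countD gn (ltW gS) (finite_jumps gn) f2.
exact: leq_add.
Qed.

Lemma grid_count_eq T : 0 < T -> \forall n \near \oo, grid_count T n = jump_count 0 T.
Proof.
move=> T0; have [e e0 cell] := simple_cell_uniform T.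
exists (Num.bound (T / e)).+1 => // n /= hn.
have n0 : (0 < n)%N by apply: leq_trans hn.
have nR : 0 < (n%:R : R) by rewrite ltr0n.
set h := T / n%:R; have h0 : 0 < h by rewrite divr_gt0.
have he : h < e.
  rewrite ltr_pdivrMr // mulrC -ltr_pdivrMr //; apply: lt_le_trans (archi_boundP _) _.
    by rewrite divr_ge0 // ltW.
  by rewrite ler_nat ltnW.
have gn : grid 0 h n = T by rewrite /grid /h mulrC divfK ?gt_eqF // add0r.
have := @fine_grid_count (grid 0 h) T e n cell.
rewrite gn [grid 0 h 0](_ : _ = 0); last by rewrite /grid mul0r addr0.
move=> /(_ (lexx _) _ (lexx _)) [k _|_ ->//].
by rewrite gridS ltrDl addrAC subrr add0r.
Qed.

End StepPath.

Section RiemannSums.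
Variables (R : realType) (S : eqType) (x : R -> S).
Hypothesis x_right : forall t, 0 <= t -> \forall s \near t^'+, x s = x t.
Hypothesis x_left : forall t, 0 < t -> exists xi, \forall s \near t^'-, x s = xi.
Variables (F : S -> R) (B : R).
Hypothesis F_le : forall xi, `|F xi| <= B.
Implicit Types (s t u v z : R).

Local Notation f := (fun t => F (x t)).
Local Notation leb := (@lebesgue_measure R).

Lemma setU_itvco s t u : s <= t -> t <= u -> `[s, u[%classic = `[s, t[ `|` `[t, u[ :> set R.
Proof.
move=> st tu; apply/seteqP; split=> z; rewrite /= !in_itv /=.
  by move=> /andP[sz zu]; have [tz|zt] := leP t z; [right|left]; rewrite ?sz ?zu.
by move=> [] /andP[h1 h2]; [rewrite h1 (lt_le_trans h2)|rewrite h2 (le_trans st)].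
Qed.

Lemma disj_itvco s t u : [disjoint `[s, t[%classic & `[t, u[%classic]%classic.
Proof.
apply/disj_setPS => z /=; rewrite !in_itv /= => -[/andP[_ zt] /andP[tz _]].
by move: (le_lt_trans tz zt); rewrite ltxx.
Qed.

Lemma integrable_path s u : measurable_fun `[s, u[%classic f ->
  leb.-integrable `[s, u[%classic (EFin \o f).
Proof.
move=> mf; apply: measurable_bounded_integrable => //.
  by rewrite /= lebesgue_measure_itv /=; case: ifP => _; rewrite ?ltry // -EFinD ltry.
exists B; split; first exact: num_real.
by move=> M BM t _ /=; apply: le_trans (F_le _) (ltW BM).
Qed.

Lemma measurable_cst_on s u (c : R) : (forall z, s <= z < u -> f z = c) ->
  measurable_fun `[s, u[%classic f.
Proof.
move=> fc; apply: (eq_measurable_fun (cst c)); last exact: measurable_cst.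
by move=> z; rewrite inE /= in_itv /= => /fc <-.
Qed.

Lemma fine_itvco s u : s <= u -> fine (leb `[s, u[%classic) = u - s.
Proof.
rewrite /= lebesgue_measure_itv /= lte_fin; case: ltP => // us su.
by have -> : s = u; [apply/le_anti/andP|rewrite subrr].
Qed.

(** Only cells with a jump contribute an error, so the error of a Riemann sum is of the order of the
    mesh times the number of jumps. *)
Lemma simple_cell_integral s u : s < u -> simple_cell x s u ->
  measurable_fun `[s, u[%classic f /\
  `|\int[leb]_(t in `[s, u[) f t - (u - s) * f s| <= 2 * B * (u - s) * (x s != x u)%:R.
Proof.
move=> su cell.
have B0 : 0 <= B by apply: le_trans (F_le (x s)); exact: normr_ge0.
have mf : measurable_fun `[s, u[%classic f.
  case: cell => [h|[_ [v _ [sv vu h1 h2]]]].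
    by apply: (@measurable_cst_on _ _ (f s)) => z /andP[sz zu]; rewrite h // sz ltW.
  rewrite (setU_itvco (ltW sv) vu); apply/measurable_funU => //; split.
    by apply: (@measurable_cst_on _ _ (f s)) => z h; rewrite h1.
  by apply: (@measurable_cst_on _ _ (f u)) => z /andP[h h']; rewrite h2 // h ltW.
split=> //.
have cE : (u - s) * f s = \int[leb]_(t in `[s, u[) f s.
  by rewrite Rintegral_cst // (fine_itvco (ltW su)) mulrC.
have ic (c : R) : leb.-integrable `[s, u[%classic (EFin \o (fun _ => c)).
  apply: measurable_bounded_integrable => //.
    by rewrite /= lebesgue_measure_itv /=; case: ifP => _; rewrite ?ltry // -EFinD ltry.
  by exists `|c|; split => // M cM t _ /=; exact: ltW.
have iF := integrable_path mf.
rewrite cE -RintegralB //; case: cell => [h|[/eqP ne _]].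
  have -> : \int[leb]_(t in `[s, u[) (f t - f s) = 0.
    rewrite -[RHS](mul0r (fine (leb `[s, u[%classic))) -Rintegral_cst //.
    apply: eq_Rintegral => z; rewrite inE /= in_itv /= => /andP[sz zu].
    by rewrite h ?subrr // sz ltW.
  have us0 : 0 <= u - s by rewrite subr_ge0 ltW.
  by rewrite normr0 mulr_ge0 // mulr_ge0 // mulr_ge0.
rewrite ne mulr1 -(fine_itvco (ltW su)) -Rintegral_cst //.
have iD : leb.-integrable `[s, u[%classic (EFin \o (fun t => f t - f s)).
  by rewrite (_ : EFin \o _ = ((EFin \o f) \- (EFin \o fun=> f s))%E) //; exact: integrableB.
apply: (le_trans (@le_normr_Rintegral _ _ _ leb `[s, u[%classic
  (fun t => f t - f s) _ iD)) => //.
apply: le_Rintegral => //; first exact: (integrable_norm iD).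
by move=> z _; apply: le_trans (ler_normB _ _) _; rewrite mulr2n mulrDl mul1r lerD.
Qed.

Definition riemann_sum T (n : nat) : R :=
  \sum_(k < n) T / n%:R * F (x (grid 0 (T / n%:R) k)).

Lemma grid_integral (h e T : R) n : 0 < h -> h < e ->
  (forall s u, 0 <= s -> s < u -> u <= T -> u - s < e -> simple_cell x s u) ->
  grid 0 h n <= T ->
  measurable_fun `[0, grid 0 h n[%classic f /\
  `|\int[leb]_(t in `[0, grid 0 h n[) f t - \sum_(k < n) h * F (x (grid 0 h k))| <=
  2 * B * h * (\sum_(k < n) (x (grid 0 h k) != x (grid 0 h k.+1)))%:R.
Proof.
move=> h0 he cell; elim: n => [|n IH] gT.
  have -> : grid 0 h 0 = 0 by rewrite /grid mul0r addr0.
  have -> : `[0, 0[%classic = set0 :> set R by rewrite set_itv_ge // bnd_simp ltxx.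
  rewrite Rintegral_set0 !big_ord0 subrr normr0 mulr0; split=> //.
  exact: measurable_fun_set0.
have gS : grid 0 h n < grid 0 h n.+1 by rewrite gridS ltrDl.
have g0 : 0 <= grid 0 h n by rewrite /grid add0r mulr_ge0 // ltW.
have gd : grid 0 h n.+1 - grid 0 h n = h by rewrite gridS addrAC subrr add0r.
have [m1 e1] := IH (le_trans (ltW gS) gT).
have [m2 e2] := simple_cell_integral gS (cell _ _ g0 gS gT (eq_ind_r (fun z => z < e) he gd)).
have m12 : measurable_fun `[0, grid 0 h n.+1[%classic f.
  by rewrite (setU_itvco g0 (ltW gS)); apply/measurable_funU.
split=> //; rewrite (setU_itvco g0 (ltW gS)) Rintegral_setU //; last first.
- exact: disj_itvco.
- by rewrite -(setU_itvco g0 (ltW gS)); exact: integrable_path.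
rewrite gd in e2; rewrite !big_ord_recr /= natrD mulrDr opprD addrACA.
by apply: le_trans (ler_normD _ _) _; rewrite lerD.
Qed.

Lemma riemann_sum_cvg T : 0 < T ->
  riemann_sum T n @[n --> \oo] --> \int[leb]_(t in `[0, T]) f t.
Proof.
move=> T0; have [e e0 cell] := simple_cell_uniform x_right x_left T.
have B0 : 0 <= B by apply: le_trans (F_le (x 0)); exact: normr_ge0.
apply/cvgrPdist_le => eps eps0.
pose A := 2 * B * T * (jump_count x 0 T)%:R.
have A0 : 0 <= A by rewrite !mulr_ge0 // ltW.
exists (maxn (Num.bound (T / e)).+1 (Num.bound (A / eps)).+1) => // n /=.
rewrite geq_max => /andP[n1 n2].
have n0 : (0 < n)%N by apply: leq_trans n1.
have nR : 0 < (n%:R : R) by rewrite ltr0n.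
set h := T / n%:R; have h0 : 0 < h by rewrite divr_gt0.
have he : h < e.
  rewrite ltr_pdivrMr // mulrC -ltr_pdivrMr //; apply: lt_le_trans (archi_boundP _) _.
    by rewrite divr_ge0 // ltW.
  by rewrite ler_nat ltnW.
have gn : grid 0 h n = T by rewrite /grid /h mulrC divfK ?gt_eqF // add0r.
have := @grid_integral h e T n h0 he cell; rewrite gn => /(_ (lexx _)) [mf].
have iF := integrable_path mf.
rewrite Rintegral_itv_bndo_bndc // => err; apply: le_trans err _.
apply: le_trans (_ : 2 * B * h * (jump_count x 0 T)%:R <= _).
  have Bh : 0 <= 2 * B * h by rewrite mulr_ge0 ?[0 <= 2 * B]mulr_ge0 // ltW.
  rewrite ler_wpM2l // ler_nat.
  exact: (grid_count_le x_right x_left T0 n0).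
have -> : 2 * B * h * (jump_count x 0 T)%:R = A / n%:R by rewrite /A /h; ring.
rewrite ler_pdivrMr // mulrC -ler_pdivrMr //; apply: le_trans (ltW (archi_boundP _)) _.
  by rewrite divr_ge0 // ltW.
by rewrite ler_nat ltnW.
Qed.

End RiemannSums.

(** * From finite-dimensional laws to exponential moments *)

Section GridExpectation.
Variables (R : realType) (d N : nat) (rho : R) (b : site d -> bool).
Variables (disp : measure_display) (W : measurableType disp) (P : probability W R).
Variable eta : R -> W -> config d N.
Hypothesis proc : FA1f_process rho b P eta.
Implicit Types (xi : nat -> config d N) (w : W).

Lemma measurable_state (A : config d N -> R) t : 0 <= t ->
  measurable_fun setT (fun w => A (eta t w)).
Proof.
move=> t0.
rewrite (_ : (fun w => _) = fun w => \sum_(z : config d N) A z * \1_[set w' | eta t w' = z] w).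
  apply: measurable_sum => z; apply: measurable_funM; first exact: measurable_cst.
  by apply: measurable_indic; exact: (FA1f_measurable proc).
apply/funext => w; rewrite (bigD1 (eta t w)) //= indicE mem_set // mulr1 big1 ?addr0 // => z zw.
rewrite indicE memNset ?mulr0 // => e; move/eqP: zw; apply; exact/esym.
Qed.

Lemma measurable_state2 (A : config d N -> config d N -> R) s t : 0 <= s -> 0 <= t ->
  measurable_fun setT (fun w => A (eta s w) (eta t w)).
Proof.
move=> s0 t0.
rewrite (_ : (fun w => _) = fun w => \sum_(z : config d N) (eta s w == z)%:R * A z (eta t w)).
  apply: measurable_sum => z; apply: measurable_funM.
    exact: (measurable_state (fun y => (y == z)%:R)).
  exact: (measurable_state (fun y => A z y)).
apply/funext => w; rewrite (bigD1 (eta s w)) //= eqxx mul1r big1 ?addr0 // => z /negbTE.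
by rewrite eq_sym => ->; rewrite mul0r.
Qed.

Variable wt : config d N -> config d N -> R.
Hypothesis wt_ge0 : forall x y, 0 <= wt x y.
Variable h : R.
Hypothesis h_ge0 : 0 <= h.

Local Notation t := (grid 0 h).

Definition weighted_step (f : config d N -> R) : config d N -> R := fun x =>
  \sum_y transition rho b h x y * (wt x y * f y).

Local Notation one := (fun _ : config d N => 1 : R).

Definition cylinder k xi : set W := [set w | forall j, (j <= k)%N -> eta (t j) w = xi j].

Let t_ge0 k : 0 <= t k. Proof. by rewrite /grid add0r mulr_ge0. Qed.

Lemma cylinderS k xi y :
  cylinder k.+1 (fun j => if (j <= k)%N then xi j else y) =
  cylinder k xi `&` [set w | eta (t k.+1) w = y].
Proof.
apply/seteqP; split=> w /=.
  move=> H; split=> [j jk|]; first by have := H j (leqW jk); rewrite jk.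
  by have := H k.+1 (leqnn _); rewrite ltnn.
move=> [H1 H2] j; rewrite leq_eqVlt ltnS => /predU1P[->|jk]; first by rewrite ltnn.
by rewrite jk H1.
Qed.

Lemma measurable_cylinder k xi : measurable (cylinder k xi).
Proof.
elim: k => [|k IH].
  rewrite (_ : cylinder 0 xi = [set w | eta (t 0%N) w = xi 0%N]).
    exact: (FA1f_measurable proc).
  apply/seteqP; split=> w /=; first exact.
  by move=> e j; rewrite leqn0 => /eqP ->.
rewrite (_ : cylinder k.+1 xi = cylinder k xi `&` [set w | eta (t k.+1) w = xi k.+1]).
  by apply: measurableI => //; exact: (FA1f_measurable proc).
apply/seteqP; split=> w /=.
  by move=> H; split=> [j jk|]; apply: H; rewrite // leqW.
by move=> [H1 H2] j; rewrite leq_eqVlt ltnS => /predU1P[->//|]; exact: H1.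
Qed.

Definition cylinder_prob k xi : R :=
  nu rho (xi 0%N) * \prod_(j < k) transition rho b h (xi j) (xi j.+1).

Lemma cylinderP k xi : P (cylinder k xi) = (cylinder_prob k xi)%:E.
Proof.
have t0 : t 0%N = 0 by rewrite /grid mul0r addr0.
have tS j : t j <= t j.+1 by rewrite gridS lerDl.
have := FA1f_markov proc k xi t0 tS; rewrite /cylinder => ->; congr (_ * _)%:E.
by apply: eq_bigr => j _; rewrite gridS addrAC subrr add0r.
Qed.

Definition path_weight k m w : R := \prod_(j < m) wt (eta (t (k + j)) w) (eta (t (k + j).+1) w).

Lemma path_weight_ge0 k m w : 0 <= path_weight k m w.
Proof. by apply: prodr_ge0. Qed.

Lemma measurable_path_weight k m : measurable_fun setT (path_weight k m).
Proof. by apply: measurable_prod => j _; exact: measurable_state2. Qed.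

Lemma path_weightS k m w :
  path_weight k m.+1 w = wt (eta (t k) w) (eta (t k.+1) w) * path_weight k.+1 m w.
Proof.
rewrite /path_weight big_ord_recl addn0; congr (_ * _); apply: eq_bigr => j _.
by rewrite /= /bump /= add1n addSnnS.
Qed.

(** Induction on the number [m] of remaining steps. The prescribed past [xi] is part of the
    statement because summing over the next state lengthens the cylinder by one step. *)
Lemma expectation_cylinder m k xi :
  (\int[P]_w (\1_(cylinder k xi) w * path_weight k m w)%:E =
   (cylinder_prob k xi * iter m weighted_step one (xi k))%:E)%E.
Proof.
elim: m k xi => [|m IH] k xi.
  rewrite mulr1 -cylinderP -[in RHS](setIT (cylinder k xi)) -integral_indic //.
    by apply: eq_integral => w _; rewrite /path_weight big_ord0 mulr1.
  exact: measurable_cylinder.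
pose xi' y j := if (j <= k)%N then xi j else y.
have E w : \1_(cylinder k xi) w * path_weight k m.+1 w =
   \sum_(y : config d N) wt (xi k) y * (\1_(cylinder k.+1 (xi' y)) w * path_weight k.+1 m w).
  rewrite path_weightS (bigD1 (eta (t k.+1) w)) //= [X in _ + X]big1 ?addr0.
    rewrite cylinderS indicI; case: (pselect (cylinder k xi w)) => hw; last first.
      by rewrite /= !indicE (memNset hw) !mul0r mulr0.
    rewrite /= !indicE !mem_set // !mul1r; congr (wt _ _ * _).
    exact: (hw k (leqnn _)).
  move=> y /eqP ny; rewrite cylinderS indicI /= [X in _ * (_ * X * _)]indicE memNset.
    by rewrite mulr0 mul0r mulr0.
  by move=> e; apply: ny; rewrite -e.
under eq_integral do rewrite E -sumEFin.
have mI y : measurable_fun setT (fun w => \1_(cylinder k.+1 (xi' y)) w * path_weight k.+1 m w).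
  apply: measurable_funM; last exact: measurable_path_weight.
  by apply: measurable_indic; exact: measurable_cylinder.
rewrite ge0_integral_sum //; last 2 first.
- move=> y; apply/measurable_EFinP; apply: measurable_funM => //; exact: measurable_cst.
- move=> y w _; rewrite lee_fin mulr_ge0 // mulr_ge0 ?path_weight_ge0 //.
rewrite iterS /weighted_step mulr_sumr -sumEFin; apply: eq_bigr => y _.
under eq_integral do rewrite EFinM.
rewrite ge0_integralZl_EFin //; last 2 first.
- by move=> w _; rewrite lee_fin mulr_ge0 // path_weight_ge0.
- exact/measurable_EFinP.
rewrite IH -EFinM; congr (_%:E).
have -> : cylinder_prob k.+1 (xi' y) = cylinder_prob k xi * transition rho b h (xi k) y.
  rewrite /cylinder_prob big_ord_recr /= {1}/xi' /= mulrA; congr (_ * _ * _).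
    by apply: eq_bigr => j _; rewrite /xi' ltnW ?ltn_ord // ltn_ord.
  by rewrite /xi' leqnn ltnn.
rewrite {1}/xi' ltnn; ring.
Qed.

Lemma expectation_grid n :
  (\int[P]_w (\prod_(k < n) wt (eta (t k) w) (eta (t k.+1) w))%:E =
   (nu_mean rho (iter n weighted_step one))%:E)%E.
Proof.
have E w : \prod_(k < n) wt (eta (t k) w) (eta (t k.+1) w) =
   \sum_(y : config d N) \1_(cylinder 0 (fun _ => y)) w * path_weight 0 n w.
  rewrite (bigD1 (eta (t 0%N) w)) //= [X in _ + X]big1 ?addr0.
    rewrite indicE mem_set ?mul1r // => j; rewrite leqn0 => /eqP -> //.
  move=> y /eqP ny; rewrite indicE memNset ?mul0r //.
  by move=> /(_ 0%N (leqnn _)) e; apply: ny; rewrite -e.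
under eq_integral do rewrite E -sumEFin.
have mI y : measurable_fun setT (fun w => \1_(cylinder 0 (fun _ => y)) w * path_weight 0 n w).
  apply: measurable_funM; last exact: measurable_path_weight.
  by apply: measurable_indic; exact: measurable_cylinder.
rewrite ge0_integral_sum //; last 2 first.
- by move=> y; apply/measurable_EFinP.
- by move=> y w _; rewrite lee_fin mulr_ge0 ?path_weight_ge0.
rewrite /nu_mean -sumEFin; apply: eq_bigr => y _.
by rewrite expectation_cylinder /cylinder_prob big_ord0 mulr1.
Qed.

End GridExpectation.

Lemma limn_einf_le_cvg (R : realType) (u : nat -> \bar R) (v : nat -> R) (l : R) :
  (\forall n \near \oo, (u n <= (v n)%:E)%E) -> v n @[n --> \oo] --> l ->
  (limn_einf u <= l%:E)%E.
Proof.
move=> uv vl; apply/lee_addgt0Pr => e e0; rewrite limn_einf_lim -EFinD.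
apply: lime_le; first exact: is_cvg_einfs.
have vle : \forall n \near \oo, v n <= l + e.
  move/cvgrPdist_lt: vl => /(_ e e0); apply: filterS => n.
  by rewrite ltr_distl => /andP[]; lra.
apply: filterS2 uv vle => n h1 h2; apply: le_trans (_ : (u n <= _)%E).
  by apply: ereal_inf_lbound; exists n => //=.
by apply: le_trans h1 _; rewrite lee_fin.
Qed.

Lemma cvg_invr_nat (R : realType) : n%:R^-1 @[n --> \oo] --> (0 : R).
Proof.
apply/cvgrPdist_le => e e0; exists (Num.bound e^-1).+1 => // n /= hn.
have n0 : 0 < (n%:R : R) by rewrite ltr0n; apply: leq_trans hn.
rewrite sub0r normrN ger0_norm ?invr_ge0 ?ler0n // -[e]invrK lef_pV2 ?posrE ?invr_gt0 //.
apply: le_trans (ltW (archi_boundP _)) _; first by rewrite invr_ge0 ltW.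
by rewrite ler_nat ltnW.
Qed.

Section ExponentialMoments.
Variables (R : realType) (d N : nat) (rho : R) (b : site d -> bool).
Hypothesis hrho : 0 < rho < 1.
Variables (disp : measure_display) (W : measurableType disp) (P : probability W R).
Variable eta : R -> W -> config d N.
Hypothesis proc : FA1f_process rho b P eta.
Implicit Types (w : W) (lam K T : R) (G : config d N -> R).

Local Notation nuE := (nu_mean rho).
Local Notation one := (fun _ : config d N => 1 : R).
Local Notation form_le lam G K := (forall f : config d N -> R,
  nuE (fun x => f x * tilted_generator rho b lam G f x) <= K * nuE (fun x => f x ^+ 2)).

Let pr w t : 0 <= t -> \forall s \near t^'+, eta s w = eta t w.
Proof. exact: (FA1f_right_continuous proc). Qed.

Let pl w t : 0 < t -> exists xi, \forall s \near t^'-, eta s w = xi.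
Proof. exact: (FA1f_left_limits proc). Qed.

Let G_le G (z : config d N) : `|G z| <= \sum_y `|G y|.
Proof. by rewrite (bigD1 z) //= lerDl sumr_ge0. Qed.

Definition grid_weight lam G T (n : nat) w : R :=
  expR (riemann_sum (eta^~ w) G T n + lam * (grid_count (eta^~ w) T n)%:R).

Definition path_weight_lim lam G T w : R :=
  expR (time_integral eta T G w + lam * activity eta T w).

Lemma grid_weightE lam G T n w : grid_weight lam G T n w =
  \prod_(k < n) step_weight lam G (T / n%:R) (eta (grid 0 (T / n%:R) k) w)
                                             (eta (grid 0 (T / n%:R) k.+1) w).
Proof.
rewrite /step_weight -expR_sum; congr expR.
rewrite big_split /=; congr (_ + _); by rewrite -mulr_sumr -natr_sum.
Qed.

Lemma measurable_grid_weight lam G T n : 0 <= T -> measurable_fun setT (grid_weight lam G T n).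
Proof.
move=> T0; rewrite (_ : grid_weight lam G T n = fun w =>
  \prod_(k < n) step_weight lam G (T / n%:R) (eta (grid 0 (T / n%:R) k) w)
                                             (eta (grid 0 (T / n%:R) k.+1) w)); last first.
  by apply/funext => w; exact: grid_weightE.
have g0 k : 0 <= grid 0 (T / n%:R) k by rewrite /grid add0r mulr_ge0 // divr_ge0.
by apply: measurable_prod => k _; apply: (measurable_state2 proc).
Qed.

Lemma mean_grid_weight lam G T n : 0 <= T ->
  (\int[P]_w (grid_weight lam G T n w)%:E =
   (nuE (iter n (tilted_step rho b lam G (T / n%:R)) one))%:E)%E.
Proof.
move=> T0; under eq_integral do rewrite grid_weightE.
have h0 : 0 <= T / n%:R by rewrite divr_ge0.
have wt0 x y : 0 <= step_weight lam G (T / n%:R) x y by exact: expR_ge0.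
exact: (expectation_grid proc wt0 h0).
Qed.

Lemma grid_weight_cvg lam G T w : 0 < T ->
  grid_weight lam G T n w @[n --> \oo] --> path_weight_lim lam G T w.
Proof.
move=> T0; apply: continuous_cvg; first exact: continuous_expR.
apply: cvgD.
  exact: (riemann_sum_cvg (@pr w) (@pl w) (G_le G) T0).
apply: cvgM; first exact: cvg_cst.
apply: cvg_near_cst.
by apply: filterS (grid_count_eq (@pr w) (@pl w) T0) => n ->.
Qed.

Lemma measurable_path_weight_lim lam G T : 0 < T ->
  measurable_fun setT (path_weight_lim lam G T).
Proof.
move=> T0; apply: (@measurable_fun_cvg _ _ _ _ (grid_weight lam G T)).
  by move=> n; apply: measurable_grid_weight; exact: ltW.
by move=> w _; exact: grid_weight_cvg.
Qed.

Lemma measurable_time_integral G T : 0 < T -> measurable_fun setT (time_integral eta T G).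
Proof.
move=> T0; apply: (@measurable_fun_cvg _ _ _ _ (fun n w => riemann_sum (eta^~ w) G T n)).
  move=> n; apply: measurable_sum => k; apply: measurable_funM; first exact: measurable_cst.
  apply: (measurable_state proc); rewrite /grid add0r mulr_ge0 // divr_ge0 // ltW //.
by move=> w _; exact: (riemann_sum_cvg (@pr w) (@pl w) (G_le G) T0).
Qed.

(** Fatou's lemma gives an upper bound without prior integrability of the limit; the finiteness of
    the exponential moments is then deduced from this bound. *)
Lemma mean_path_weight_le lam G K T : 0 < T -> form_le lam G K ->
  (\int[P]_w (path_weight_lim lam G T w)%:E <= (expR (T * K))%:E)%E.
Proof.
move=> T0 hK.
have -> : (\int[P]_w (path_weight_lim lam G T w)%:E =
    \int[P]_w limn_einf (fun n => (grid_weight lam G T n w)%:E))%E.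
  apply: eq_integral => w _; apply/esym; apply: (cvg_limn_einf_sup _).1.
  by apply: cvg_EFin; [exact: nearW|exact: grid_weight_cvg].
apply: le_trans (fatou P measurableT _ _) _.
- by move=> n; apply/measurable_EFinP; apply: measurable_grid_weight; exact: ltW.
- by move=> n w _; rewrite lee_fin expR_ge0.
pose C := norm_cst rho lam G.
(* The quadratic errors of [n] steps of length [T / n] add up to a multiple of [T ^+ 2 / n]. *)
apply: (@limn_einf_le_cvg _ _ (fun n => expR (T * K + C / 2 * T ^+ 2 * n%:R^-1))).
  have h0 := step_max_gt0 G.
  exists (Num.bound (T / step_max G)).+1 => // n /= hn.
  have n0 : 0 < (n%:R : R) by rewrite ltr0n; apply: leq_trans hn.
  rewrite (mean_grid_weight _ _ _ (ltW T0)) lee_fin.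
  have hh : 0 <= T / n%:R <= step_max G.
    rewrite divr_ge0 ?(ltW T0) //= ler_pdivrMr // mulrC -ler_pdivrMr //.
    apply: le_trans (ltW (archi_boundP _)) _; first by rewrite divr_ge0 // ltW.
    by rewrite ler_nat ltnW.
  apply: le_trans (mean_iter_step_le hrho hK n hh) _; rewrite ler_expR -/C.
  by rewrite le_eqVlt; apply/orP; left; apply/eqP; field; rewrite gt_eqF.
have e0 : (T * K + C / 2 * T ^+ 2 * n%:R^-1) @[n --> \oo] --> T * K + C / 2 * T ^+ 2 * 0.
  apply: cvgD; first exact: cvg_cst.
  apply: cvgM; first exact: cvg_cst.
  exact: cvg_invr_nat.
rewrite mulr0 addr0 in e0.
by apply: continuous_cvg => //; exact: continuous_expR.
Qed.

(** Far from sharp but valid for every tilt: it makes all exponential moments of the activity finite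
    and their growth rates bounded. *)
Lemma crude_form lam : form_le lam (fun _ => 0) (`|expR lam - 1| * #|{: box d N}|%:R).
Proof.
move=> f; rewrite tilted_form // [X in _ + X - _](_ : _ = 0); last first.
  rewrite (eq_nu_mean _ (g := fun _ : config d N => 0)) ?nu_mean_cst // => x.
  by rewrite mul0r.
rewrite addr0; apply: le_trans (_ : (expR lam - 1) *
    nuE (fun x => total_rate rho b x * f x ^+ 2) <= _).
  rewrite gerBl mulr_ge0 ?divr_ge0 ?expR_ge0 // sumr_ge0 // => i _.
  exact: dirichlet_ge0.
have t0 (x : config d N) : 0 <= total_rate rho b x <= #|{: box d N}|%:R.
  rewrite /total_rate sumr_ge0 => [/=|i _]; last exact: rate_ge0.
  apply: le_trans (ler_sum _ (fun i _ => rate_le1 b hrho x i)) _.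
  by rewrite sumr_const.
have H0 : 0 <= nuE (fun x => total_rate rho b x * f x ^+ 2).
  by apply: nu_mean_ge0 => // x; rewrite mulr_ge0 ?sqr_ge0 //; case/andP: (t0 x).
apply: le_trans (_ : `|expR lam - 1| * nuE (fun x => total_rate rho b x * f x ^+ 2) <= _).
  by rewrite ler_wpM2r // ler_norm.
rewrite -mulrA ler_wpM2l // -nu_meanZ; apply: ler_nu_mean => // x.
by rewrite ler_wpM2r ?sqr_ge0 //; case/andP: (t0 x).
Qed.

End ExponentialMoments.

(** * Existence of the free energy and bounds on it *)

Lemma cvg_subseq_le (R : realType) (u : nat -> R) (l : R) (s : nat -> nat) :
  (forall k, (k <= s k)%N) -> u n @[n --> \oo] --> l -> u (s k) @[k --> \oo] --> l.
Proof.
move=> hs /cvgrPdist_lt ul; apply/cvgrPdist_lt => e /ul[A _ hA].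
by exists A => // k /= Ak; apply: hA => /=; exact: leq_trans Ak (hs k).
Qed.

Lemma mul_near_le (R : realDomainType) (x s t p : R) :
  t - s <= x <= t + s -> t * p - s * `|p| <= x * p.
Proof.
move=> /andP[x1 x2]; rewrite lerBlDr -lerBlDl -mulrBl.
apply: le_trans (ler_norm _) _; rewrite normrM ler_wpM2r // ler_norml.
by apply/andP; split; lra.
Qed.

Section FreeEnergy.
Variables (R : realType) (d N : nat) (rho : R) (b : site d -> bool).
Hypothesis hrho : 0 < rho < 1.
Variables (disp : measure_display) (W : measurableType disp) (P : probability W R).
Variable eta : R -> W -> config d N.
Hypothesis proc : FA1f_process rho b P eta.
Implicit Types (w : W) (lam K T : R) (G : config d N -> R).

Local Notation nuE := (nu_mean rho).
Local Notation one := (fun _ : config d N => 1 : R).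
Local Notation zero := (fun _ : config d N => 0 : R).
Local Notation form_le lam G K := (forall f : config d N -> R,
  nuE (fun x => f x * tilted_generator rho b lam G f x) <= K * nuE (fun x => f x ^+ 2)).
Local Notation step lam := (tilted_step rho b lam zero).
Local Notation act := (activity eta).

Let pr w t : 0 <= t -> \forall s \near t^'+, eta s w = eta t w.
Proof. exact: (FA1f_right_continuous proc). Qed.

Let pl w t : 0 < t -> exists xi, \forall s \near t^'-, eta s w = xi.
Proof. exact: (FA1f_left_limits proc). Qed.

Definition exp_moment lam T : R := mean P (fun w => expR (lam * act T w)).

Lemma path_weight_lim0 lam T w : path_weight_lim eta lam zero T w = expR (lam * act T w).
Proof.
rewrite /path_weight_lim /time_integral Rintegral_cst //.
by rewrite mul0r add0r.
Qed.

Lemma measurable_exp_activity lam T : 0 < T ->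
  measurable_fun setT (fun w => expR (lam * act T w)).
Proof.
move=> T0; rewrite (_ : (fun w => _) = path_weight_lim eta lam zero T).
  exact: (measurable_path_weight_lim proc).
by apply/funext => w; rewrite path_weight_lim0.
Qed.

Lemma exp_activity_le lam K T : 0 < T -> form_le lam zero K ->
  (\int[P]_w (expR (lam * act T w))%:E <= (expR (T * K))%:E)%E.
Proof.
move=> T0 hK; apply: le_trans (mean_path_weight_le hrho proc T0 hK).
by under [in leRHS]eq_integral do rewrite path_weight_lim0.
Qed.

Lemma exp_momentE lam T : 0 < T ->
  (\int[P]_w (expR (lam * act T w))%:E = (exp_moment lam T)%:E)%E.
Proof.
move=> T0; rewrite /exp_moment /mean unlock fineK // ge0_fin_numE.
  by apply: le_lt_trans (exp_activity_le T0 (crude_form _ hrho lam)) _; rewrite ltry.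
by apply: integral_ge0 => w _; rewrite lee_fin expR_ge0.
Qed.

Lemma exp_moment_le lam K T : 0 < T -> form_le lam zero K ->
  exp_moment lam T <= expR (T * K).
Proof. by move=> T0 hK; rewrite -lee_fin -exp_momentE // exp_activity_le. Qed.

Lemma grid_weight0 lam T n w :
  grid_weight eta lam zero T n w = expR (lam * (grid_count (eta^~ w) T n)%:R).
Proof.
by rewrite /grid_weight /riemann_sum big1 ?add0r // => k _; rewrite mulr0.
Qed.

(** Fatou is one-sided, and lower bounds need genuine convergence. The dominating function has the
    tilt [|lam|] and is integrable by [crude_form]. *)
Lemma exp_moment_cvg lam T : 0 < T ->
  nuE (iter n (step lam (T / n%:R)) one) @[n --> \oo] --> exp_moment lam T.
Proof.
move=> T0; have := @dominated_convergence _ W R P setT measurableT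
  (fun n w => (grid_weight eta lam zero T n w)%:E)
  (fun w => (expR (lam * act T w))%:E) (fun w => (expR (`|lam| * act T w))%:E).
case.
- by move=> n; apply/measurable_EFinP; apply: (measurable_grid_weight proc); exact: ltW.
- by apply/measurable_EFinP; exact: measurable_exp_activity.
- apply: aeW => w _; apply: cvg_EFin; first exact: nearW.
  by have := @grid_weight_cvg R d N rho b disp W P eta proc lam zero T w T0;
    rewrite path_weight_lim0.
- apply/integrableP; split; first by apply/measurable_EFinP; exact: measurable_exp_activity.
  rewrite (eq_integral (fun w => (expR (`|lam| * act T w))%:E)) => [|w _].
    by rewrite exp_momentE // ltry.
  by rewrite gee0_abs // lee_fin expR_ge0.
- apply: aeW => w n _; rewrite gee0_abs ?lee_fin ?expR_ge0 // grid_weight0 ler_expR.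
  apply: le_trans (_ : `|lam| * (grid_count (eta^~ w) T n)%:R <= _).
    by rewrite ler_wpM2r // ler_norm.
  rewrite ler_wpM2l // /activity ler_nat.
  case: n => [|n]; first by rewrite /grid_count big_ord0.
  exact: (grid_count_le (@pr w) (@pl w) T0).
move=> _ _; rewrite exp_momentE // => h; move/fine_cvgP: h => [_].
apply: cvg_trans; rewrite (_ : fine \o _ = (fun n => nuE (iter n (step lam (T / n%:R)) one))) //.
by apply/funext => n /=; rewrite (mean_grid_weight proc) // ltW.
Qed.

Local Notation a lam := ((expR lam - 1) * nuE (total_rate rho b : config d N -> R)).

Lemma exp_moment_ge lam T : 0 < T -> expR (T * a lam) <= exp_moment lam T.
Proof.
move=> T0; have [C [h1 [h10 hC]]] := mean_iter_step_ge N b hrho lam.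
have pow2 k : (k <= 2 ^ k)%N by apply: ltnW; exact: ltn_expl.
have sub := cvg_subseq_le pow2 (@exp_moment_cvg lam T T0).
have inv := cvg_subseq_le pow2 (@cvg_invr_nat R).
have low : expR (T * a lam - C * T ^+ 2 * ((2 ^ k)%:R : R)^-1) @[k --> \oo] --> expR (T * a lam).
  apply: continuous_cvg; first exact: continuous_expR.
  have e : T * a lam = T * a lam - C * T ^+ 2 * 0 by rewrite mulr0 subr0.
  rewrite [X in _ --> X]e.
  by apply: cvgB; [exact: cvg_cst|apply: cvgM; [exact: cvg_cst|]].
apply: (ler_cvg_to low sub).
exists (Num.bound (T / h1)).+1 => // k /= hk.
have k2 : 0 < ((2 ^ k)%:R : R) by rewrite ltr0n expn_gt0.
have hh : 0 <= T / (2 ^ k)%:R <= h1.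
  rewrite divr_ge0 ?(ltW T0) //= ler_pdivrMr // mulrC -ler_pdivrMr //.
  apply: le_trans (ltW (archi_boundP _)) _; first by rewrite divr_ge0 // ltW.
  by rewrite ler_nat; apply: leq_trans (pow2 k); exact: ltnW.
apply: le_trans (hC _ k hh); rewrite ler_expR.
by rewrite le_eqVlt; apply/orP; left; apply/eqP; field; rewrite gt_eqF.
Qed.

Lemma exp_moment_mono lam S T : 0 < S -> S <= T ->
  if 0 <= lam then exp_moment lam S <= exp_moment lam T
  else exp_moment lam T <= exp_moment lam S.
Proof.
move=> S0 ST; have T0 : 0 < T := lt_le_trans S0 ST.
have mono w : act S w <= act T w.
  rewrite /activity ler_nat.
  have fS := finite_jumps (@pr w) (@pl w) (ltW S0).
  have fT : finite_set (jumps (eta^~ w) S T).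
    apply: sub_finite_set (finite_jumps (@pr w) (@pl w) (ltW T0)) => v [/andP[h1 h2] h3].
    by split=> //; rewrite h2 andbT (lt_trans S0).
  have [_] := jump_countD (ltW S0) ST fS fT.
  by rewrite /jump_count => ->; rewrite leq_addr.
have le (l1 l2 T1 T2 : R) : 0 < T1 -> 0 < T2 ->
    (forall w, lam * act T1 w <= lam * act T2 w) -> exp_moment lam T1 <= exp_moment lam T2.
  move=> T10 T20 h; rewrite -lee_fin -(exp_momentE lam T10) -(exp_momentE lam T20).
  have e0 T' w : setT w -> (0 <= (expR (lam * act T' w))%:E)%E by rewrite lee_fin expR_ge0.
  have m1 := (measurable_EFinP _ _).2 (@measurable_exp_activity lam _ T10).
  have m2 := (measurable_EFinP _ _).2 (@measurable_exp_activity lam _ T20).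
  apply: (@ge0_le_integral _ _ _ P setT measurableT _ _ (e0 T1) m1 m2) => w _.
  by rewrite lee_fin ler_expR.
case: (leP 0 lam) => hl.
  by apply: le => // w; rewrite ler_wpM2l.
by apply: le => // w; rewrite ler_wnM2l // ltW.
Qed.

(** The mesh [T / (2 * n)] makes the steps up to time [m.+1 * T] split into [m * n] and [m.+2 * n]
    whole steps. The conditional supplies the value 1 at time 0, since [exp_moment_cvg] concerns
    positive times. *)
Lemma exp_moment_logconvex lam T m : 0 < T ->
  exp_moment lam (m.+1%:R * T) ^+ 2 <=
  (if m == 0%N then 1 else exp_moment lam (m%:R * T)) * exp_moment lam (m.+2%:R * T).
Proof.
move=> T0.
pose V p n := nuE (iter (p * (2 * n)) (step lam (T / (2 * n)%:R)) one).
have V_cvg p : (0 < p)%N -> V p n @[n --> \oo] --> exp_moment lam (p%:R * T).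
  move=> p0; have pT : 0 < p%:R * T by rewrite mulr_gt0 // ltr0n.
  have hs n : (n <= p * (2 * n))%N by rewrite mulnA leq_pmull // muln_gt0 p0.
  have cv := cvg_subseq_le hs (@exp_moment_cvg lam (p%:R * T) pT).
  suff -> : V p = (fun n => nuE (iter (p * (2 * n)) (step lam (p%:R * T / (p * (2 * n))%:R)) one)).
    exact: cv.
  apply/funext => n; rewrite /V; congr (nuE (iter _ (step _ _) _)).
  rewrite [(p * _)%:R]natrM [in RHS]invfM mulrACA mulfV ?mul1r // pnatr_eq0; exact: lt0n_neq0.
have V0 n : V 0%N n = 1 by rewrite /V mul0n nu_mean_cst.
have V_cvg' : V m n @[n --> \oo] --> (if m == 0%N then 1 else exp_moment lam (m%:R * T)).
  case: (posnP m) => [->|m0]; last exact: V_cvg.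
  rewrite (_ : V 0%N = fun _ => 1); first exact: cvg_cst.
  by apply/funext => n; rewrite V0.
have CS n : V m.+1 n ^+ 2 <= V m n * V m.+2 n.
  have h0 : 0 <= T / (2 * n)%:R by rewrite divr_ge0 // ltW.
  have := mean_iter_step_CS N b hrho lam (m * n) (m.+2 * n) h0.
  rewrite /V.
  have -> : (m * n + m.+2 * n = m.+1 * (2 * n))%N by lia.
  have -> : (m * n + m * n = m * (2 * n))%N by lia.
  by have -> : (m.+2 * n + m.+2 * n = m.+2 * (2 * n))%N by lia.
apply: (ler_cvg_to _ (cvgM V_cvg' (V_cvg m.+2 isT))); last by apply: nearW; exact: CS.
exact: cvgM (V_cvg m.+1 isT) (V_cvg m.+1 isT).
Qed.

Lemma exp_moment_gt0 lam T : 0 < T -> 0 < exp_moment lam T.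
Proof. by move=> T0; apply: lt_le_trans (exp_moment_ge lam T0); exact: expR_gt0. Qed.

(** By log-convexity the ratios of successive moments are nondecreasing, hence at least the first
    ratio [U 1 / U 0], and [U 0] is 1. *)
Lemma exp_moment_pow lam T m : 0 < T -> (0 < m)%N ->
  exp_moment lam T ^+ m <= exp_moment lam (m%:R * T).
Proof.
move=> T0; pose U n := if n == 0%N then 1 else exp_moment lam (n%:R * T).
have U0 n : 0 < U n.
  rewrite /U; case: eqVneq => // n0; apply: exp_moment_gt0.
  by rewrite mulr_gt0 // ltr0n lt0n.
have logU n : U n.+1 ^+ 2 <= U n * U n.+2 by exact: exp_moment_logconvex.
have ratio n : U n * U 1%N <= U n.+1.
  elim: n => [|n IH]; first by rewrite {1}/U mul1r.
  rewrite -(ler_pM2l (U0 n)); apply: le_trans (logU n).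
  by rewrite expr2 mulrCA ler_wpM2l // ltW.
have pow n : U 1%N ^+ n <= U n.
  elim: n => [|n IH]; first by rewrite expr0.
  by rewrite exprSr; apply: le_trans (ratio n); rewrite ler_wpM2r // ltW.
by case: m => // m _; have := pow m.+1; rewrite /U /= mul1r.
Qed.

Local Notation rate_of lam T := (T^-1 * ln (exp_moment lam T)).

Lemma rate_le lam K T : 0 < T -> form_le lam zero K -> rate_of lam T <= K.
Proof.
move=> T0 hK; rewrite mulrC ler_pdivrMr // -[leRHS]expRK mulrC ler_ln ?posrE ?expR_gt0 //.
  exact: exp_moment_le.
exact: exp_moment_gt0.
Qed.

Lemma rate_ge lam T : 0 < T -> a lam <= rate_of lam T.
Proof.
move=> T0; rewrite [_^-1 * _]mulrC ler_pdivlMr // -[leLHS]expRK [_ * T]mulrC ler_ln ?posrE ?expR_gt0 //.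
  exact: exp_moment_ge.
exact: exp_moment_gt0.
Qed.

(** The time [T] is rounded to a multiple of [S], down for nonnegative [lam] and up for negative
    [lam], as the monotonicity of the moments dictates. The rounding error is at most [S], whence
    the correction. *)
Lemma ln_exp_moment_ge lam S T : 0 < S -> S <= T ->
  T * rate_of lam S - S * `|rate_of lam S| <= ln (exp_moment lam T).
Proof.
move=> S0 ST; have T0 : 0 < T := lt_le_trans S0 ST.
set p := rate_of lam S.
have [m m1 m2] : exists2 m : nat, m%:R <= T / S & T / S < m.+1%:R.
  by have /andP[] := truncn_itv (ltW (divr_gt0 T0 S0)); eexists; eassumption.
have m0 : (0 < m)%N by rewrite -ltnS -(ltr_nat R); apply: le_lt_trans m2; rewrite ler_pdivlMr ?mul1r.
rewrite ler_pdivlMr // in m1; rewrite ltr_pdivrMr // in m2.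
have lnp n : (0 < n)%N -> n%:R * S * p <= ln (exp_moment lam (n%:R * S)).
  move=> n0; rewrite -mulrA /p mulVKf ?gt_eqF // mulr_natl.
  rewrite -lnXn ?exp_moment_gt0 // ler_ln ?posrE ?exprn_gt0 ?exp_moment_gt0 //.
    exact: exp_moment_pow.
  by rewrite mulr_gt0 // ltr0n.
have mS0 : 0 < m%:R * S by rewrite mulr_gt0 // ltr0n.
have mono : ln (exp_moment lam (m%:R * S)) <= ln (exp_moment lam T) \/
    ln (exp_moment lam (m.+1%:R * S)) <= ln (exp_moment lam T).
  have h1 := exp_moment_mono lam mS0 m1.
  have h2 := exp_moment_mono lam T0 (ltW m2).
  case: ifP h1 h2 => _ h1 h2; [left|right]; rewrite ler_ln ?posrE ?exp_moment_gt0 //.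
  by rewrite mulr_gt0 // ltr0n.
have e : m.+1%:R * S = m%:R * S + S by rewrite -natr1 mulrDl mul1r.
rewrite e in m2; case: mono => h; apply: le_trans h.
  by apply: le_trans (lnp m m0); apply: mul_near_le; rewrite lerBlDr (ltW m2) (le_trans m1) // lerDl ltW.
by apply: le_trans (lnp m.+1 isT); apply: mul_near_le; rewrite e lerD2r m1 andbT (le_trans _ (ltW m2)) // gerBl ltW.
Qed.

(** Fekete's argument: a nearly optimal time [S] controls all large [T], so the limit is the
    supremum. *)
Lemma rate_cvg lam : exists2 L, rate_of lam T @[T --> +oo] --> L &
  forall T, 0 < T -> rate_of lam T <= L.
Proof.
pose E := [set rate_of lam T | T in [set T | 0 < T]].
have supE : has_sup E.
  split; first by exists (rate_of lam 1), 1 => //=.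
  by exists (`|expR lam - 1| * #|{: box d N}|%:R) => _ [T T0 <-]; apply: rate_le => //; exact: crude_form.
have ub T : 0 < T -> rate_of lam T <= sup E.
  by move=> T0; apply: sup_upper_bound => //; exists T.
exists (sup E) => //; apply/cvgrPdist_le => e e0.
have e2 : 0 < e / 2 by rewrite divr_gt0.
have [_ [S S0 <-] hS] := sup_adherent e2 supE; set p := rate_of lam S in hS.
exists (Num.max S (S * `|p| / (e / 2))); split; first exact: num_real.
move=> T; rewrite gt_max => /andP[ST pT]; have T0 : 0 < T := lt_trans S0 ST.
rewrite ger0_norm ?subr_ge0 ?ub //.
suff : p - e / 2 <= rate_of lam T by move: hS; lra.
have := ln_exp_moment_ge lam S0 (ltW ST); rewrite -/p => h.
rewrite [T^-1 * _]mulrC ler_pdivlMr //; apply: le_trans h.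
rewrite mulrBl [p * T]mulrC lerD2l lerN2; move: pT; rewrite ltr_pdivrMr // => /ltW.
by rewrite [T * _]mulrC.
Qed.

Lemma free_energy_ge lam : a lam <= free_energy P eta lam.
Proof.
have [L cL hL] := rate_cvg lam; rewrite /free_energy (cvg_lim _ cL) //.
exact: le_trans (rate_ge lam ltr01) (hL 1 ltr01).
Qed.

Lemma free_energy_le lam K : form_le lam zero K -> free_energy P eta lam <= K.
Proof.
move=> hK; have [L cL hL] := rate_cvg lam; rewrite /free_energy (cvg_lim _ cL) //.
rewrite -(cvg_lim _ cL) //; apply: limr_le; first by apply/cvg_ex; exists L.
by exists 0; split => // T T0; exact: rate_le.
Qed.

End FreeEnergy.

(** * Concentration under the tilted measure *)

Section TiltedMeasure.
Variables (R : realType) (d N : nat) (rho : R) (b : site d -> bool).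
Hypothesis hrho : 0 < rho < 1.
Variables (disp : measure_display) (W : measurableType disp) (P : probability W R).
Variable eta : R -> W -> config d N.
Hypothesis proc : FA1f_process rho b P eta.
Implicit Types (w : W) (lam K T : R) (G : config d N -> R).

Local Notation nuE := (nu_mean rho).
Local Notation form_le lam G K := (forall f : config d N -> R,
  nuE (fun x => f x * tilted_generator rho b lam G f x) <= K * nuE (fun x => f x ^+ 2)).
Local Notation a lam := ((expR lam - 1) * nuE (total_rate rho b : config d N -> R)).
Local Notation Z lam T w := (expR (lam * activity eta T w)).

Lemma time_integralZ (c : R) G T w : 0 < T ->
  time_integral eta T (fun x => c * G x) w = c * time_integral eta T G w.
Proof.
move=> T0.
have pr t : 0 <= t -> \forall s \near t^'+, eta s w = eta t w.
  exact: (FA1f_right_continuous proc).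
have pl t : 0 < t -> exists xi, \forall s \near t^'-, eta s w = xi.
  exact: (FA1f_left_limits proc).
have bd G' (z : config d N) : `|G' z| <= \sum_y `|G' y| :> R.
  by rewrite (bigD1 z) //= lerDl sumr_ge0.
have c1 := riemann_sum_cvg pr pl (bd (fun x => c * G x)) T0.
have c2 : riemann_sum (eta^~ w) (fun x => c * G x) T n @[n --> \oo] -->
    c * time_integral eta T G w.
  rewrite (_ : riemann_sum _ _ _ = fun n => c * riemann_sum (eta^~ w) G T n).
    apply: cvgM; first exact: cvg_cst.
    exact: (riemann_sum_cvg pr pl (bd G) T0).
  apply/funext => n; rewrite /riemann_sum mulr_sumr; apply: eq_bigr => k _; ring.
exact: (cvg_unique _ c1 c2).
Qed.

Lemma measurable_close_on_average T (f : config d N -> R) (m delta : R) : 0 < T ->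
  measurable (close_on_average eta T f m delta).
Proof.
move=> T0; have mI := measurable_time_integral proc (fun x => `|f x - m|) T0.
have := mI measurableT _ (measurable_itv `]-oo, (delta * T)]); rewrite setTI.
rewrite (_ : _ @^-1` _ = close_on_average eta T f m delta) //.
Qed.

(** On the complement the time integral exceeds [delta * T], so a factor
    [expR (s * (integral - delta * T))] can be inserted. This yields the moment with potential,
    while [exp_moment_ge] bounds the normalization from below. *)
Lemma tilted_complement lam K (f : config d N -> R) (m delta s T : R) : 0 < T -> 0 <= s ->
  form_le lam (fun x => s * `|f x - m|) K ->
  0 <= 1 - tilted P eta lam T (close_on_average eta T f m delta) <=
    expR (T * (K - s * delta - a lam)).
Proof.
move=> T0 s0 hK; set E := close_on_average _ _ _ _ _.
have mE : measurable E by exact: measurable_close_on_average.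
have mEC : measurable (~` E) by exact: measurableC.
have mZ := measurable_exp_activity proc lam T0.
have u0 := exp_moment_gt0 hrho proc lam T0.
have m1 (B : set W) : measurable B -> measurable_fun setT (fun w => (\1_B w * Z lam T w)%:E).
  by move=> mB; apply/measurable_EFinP; apply: measurable_funM => //; exact: measurable_indic.
have p1 (B : set W) w : setT w -> (0 <= (\1_B w * Z lam T w)%:E)%E.
  by move=> _; rewrite lee_fin mulr_ge0 ?expR_ge0.
pose I (B : set W) := (\int[P]_w (\1_B w * Z lam T w)%:E)%E.
have sumI : (I E + I (~` E) = (exp_moment P eta lam T)%:E)%E.
  rewrite -(exp_momentE hrho proc lam T0) /I.
  rewrite -(@ge0_integralD _ _ _ P setT measurableT _ _ (p1 E) (m1 E mE) (p1 (~` E)) (m1 _ mEC)).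
  apply: eq_integral => w _; rewrite -EFinD -mulrDl; congr (_%:E).
  have -> : \1_E w + \1_(~` E) w = 1 :> R.
    rewrite !indicE; case: (pselect (E w)) => h.
      by rewrite (mem_set h) memNset ?addr0 // => /(_ h).
    by rewrite (memNset h) (mem_set (h : (~` E) w)) add0r.
  by rewrite mul1r.
have I0 B : (0 <= I B)%E by apply: integral_ge0 => w; exact: p1.
have IC : (I (~` E) <= (expR (T * (K - s * delta)))%:E)%E.
  have := mean_path_weight_le hrho proc T0 hK.
  set G := fun x => s * _ => hG.
  have mpw := (measurable_EFinP _ _).2 (@measurable_path_weight_lim _ _ _ _ _ _ _ _ _ proc lam G T T0).
  have pw0 w : setT w -> (0 <= (path_weight_lim eta lam G T w)%:E)%E.
    by move=> _; rewrite lee_fin expR_ge0.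
  apply: le_trans (_ : (\int[P]_w ((expR (- (s * delta * T)))%:E *
     (path_weight_lim eta lam G T w)%:E) <= _)%E).
    apply: (@ge0_le_integral _ _ _ P setT measurableT _ _ (p1 (~` E)) (m1 _ mEC)
      (measurable_funeM _ mpw)).
    move=> w _; rewrite -EFinM lee_fin indicE; case: (pselect (E w)) => h.
      by rewrite memNset ?mul0r ?mulr_ge0 ?expR_ge0 // => /(_ h).
    rewrite (mem_set (h : (~` E) w)) mul1r /path_weight_lim -expRD ler_expR addrA lerDr.
    rewrite time_integralZ // addrC -mulrA -mulrBr mulr_ge0 // subr_ge0 ltW //.
    by rewrite ltNge; apply/negP.
  rewrite (@ge0_integralZl_EFin _ _ _ P setT measurableT _ pw0 mpw _ (expR_ge0 _)).
  apply: le_trans (lee_wpmul2l _ hG) _; first by rewrite lee_fin expR_ge0.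
  by rewrite -EFinM -expRD lee_fin ler_expR le_eqVlt; apply/orP; left; apply/eqP; ring.
have fC : I (~` E) \is a fin_num.
  by rewrite ge0_fin_numE //; apply: le_lt_trans IC _; rewrite ltry.
have fE : I E \is a fin_num.
  rewrite ge0_fin_numE //; apply: le_lt_trans (_ : (I E + I (~` E) < +oo)%E).
    by rewrite leeDl.
  by rewrite sumI ltry.
have eqr : fine (I E) + fine (I (~` E)) = exp_moment P eta lam T.
  by rewrite -fineD // sumI.
have -> : 1 - tilted P eta lam T E = fine (I (~` E)) / exp_moment P eta lam T.
  have -> : tilted P eta lam T E = fine (I E) / exp_moment P eta lam T.
    by rewrite /tilted /exp_moment /mean !unlock.
  rewrite -eqr in u0 *; rewrite -{1}(mulfV (lt0r_neq0 u0)) -mulrBl; congr (_ / _).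
  by rewrite addrAC subrr add0r.
apply/andP; split; first by rewrite divr_ge0 ?(ltW u0) //; exact: fine_ge0.
rewrite ler_pdivrMr //.
apply: le_trans (_ : expR (T * (K - s * delta)) <= _).
  by rewrite -lee_fin fineK.
apply: le_trans (_ : expR (T * (K - s * delta - a lam)) * expR (T * a lam) <= _).
  by rewrite -expRD -mulrDr subrK.
by rewrite ler_wpM2l ?expR_ge0 // (exp_moment_ge hrho proc lam T0).
Qed.

Lemma tilted_cvg1 lam K (f : config d N -> R) (m delta s : R) : 0 <= s ->
  form_le lam (fun x => s * `|f x - m|) K -> K - s * delta < a lam ->
  tilted P eta lam T (close_on_average eta T f m delta) @[T --> +oo] --> (1 : R).
Proof.
move=> s0 hK gap; pose c := a lam - (K - s * delta).
have c0 : 0 < c by rewrite subr_gt0.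
apply/cvgrPdist_le => e e0; exists (Num.max 0 (c * e)^-1); split; first exact: num_real.
move=> T; rewrite gt_max => /andP[T0 Te].
have /andP[h1 h2] := tilted_complement delta T0 s0 hK.
rewrite ger0_norm //; apply: le_trans h2 _.
have -> : T * (K - s * delta - a lam) = - (c * T) by rewrite /c; ring.
have cT : 0 < c * T by rewrite mulr_gt0.
rewrite expRN -[e]invrK lef_pV2 ?posrE ?expR_gt0 ?invr_gt0 //.
apply: le_trans (expR_ge1Dx _); apply: ler_wpDl => //.
move: Te; rewrite invfM => /ltW h; rewrite -(ler_pM2l (_ : 0 < c^-1)) ?invr_gt0 //.
by rewrite mulKf ?gt_eqF.
Qed.

End TiltedMeasure.

(** * Choice of the scales and conclusion *)

Section Diagonal.
Variable R : realType.

Lemma diagonal_sequence (Q : nat -> R -> Prop) :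
  (forall g, 0 < g -> \forall N \near \oo, Q N g) ->
  exists gamma : nat -> R, [/\ gamma @ \oo --> (0 : R), forall N, 0 < gamma N &
    \forall N \near \oo, Q N (gamma N)].
Proof.
move=> hQ.
have /choice[th hth] : forall k : nat, exists n : nat, forall N, (n <= N)%N -> Q N k.+1%:R^-1.
  move=> k; have [|n _ hn] := hQ k.+1%:R^-1; first by rewrite invr_gt0 ltr0n.
  by exists n => N nN; exact: hn.
(* [kap N] is the largest [k <= N] whose threshold [th k] has been passed by [N]; the cap [k <= N]
   guarantees that a largest one exists. *)
have /choice[kap hkap] : forall N, exists k, (th 0%N <= N)%N ->
    (th k <= N)%N /\ forall j, (j <= N)%N -> (th j <= N)%N -> (j <= k)%N.
  move=> N; have [h0|_] := leqP (th 0%N) N; last by exists 0%N.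
  have ex : exists k, (k <= N)%N && (th k <= N)%N by exists 0%N; rewrite h0.
  have ub k : (k <= N)%N && (th k <= N)%N -> (k <= N)%N by case/andP.
  case: (ex_maxnP ex ub) => k /andP[_ tk] kmax; exists k => _; split=> // j jN tj.
  by apply: kmax; rewrite jN.
exists (fun N => (kap N).+1%:R^-1); split.
- apply/cvgrPdist_le => e e0.
  pose k := Num.bound e^-1.
  exists (maxn k (maxn (th k) (th 0%N))) => // N /=.
  rewrite !geq_max => /andP[kN /andP[tk t0]].
  rewrite sub0r normrN ger0_norm ?invr_ge0 ?ler0n // -[e]invrK lef_pV2 ?posrE ?invr_gt0 ?ltr0n //.
  apply: le_trans (ltW (archi_boundP _)) _; first by rewrite invr_ge0 ltW.
  by rewrite ler_nat ltnW // ltnS; exact: (hkap N t0).2.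
- by move=> N; rewrite invr_gt0 ltr0n.
- by exists (th 0%N) => // N /= t0; apply: hth; exact: (hkap N t0).1.
Qed.

End Diagonal.

Section Tilts.
Variables (R : realType) (rho : R) (d c : nat).
Hypothesis hrho : 0 < rho < 1.
Hypothesis hd : (2 <= d)%N.
Hypothesis hc : (c <= d - 1)%N.

Local Notation nuE := (nu_mean rho).
Local Notation A := (mean_rate rho d).
Local Notation C0 := (path_cst rho).
Local Notation p := (d - c)%N.

(* The threshold makes the term C0 N^(d - c) of the functional inequality absorbable
   into the Dirichlet form. *)
Definition small_tilt : R := (16 * (C0 + 1))^-1.

Lemma small_tilt_gt0 : 0 < small_tilt.
Proof. by rewrite invr_gt0 mulr_gt0 // ltr_wpDl // path_cst_ge0. Qed.

Lemma small_tilt_C0 : small_tilt * C0 <= 1 / 16.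
Proof.
have h := path_cst_ge0 hrho; have h1 : 0 < C0 + 1 by rewrite ltr_wpDl.
by rewrite /small_tilt mulrC ler_pdivrMr ?mulr_gt0 //; lra.
Qed.

Lemma small_tilt_le : small_tilt <= 1 / 16.
Proof.
have h := path_cst_ge0 hrho; have h1 : 0 < C0 + 1 by rewrite ltr_wpDl.
by rewrite /small_tilt -div1r ler_pdivrMr ?mulr_gt0 //; lra.
Qed.

Lemma expR_sub1_le (x : R) : `|x| <= 1 / 2 -> `|expR x - 1| <= 2 * `|x|.
Proof.
move=> x2; have q := expR_quadratic x2.
have l2 : x ^+ 2 = `|x| * `|x| by rewrite -expr2 real_normK ?num_real.
have : `|x| * `|x| <= `|x| * (1 / 2) by rewrite ler_wpM2l.
have := ler_normD (expR x - (1 + x)) x; rewrite opprD addrA subrK.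
by move: q; rewrite l2 opprD addrA; lra.
Qed.

(** The Dirichlet coefficient [expR lam / 2] is at least [15 / 32], and the two deviations spend
    [1 / 8] each. For [lam >= 0] the total rate only costs [C * D], so smallness of [lam] suffices;
    for [lam < 0] it costs [(C0 * n + C) * D], which is where the lower bound on [lam * n] is
    spent. *)
Lemma absorb (lam s n C eps X D rate_dev dev : R) :
  0 <= X -> 0 <= D -> 0 <= C -> 0 <= n -> 0 <= s -> s * n <= small_tilt -> s * C <= 1 / 16 ->
  `|lam| <= 1 / 2 -> 2 * `|lam| * C <= 1 / 16 -> - small_tilt <= lam * n -> -1 / 16 <= lam ->
  rate_dev <= eps * X + C * D -> - rate_dev <= eps * X + (C0 * n + C) * D ->
  dev <= eps * X + (C0 * n + C) * D ->
  (expR lam - 1) * rate_dev + s * dev - expR lam / 2 * D <=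
    (`|expR lam - 1| + s) * eps * X.
Proof.
move=> X0 D0 C_0 n0 s0 sn sC lam2 lamC lamn lam16 r1 r2 r3.
have C00 := path_cst_ge0 hrho; have tC := small_tilt_C0.
have e1 := expR_ge1Dx lam.
have h3 : s * dev <= s * (eps * X) + 1 / 8 * D.
  apply: le_trans (_ : s * (eps * X + (C0 * n + C) * D) <= _); first by rewrite ler_wpM2l.
  rewrite mulrDr lerD2l mulrA ler_wpM2r //.
  have : s * n * C0 <= small_tilt * C0 by rewrite ler_wpM2r.
  by move: sC tC; rewrite mulrDr; lra.
set e := expR lam - 1.
have e_abs : `|e| <= 2 * `|lam| := expR_sub1_le lam2.
have eC : `|e| * C <= 1 / 16 by apply: le_trans lamC; rewrite ler_wpM2r.
have h1 : e * rate_dev <= `|e| * (eps * X) + 1 / 8 * D.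
  have [e0|e0] := leP 0 e.
    rewrite ger0_norm // in eC *; apply: le_trans (ler_wpM2l e0 r1) _.
    rewrite mulrDr lerD2l mulrA ler_wpM2r //; by move: eC; lra.
  have ne0 : 0 <= - e by rewrite oppr_ge0 ltW.
  have ele : - e <= - lam by rewrite /e; lra.
  rewrite ltr0_norm // in eC *; rewrite -mulrNN; apply: le_trans (ler_wpM2l ne0 r2) _.
  rewrite mulrDr lerD2l mulrA ler_wpM2r // mulrDr.
  have : - e * (C0 * n) <= - lam * (C0 * n) by rewrite ler_wpM2r // mulr_ge0.
  have : - lam * n * C0 <= small_tilt * C0 by rewrite ler_wpM2r // mulNr; lra.
  have -> : - lam * (C0 * n) = - lam * n * C0 by ring.
  by move: eC tC; lra.
have hD : 15 / 16 * D <= expR lam * D by rewrite ler_wpM2r //; lra.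
have -> : (`|e| + s) * eps * X = `|e| * (eps * X) + s * (eps * X) by ring.
by move: h1 h3 hD; rewrite [expR lam / 2 * D]mulrAC; lra.
Qed.

Local Notation Dsum b f := (\sum_i dirichlet rho b i f).

Lemma tilted_form_bound N (b : site d -> bool) (F : config d N -> R) (m eps C lam s : R) :
  0 <= C -> 0 <= s -> s * N%:R ^+ p <= small_tilt -> s * C <= 1 / 16 ->
  `|lam| <= 1 / 2 -> 2 * `|lam| * C <= 1 / 16 -> - small_tilt <= lam * N%:R ^+ p ->
  -1 / 16 <= lam ->
  (forall f, nuE (fun eta => `|F eta - m| * f eta ^+ 2) <=
     eps * N%:R ^+ d * nuE (fun eta => f eta ^+ 2) + (C0 * N%:R ^+ p + C) * Dsum b f) ->
  (forall f : config d N -> R,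
    nuE (fun eta => `|total_rate rho b eta - N%:R ^+ d * A| * f eta ^+ 2) <=
      eps * N%:R ^+ d * nuE (fun eta => f eta ^+ 2) + (C0 * N%:R ^+ p + C) * Dsum b f /\
    nuE (fun eta => (total_rate rho b eta - N%:R ^+ d * A) * f eta ^+ 2) <=
      eps * N%:R ^+ d * nuE (fun eta => f eta ^+ 2) + C * Dsum b f) ->
  forall f, nuE (fun eta => f eta * tilted_generator rho b lam (fun x => s * `|F x - m|) f eta) <=
    ((expR lam - 1) * (N%:R ^+ d * A) + (`|expR lam - 1| + s) * (eps * N%:R ^+ d)) *
    nuE (fun eta => f eta ^+ 2).
Proof.
move=> C_0 s0 sn sC lam2 lamC lamn lam16 hF hH f.
have := tilted_form b hrho (expR lam) f (fun x => s * `|F x - m|).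
rewrite /tilted_generator => ->.
set X := nuE (fun eta => f eta ^+ 2); set D := Dsum b f.
have [hH1 hH2] := hH f.
set rdev := nuE (fun eta => (total_rate rho b eta - N%:R ^+ d * A) * f eta ^+ 2) in hH2.
set dev := nuE (fun eta => `|F eta - m| * f eta ^+ 2).
have X0 : 0 <= X by apply: nu_mean_ge0 => // eta; exact: sqr_ge0.
have D0 : 0 <= D by apply: sumr_ge0 => i _; exact: dirichlet_ge0.
have eH : nuE (fun eta => total_rate rho b eta * f eta ^+ 2) = rdev + N%:R ^+ d * A * X.
  rewrite -nu_meanZ -nu_meanD; apply: eq_nu_mean => eta /=; ring.
have eF : nuE (fun eta => s * `|F eta - m| * f eta ^+ 2) = s * dev.
  by rewrite -nu_meanZ; apply: eq_nu_mean => eta /=; ring.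
have h1 : - rdev <= eps * N%:R ^+ d * X + (C0 * N%:R ^+ p + C) * D.
  apply: le_trans hH1; rewrite -mulN1r -nu_meanZ; apply: ler_nu_mean => // eta.
  by rewrite mulrA mulN1r ler_wpM2r ?sqr_ge0 // -normrN ler_norm.
rewrite eH eF.
have n0 : (0 : R) <= N%:R ^+ p by rewrite exprn_ge0.
have Y0 : 0 <= N%:R ^+ d * X by rewrite mulr_ge0 // exprn_ge0.
have hF' : dev <= eps * (N%:R ^+ d * X) + (C0 * N%:R ^+ p + C) * D by rewrite mulrA; exact: hF.
have := @absorb lam s (N%:R ^+ p) C eps (N%:R ^+ d * X) D rdev dev Y0 D0 C_0 n0 s0 sn sC lam2 lamC lamn lam16.
rewrite !mulrA -/X -/D in hH2 h1 hF' *; move=> /(_ hH2 h1 hF').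
rewrite -[X in X <= _ -> _](_ : (expR lam - 1) * (rdev + N%:R ^+ d * A * X) + s * dev -
    expR lam / 2 * D - (expR lam - 1) * (N%:R ^+ d * A) * X = _); last by ring.
rewrite lerBlDr => h; apply: le_trans h _.
by rewrite le_eqVlt; apply/orP; left; apply/eqP; ring.
Qed.

(** Everything the conclusion needs at one [N]: the forms bound growth rates from above, with each
    of the two potentials and without, and the last inequality makes the lower bound comparable,
    around the common value [(expR lam - 1) * (N%:R ^+ d * A)]. *)
Definition controlled N (b : site d -> bool) (eps lam s : R) : Prop :=
  let K s' := (expR lam - 1) * (N%:R ^+ d * A) + (`|expR lam - 1| + s') * (eps * N%:R ^+ d) in
  let form s' G := forall f : config d N -> R,
    nuE (fun eta => f eta * tilted_generator rho b lam G f eta) <=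
    K s' * nuE (fun eta => f eta ^+ 2) in
  [/\ form s (fun x => s * `|particles R x - N%:R ^+ d * rho|),
      form s (fun x => s * `|total_rate rho b x - N%:R ^+ d * A|),
      form 0 (fun=> 0) &
      (expR lam - 1) * (N%:R ^+ d * A) - `|expR lam - 1| * (eps * N%:R ^+ d) <=
      (expR lam - 1) * nuE (total_rate rho b : config d N -> R)].

(** The functional inequality at [f = 1], where the Dirichlet forms vanish, also compares the mean
    total rate with its bulk value. *)
Lemma total_rate_mean_bound N (b : site d -> bool) (X C1 : R) :
  (forall f : config d N -> R,
    nuE (fun eta => `|total_rate rho b eta - N%:R ^+ d * A| * f eta ^+ 2) <=
      X * nuE (fun eta => f eta ^+ 2) + C1 * Dsum b f) ->
  `|nuE (total_rate rho b : config d N -> R) - N%:R ^+ d * A| <= X.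
Proof.
move=> /(_ (fun=> 1)).
have -> : Dsum b (fun _ : config d N => 1) = 0.
  apply: big1 => i _; rewrite /dirichlet -[RHS](nu_mean_cst d N rho 0).
  by apply: eq_nu_mean => eta; rewrite subrr expr0n mulr0.
rewrite mulr0 addr0 expr1n nu_mean_cst mulr1; apply: le_trans.
rewrite -[X in _ - X](nu_mean_cst d N rho) -nu_meanB.
rewrite ler_norml; apply/andP; split.
  rewrite -mulN1r -nu_meanZ; apply: ler_nu_mean => // eta.
  by rewrite mulr1 mulN1r lerNl -normrN ler_norm.
by apply: ler_nu_mean => // eta; rewrite mulr1 ler_norm.
Qed.

Lemma controlled_near (M eps : R) : 0 < M -> 0 < eps ->
  \forall N \near \oo, forall b alpha, boundary_of_dim N c b -> - small_tilt < alpha ->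
    `|alpha| <= M ->
    `|scaled_tilt d c alpha N| <= 1 / 2 /\
    controlled N b eps (scaled_tilt d c alpha N) (scaled_tilt d c small_tilt N).
Proof.
move=> M0 e0.
have l0 : 'I_d := Ordinal (ltnW hd).
have [C1 [N1 [C10 h1]]] := asymptotic_particles hrho l0 e0.
have [C2 [N2 [C20 h2]]] := asymptotic_total_rate hrho l0 e0.
pose C := C1 + C2; have C_0 : 0 <= C by rewrite addr_ge0.
(* The summands enforce in turn [|lam| <= 1 / 2], [2 * |lam| * C <= 1 / 16], [s * C <= 1 / 16] and
   [1 <= N]. *)
pose B := 2 * M + 32 * (M * C) + C + 1.
have MC0 : 0 <= M * C by rewrite mulr_ge0 // ltW.
have B0 : 0 <= B by rewrite /B; lra.
exists (maxn (Num.bound B) (maxn N1 N2)) => // N /=.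
rewrite !geq_max => /andP[NB /andP[N1N N2N]] b alpha hb alpha0 alphaM.
have BN : B <= N%:R.
  by apply: le_trans (ltW (archi_boundP B0)) _; rewrite ler_nat.
have N1' : (1 : R) <= N%:R by move: BN; rewrite /B; lra.
(* This is where [c <= d - 1] enters: [N ^ (d - c)] is at least [N], so both tilts vanish as [N]
   grows. *)
have p1 : (1 <= p)%N.
  by rewrite subn_gt0 (leq_ltn_trans hc) // subn1 ltn_predL ltnW.
have t0 := small_tilt_gt0; have t16 := small_tilt_le.
set n := N%:R ^+ p : R.
have Nn : N%:R <= n by rewrite -[leLHS]expr1 ler_weXn2l.
have n0 : 0 < n by lra.
have MCn : 2 * M + 32 * (M * C) + C <= n by move: BN; rewrite /B; lra.
rewrite /scaled_tilt -/n.
have lam2 : `|alpha / n| <= 1 / 2.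
  by rewrite normrM normfV (gtr0_norm n0) ler_pdivrMr //; lra.
have lamC : 2 * `|alpha / n| * C <= 1 / 16.
  rewrite normrM normfV (gtr0_norm n0) -mulrA [_ / n * C]mulrAC mulrA ler_pdivrMr //.
  by have : `|alpha| * C <= M * C by [rewrite ler_wpM2r]; lra.
have lamn : - small_tilt <= alpha / n * n by rewrite divfK ?gt_eqF // ltW.
have lam16 : -1 / 16 <= alpha / n by rewrite ler_pdivlMr //; lra.
have sC : small_tilt / n * C <= 1 / 16.
  rewrite mulrAC ler_pdivrMr //.
  by have : small_tilt * C <= 1 / 16 * C by [rewrite ler_wpM2r]; lra.
have sn : small_tilt / n * n <= small_tilt by rewrite divfK // gt_eqF.
have s0 : 0 <= small_tilt / n by rewrite divr_ge0 // ltW.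
have D0 (f : config d N -> R) : 0 <= Dsum b f by apply: sumr_ge0 => i _; exact: dirichlet_ge0.
have hp (f : config d N -> R) : nuE (fun eta => `|particles R eta - N%:R ^+ d * rho| * f eta ^+ 2) <=
     eps * N%:R ^+ d * nuE (fun eta => f eta ^+ 2) + (C0 * n + C) * Dsum b f.
  have := h1 N c b N1N hb f; rewrite -/n => /le_trans; apply.
  by rewrite lerD2l ler_wpM2r // lerD2l lerDl.
have hr (f : config d N -> R) :
    nuE (fun eta => `|total_rate rho b eta - N%:R ^+ d * A| * f eta ^+ 2) <=
      eps * N%:R ^+ d * nuE (fun eta => f eta ^+ 2) + (C0 * n + C) * Dsum b f /\
    nuE (fun eta => (total_rate rho b eta - N%:R ^+ d * A) * f eta ^+ 2) <=
      eps * N%:R ^+ d * nuE (fun eta => f eta ^+ 2) + C * Dsum b f.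
  have := h2 N c b N2N hb f; rewrite -/n => -[q1 q2].
  split; [move: q1|move: q2] => /le_trans; apply; rewrite lerD2l ler_wpM2r //.
    by rewrite lerD2l lerDr.
  by rewrite lerDr.
split=> //; split.
- exact: (tilted_form_bound C_0 s0 sn sC lam2 lamC lamn lam16 hp hr).
- exact: (tilted_form_bound C_0 s0 sn sC lam2 lamC lamn lam16 (fun f => (hr f).1) hr).
- move=> f.
  have z0 : 0 <= (0 : R) by [].
  have zn : (0 : R) * n <= small_tilt by rewrite mul0r ltW.
  have zC : (0 : R) * C <= 1 / 16 by rewrite mul0r; lra.
  have := tilted_form_bound C_0 z0 zn zC lam2 lamC lamn lam16 hp hr f.
  suff -> : (fun x : config d N => 0 * `|particles R x - N%:R ^+ d * rho|) = (fun=> 0) by [].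
  by apply/funext => x; rewrite mul0r.
- have := total_rate_mean_bound (fun f => (hr f).1).
  set h := nuE _; set Y := _ * A => hY.
  rewrite lerBlDr -lerBlDl -mulrBr.
  apply: le_trans (ler_norm _) _; rewrite normrM ler_wpM2l // distrC //.
Qed.

(** The range of [alpha] widens as [g] decreases, so along a sequence tending to 0 every [alpha]
    above the threshold is eventually covered. The inequality is the gap required by [tilted_cvg1];
    the factor 2 comes from the errors in the upper and the lower growth rates. *)
Definition tilt_window N (g : R) : Prop :=
  forall b alpha, boundary_of_dim N c b -> - small_tilt < alpha -> `|alpha| <= g^-1 ->
  exists eps, controlled N b eps (scaled_tilt d c alpha N) (scaled_tilt d c small_tilt N) /\
    (2 * `|expR (scaled_tilt d c alpha N) - 1| + scaled_tilt d c small_tilt N) *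
      (eps * N%:R ^+ d) < scaled_tilt d c small_tilt N * (g * N%:R ^+ d).

Lemma tilt_window_near (g : R) : 0 < g -> \forall N \near \oo, tilt_window N g.
Proof.
move=> g0; have t0 := small_tilt_gt0.
have M0 : 0 < g^-1 by rewrite invr_gt0.
(* Multiplied by [N ^ (d - c)], the first factor of the gap is at most [4 / g + small_tilt]; the
   extra 2 in the denominator makes the inequality strict. *)
pose eps := small_tilt * g / (2 * (4 * g^-1 + small_tilt)).
have den0 : 0 < 2 * (4 * g^-1 + small_tilt) by lra.
have e0 : 0 < eps by rewrite divr_gt0 // mulr_gt0.
have he : (4 * g^-1 + small_tilt) * eps < small_tilt * g.
  have tg : 0 < small_tilt * g by rewrite mulr_gt0.
  by rewrite /eps mulrA ltr_pdivrMr // [ltLHS]mulrC ltr_pM2l //; lra.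
clearbody eps.
have := controlled_near M0 e0; apply: filterS2 (nbhs_infty_gt 0) => N /= N0 h b alpha hb h1 h2.
have [lam2 hc'] := h b alpha hb h1 h2; exists eps; split=> //.
have n0 : (0 : R) < N%:R ^+ p by rewrite exprn_gt0 // ltr0n.
rewrite !mulrA ltr_pM2r ?exprn_gt0 ?ltr0n // -(ltr_pM2r n0).
have e1 := expR_sub1_le lam2.
rewrite [ltRHS]mulrAC /scaled_tilt divfK ?gt_eqF //.
have e2 : `|expR (alpha / N%:R ^+ p) - 1| * N%:R ^+ p <= 2 * g^-1.
  apply: le_trans (ler_wpM2r (ltW n0) e1) _.
  by rewrite /scaled_tilt normrM normfV (gtr0_norm n0) -mulrA divfK ?gt_eqF // ler_pM2l.
rewrite [ltLHS]mulrAC mulrDl divfK ?gt_eqF //.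
by apply: le_lt_trans he; rewrite ler_pM2r //; lra.
Qed.

End Tilts.

Section FreeEnergy.
Variables (R : realType) (rho : R) (d c : nat) (b : nat -> site d -> bool).
Hypothesis hrho : 0 < rho < 1.
Hypothesis hd : (2 <= d)%N.
Hypothesis hc : (c <= d - 1)%N.
Hypothesis hb : forall N, (0 < N)%N -> boundary_of_dim N c (b N).
Variables (disp : nat -> measure_display) (W : forall N, measurableType (disp N)).
Variables (P : forall N, probability (W N) R) (eta : forall N, R -> W N -> config d N).
Hypothesis proc : forall N, (0 < N)%N -> FA1f_process rho (b N) (P N) (@eta N).
Local Notation A := (mean_rate rho d).
Local Notation p := (d - c)%N.

(** After division by [N ^ c] the upper and lower bounds have the same leading term. Replacing
    [expR lam - 1] by [lam] costs at most [2 * alpha ^+ 2 / N ^ (d - c)], which tends to 0. *)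
Lemma phi_eq (alpha : R) : - small_tilt rho < alpha ->
  phi c P eta alpha = (A * alpha)%:E.
Proof.
move=> ha.
suff h : (fun N => free_energy (P N) (@eta N) (scaled_tilt d c alpha N) / N%:R ^+ c) @ \oo -->
    A * alpha.
  apply: (cvg_limn_einf_sup _).2; apply: cvg_EFin; first exact: nearW.
  exact: h.
pose M := `|alpha| + 1.
have M0 : 0 < M by have := normr_ge0 alpha; rewrite /M; lra.
have aM : `|alpha| <= M by rewrite /M; lra.
have MM : 0 < 2 * M ^+ 2 by rewrite mulr_gt0 // exprn_gt0.
have Ai := mean_rate_itv d hrho.
apply/cvgrPdist_le => e e0.
have e1 : 0 < e / (4 * M) by rewrite divr_gt0 // mulr_gt0.
have near1 := controlled_near hrho hd hc M0 e1.
have near2 : \forall N \near \oo, (4 * M ^+ 2) / e <= N%:R :> R by exact: nbhs_infty_ger.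
apply: filterS3 (nbhs_infty_gt 0) near1 near2 => N /= N0 hN Ne.
have [lam2 [_ _ hK hL]] := hN (b N) alpha (hb N0) ha aM.
have := expR_quadratic lam2; have := expR_sub1_le lam2.
set lam := scaled_tilt d c alpha N in lam2 hK hL *.
set F := free_energy _ _ _; set E := expR lam - 1 => E1 E2.
have FK := free_energy_le hrho (proc N0) hK.
have FL := le_trans hL (free_energy_ge hrho (proc N0) lam).
rewrite -/E -/F addr0 in FK FL.
have Nd : (0 : R) < N%:R ^+ d by rewrite exprn_gt0 // ltr0n.
have Nc : (0 : R) < N%:R ^+ c by rewrite exprn_gt0 // ltr0n.
have Np : (0 : R) < N%:R ^+ p by rewrite exprn_gt0 // ltr0n.
have dcp : N%:R ^+ d = N%:R ^+ p * N%:R ^+ c :> R.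
  by rewrite -exprD subnK // (leq_trans hc) // leq_subr.
have NNp : N%:R <= N%:R ^+ p :> R.
  rewrite -[leLHS]expr1 ler_weXn2l ?ler1n // subn_gt0 (leq_ltn_trans hc) // subn1 ltn_predL.
  exact: ltnW.
have lamn : lam * N%:R ^+ p = alpha by rewrite /lam /scaled_tilt divfK ?gt_eqF.
have nlamn : `|lam| * N%:R ^+ p <= M.
  by rewrite -(gtr0_norm Np) -normrM lamn.
have FD : `|F - E * (N%:R ^+ d * A)| <= `|E| * (e / (4 * M) * N%:R ^+ d).
  by rewrite ler_norml; apply/andP; split; lra.
have F1 : `|F / N%:R ^+ c - E * N%:R ^+ p * A| <= e / 2.
  have -> : F / N%:R ^+ c - E * N%:R ^+ p * A = (F - E * (N%:R ^+ d * A)) / N%:R ^+ c.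
    by rewrite dcp; field; rewrite gt_eqF.
  rewrite normrM normfV (gtr0_norm Nc) ler_pdivrMr //; apply: le_trans FD _.
  have -> : `|E| * (e / (4 * M) * N%:R ^+ d) = `|E| * N%:R ^+ p * (e / (4 * M)) * N%:R ^+ c.
    by rewrite dcp; ring.
  rewrite ler_pM2r //.
  have EM : `|E| * N%:R ^+ p <= 2 * M.
    apply: le_trans (ler_wpM2r (ltW Np) E1) _.
    by rewrite -mulrA ler_pM2l.
  apply: le_trans (ler_wpM2r (ltW e1) EM) _.
  by rewrite le_eqVlt; apply/orP; left; apply/eqP; field; rewrite gt_eqF.
have F2 : `|E * N%:R ^+ p * A - A * alpha| <= e / 2.
  have -> : E * N%:R ^+ p * A - A * alpha = (expR lam - (1 + lam)) * N%:R ^+ p * A.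
    by rewrite -lamn /E; ring.
  case/andP: Ai => A0 A1.
  rewrite normrM normrM (gtr0_norm Np) (ger0_norm A0).
  apply: (@le_trans _ _ (`|expR lam - (1 + lam)| * N%:R ^+ p)).
    by rewrite ler_piMr // mulr_ge0 // ltW.
  apply: le_trans (ler_wpM2r (ltW Np) E2) _.
  rewrite -(ler_pM2r Np).
  have -> : 2 * lam ^+ 2 * N%:R ^+ p * N%:R ^+ p = 2 * alpha ^+ 2 by rewrite -lamn; ring.
  apply: (@le_trans _ _ (2 * M ^+ 2)).
    by rewrite ler_pM2l // -real_normK ?num_real // ler_pXn2r ?nnegrE // ltW.
  have : e * (4 * M ^+ 2 / e) <= e * N%:R ^+ p by rewrite ler_pM2l // (le_trans Ne).
  by rewrite mulrCA divff ?gt_eqF // mulr1; lra.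
rewrite distrC; have := ler_distD (E * N%:R ^+ p * A) (F / N%:R ^+ c) (A * alpha).
by move/le_trans; apply; lra.
Qed.

End FreeEnergy.

Theorem theorem2p5 (R : realType) (rho : R) (d c : nat)
    (b : nat -> site d -> bool)
    (hrho : 0 < rho < 1) (hd : (2 <= d)%N) (hc : (c <= d - 1)%N)
    (hb : forall N, (0 < N)%N -> boundary_of_dim N c (b N)) :
  exists (alpha0 : R) (gamma : nat -> R),
    [/\ alpha0 < 0, gamma @ \oo --> (0 : R) &
    forall (disp : nat -> measure_display)
      (W : forall N, measurableType (disp N))
      (P : forall N, probability (W N) R)
      (eta : forall N, R -> W N -> config d N),
      (forall N, (0 < N)%N -> FA1f_process rho (b N) (P N) (eta N)) ->
    forall alpha : R, alpha0 < alpha ->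
    [/\ phi c P eta alpha = (mean_rate rho d * alpha)%:E,
        iterated_limit (fun N T =>
          mu c P eta alpha T
            (close_on_average (eta N) T (@particles R d N)
               (N%:R ^+ d * rho) (gamma N * N%:R ^+ d))) 1 &
        iterated_limit (fun N T =>
          mu c P eta alpha T
            (close_on_average (eta N) T (@total_rate R d N rho (b N))
               (N%:R ^+ d * mean_rate rho d) (gamma N * N%:R ^+ d))) 1]].
Proof.
have [gamma [gamma0 gamma_gt0 window]] := diagonal_sequence (tilt_window_near hrho hd hc).
exists (- small_tilt rho), gamma; split=> //; first by rewrite oppr_lt0 small_tilt_gt0.
move=> disp W P eta proc alpha ha.
have gamma_small : \forall N \near \oo, `|alpha| <= (gamma N)^-1.
  have ha1 : 0 < (`|alpha| + 1)^-1 by rewrite invr_gt0; have := normr_ge0 alpha; lra.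
  move/cvgrPdist_le: gamma0 => /(_ _ ha1); apply: filterS => N /=.
  rewrite sub0r normrN (gtr0_norm (gamma_gt0 N)) => h.
  apply: (@le_trans _ _ (`|alpha| + 1)); first by rewrite lerDl.
  by rewrite -[leLHS]invrK lef_pV2 ?posrE.
have tilt0 N : 0 <= scaled_tilt d c (small_tilt rho) N.
  by rewrite divr_ge0 ?exprn_ge0 // ltW // small_tilt_gt0.
split; first exact: (@phi_eq R rho d c b).
(* For every large [N] the limit in [T] is already exactly 1. *)
- exists (fun=> 1); split; last exact: cvg_cst.
  apply: filterS3 (nbhs_infty_gt 0) window gamma_small => N /= N0 hN hg.
  have [eps [[h _ _ hL] lt]] := hN _ _ (hb N N0) ha hg.
  by apply: (tilted_cvg1 hrho (proc N N0) (tilt0 N) h); lra.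
- exists (fun=> 1); split; last exact: cvg_cst.
  apply: filterS3 (nbhs_infty_gt 0) window gamma_small => N /= N0 hN hg.
  have [eps [[_ h _ hL] lt]] := hN _ _ (hb N N0) ha hg.
  by apply: (tilted_cvg1 hrho (proc N N0) (tilt0 N) h); lra.
Qed.
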